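(* Let $\phi_0\in W^{1,\infty}(\mathbb{R}^n)$, $u_0=\nabla_x\phi_0$, and $\rho_0\in L^\infty(\mathbb{R}^n)$. For $\epsilon>0$ let $\phi_0^\epsilon=\phi_0*\eta^\epsilon$ and $\rho_0^\epsilon=\rho_0*\eta^\epsilon$, where $\eta^\epsilon$ is the usual Friedrichs mollifier in $x\in\mathbb{R}^n$. Define $$u^\epsilon(x,t)=\frac{\int_{\mathbb{R}^n}\nabla_y\phi_0^\epsilon(y)\,e^{-\frac1\epsilon\left[\frac{|x-y|^2}{2t}+\phi_0^\epsilon(y)\right]}dy}{\int_{\mathbb{R}^n}e^{-\frac1\epsilon\left[\frac{|x-y|^2}{2t}+\phi_0^\epsilon(y)\right]}dy},\qquad \rho^\epsilon(x,t)=\rho_0^\epsilon\big(X^\epsilon(x,t,0)\big)\,J^\epsilon(x,t,0),$$ where $X^\epsilon(x,t,s)$ is the solution of $\frac{dX^\epsilon(s)}{ds}=u^\epsilon(X^\epsilon(s),s)$ with $X^\epsilon(s=t)=x$, and $J^\epsilon(x,t,0)$ is the Jacobian determinant of $x\mapsto X^\epsilon(x,t,0)$. Then $(u^\epsilon,\rho^\epsilon)_{\epsilon>0}$ is a weak asymptotic solution of $$u_t+(u\cdot\nabla)u=0,\qquad \rho_t+\nabla\cdot(\rho u)=0,\qquad u(x,0)=u_0(x),\quad \rho(x,0)=\rho_0(x).$$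
   Context: The formula for $u^\epsilon$ is for $t>0$; $u^\epsilon(x,0)$ is understood as the limit as $t\to0^+$. A family of smooth functions $(u^\epsilon,\rho^\epsilon)_{\epsilon>0}$ is called a weak asymptotic solution of $u_t+(u\cdot\nabla)u=0$, $\rho_t+\nabla\cdot(\rho u)=0$ with initial data $u(x,0)=u_0(x)$, $\rho(x,0)=\rho_0(x)$ if each of the four quantities $$u^\epsilon_t+(u^\epsilon\cdot\nabla)u^\epsilon,\qquad \rho^\epsilon_t+\nabla\cdot(\rho^\epsilon u^\epsilon),\qquad u^\epsilon(x,0)-u_0(x),\qquad \rho^\epsilon(x,0)-\rho_0(x)$$ is $o_{\mathcal{D}'(\mathbb{R}^n)}(1)$, meaning that for every test function $\eta\in C_c^\infty(\mathbb{R}^n)$ (in the $x$ variable) its pairing with $\eta$ tends to $0$ as $\epsilon\to0$, uniformly in $t>0$ for the first two quantities. *)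

(* Defs.v *)
From HB Require Import structures.
From mathcomp Require Import all_boot all_order all_algebra.
From mathcomp Require Import all_classical all_reals all_analysis.

Set Implicit Arguments.
Unset Strict Implicit.
Unset Printing Implicit Defensive.

Import Order.TTheory GRing.Theory Num.Theory.
Import numFieldNormedType.Exports.

Local Open Scope classical_set_scope.
Local Open Scope ring_scope.

(* 'rV[R]_n carries the sigma-algebra generated by the coordinates, which is
   the Borel sigma-algebra of R^n (compare the instance on n.-tuple T). *)
Section measurable_rV.
Context {R : realType} {n : nat}.

Let coors (i : 'I_n) (x : 'rV[R]_n) : R := x ord0 i.

Let rV_set0 : g_sigma_preimage coors set0.
Proof. exact: sigma_algebra0. Qed.

Let rV_setC A : g_sigma_preimage coors A -> g_sigma_preimage coors (~` A).
Proof. exact: sigma_algebraC. Qed.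

Let rV_bigcup (F : _^nat) : (forall i, g_sigma_preimage coors (F i)) ->
  g_sigma_preimage coors (\bigcup_i (F i)).
Proof. exact: sigma_algebra_bigcup. Qed.

HB.instance Definition _ :=
  @isMeasurable.Build (measure_tuple_display default_measure_display)
  'rV[R]_n (g_sigma_preimage coors) rV_set0 rV_setC rV_bigcup.

Lemma measurable_coord (i : 'I_n) :
  measurable_fun [set: 'rV[R]_n] (fun x : 'rV[R]_n => x ord0 i).
Proof.
move=> _ Y mY; rewrite setTI; apply: sub_sigma_algebra => /=.
rewrite -bigcup_seq/=; exists i => /=; first by rewrite mem_index_enum.
by exists Y => //; rewrite setTI.
Qed.

Lemma measurable_fun_rVP d (T : measurableType d) (f : T -> 'rV[R]_n) :
  (forall i, measurable_fun [set: T] (fun x => f x ord0 i)) ->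
  measurable_fun [set: T] f.
Proof.
move=> mf.
apply: (@measurability _ _ _ _ _ _ (\big[setU/set0]_(i < n)
  preimage_set_system setT (coors i) measurable)) => //.
move=> _ [B + <-].
rewrite -bigcup_seq => -[i _ [C mC <-]].
rewrite setTI -comp_preimage; exact: mf.
Qed.

End measurable_rV.

Section lebesgue_measure_rV.
Context {R : realType}.

(* prepends a coordinate *)
Definition cons_rV n (p : R * 'rV[R]_n) : 'rV[R]_n.+1 :=
  \row_(i < n.+1) oapp (p.2 ord0) p.1 (unlift ord0 i).

Lemma measurable_cons_rV n :
  measurable_fun [set: (R * 'rV[R]_n)%type] (@cons_rV n).
Proof.
apply: measurable_fun_rVP => i.
rewrite (_ : (fun _ => _) = fun p : R * 'rV[R]_n =>
  oapp (p.2 ord0) p.1 (unlift ord0 i)); last by apply/funext => p; rewrite mxE.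
case: (unlift ord0 i) => [j|] /=; last exact: measurable_fst.
exact: (measurableT_comp (measurable_coord j) measurable_snd).
Qed.

Definition uncons_rV n (x : 'rV[R]_n.+1) : R * 'rV[R]_n :=
  (x ord0 ord0, \row_(i < n) x ord0 (lift ord0 i)).

Lemma measurable_uncons_rV n : measurable_fun [set: 'rV[R]_n.+1] (@uncons_rV n).
Proof.
apply/measurable_fun_pairP; split; first exact: measurable_coord.
apply: measurable_fun_rVP => i.
by under eq_fun do rewrite /= mxE; exact: measurable_coord.
Qed.

Lemma cons_rVK n : cancel (@cons_rV n) (@uncons_rV n).
Proof.
move=> [a x]; congr (_, _); first by rewrite mxE unlift_none.
by apply/rowP => i; rewrite !mxE liftK.
Qed.

Section product_step.
Context {n : nat} (m : {sigma_finite_measure set 'rV[R]_n -> \bar R}).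

Definition lebesgue_product : set 'rV[R]_n.+1 -> \bar R :=
  pushforward (@lebesgue_measure R \x m)%E (@cons_rV n).

Let pm : {measure set 'rV[R]_n.+1 -> \bar R} :=
  measure_function_pushforward__canonical__measure_function_Measure
    (@lebesgue_measure R \x m)%E (@measurable_cons_rV n).

HB.instance Definition _ := isMeasure.Build _ _ _ lebesgue_product
  (measure0 pm) (measure_ge0 pm) (@measure_semi_sigma_additive _ _ _ pm).

Let lebesgue_product_sigma_finite : sigma_finite setT lebesgue_product.
Proof.
have /sigma_finiteP[F [FT ndF Foo]] := sigma_finiteT (@lebesgue_measure R).
have /sigma_finiteP[G [GT ndG Goo]] := sigma_finiteT m.
exists (fun k => @uncons_rV n @^-1` (F k `*` G k)).
  rewrite -preimage_bigcup [X in _ @^-1` X](_ : _ = setT) ?preimage_setT//.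
  rewrite -setXTT FT GT predeqE => -[x y]; split.
    by move=> [k _ [/= Fx Gy]]; split; exists k.
  move=> [/= [i _ Fx] [j _ Gy]]; exists (maxn i j) => //; split.
    by move: x Fx; exact/subsetPset/ndF/leq_maxl.
  by move: y Gy; exact/subsetPset/ndG/leq_maxr.
move=> k; have [mF Fk] := Foo k; have [mG Gk] := Goo k; split.
  rewrite -[X in measurable X]setTI; apply: measurable_uncons_rV => //.
  exact: measurableX.
rewrite /lebesgue_product /pushforward -comp_preimage.
rewrite (_ : _ \o _ = idfun) ?preimage_id; last first.
  by apply/funext => p; exact: cons_rVK.
by rewrite product_measure1E// lte_mul_pinfty// ge0_fin_numE.
Qed.

HB.instance Definition _ := Measure_isSigmaFinite.Build _ _ _ lebesgue_product
  lebesgue_product_sigma_finite.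

End product_step.

(* n-fold product of the Lebesgue measure on R; on R^0 it is the unit mass. *)
Fixpoint lebesgue_rV (n : nat) : {sigma_finite_measure set 'rV[R]_n -> \bar R} :=
  match n with
  | 0 => \d_(0 : 'rV[R]_0)
  | n'.+1 => lebesgue_product (lebesgue_rV n')
  end.

Lemma lebesgue_rV_box n (A : 'I_n -> set R) :
  (forall i, measurable (A i)) ->
  lebesgue_rV n [set x | forall i, A i (x ord0 i)] =
    (\prod_(i < n) lebesgue_measure (A i))%E.
Proof.
elim: n A => [|n IHn] A mA /=.
  rewrite big_ord0 diracE mem_set//= => -[].
  by [].
set B := [set x : 'rV[R]_n | forall i, A (lift ord0 i) (x ord0 i)].
have mB : measurable B.
  rewrite (_ : B = \bigcap_(i in [set: 'I_n])
      ((fun x : 'rV[R]_n => x ord0 i) @^-1` A (lift ord0 i))); last first.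
    by apply/seteqP; split => x /= Bx i; [move=> _|]; exact: Bx.
  apply: fin_bigcap_measurable => // i _.
  by rewrite -[X in measurable X]setTI; exact: measurable_coord.
rewrite big_ord_recl -IHn => [|i]; last exact: mA.
transitivity ((@lebesgue_measure R \x lebesgue_rV n)%E (A ord0 `*` B)); last first.
  by rewrite product_measure1E//; exact: mA.
rewrite /lebesgue_product /pushforward.
congr (product_measure1 _ _ _); apply/seteqP; split => [[a x]|[a x]] /=.
  move=> Aax; split; first by have := Aax ord0; rewrite mxE unlift_none.
  by move=> i; have := Aax (lift ord0 i); rewrite mxE liftK.
move=> [Aa Bx] i; rewrite mxE; case: unliftP => [j ->|->]//=.
Qed.

End lebesgue_measure_rV.


Section calculus.
Context {R : realType}.

(* The norm of 'rV[R]_n is the sup norm, so |x|^2 has to be spelled out. *)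
Definition normsq n (x : 'rV[R]_n) : R := \sum_(i < n) x ord0 i ^+ 2.

Definition partial n (V : normedModType R) (i : 'I_n) (f : 'rV[R]_n -> V)
  (x : 'rV[R]_n) : V := 'D_(delta_mx ord0 i) f x.

Definition gradient n (f : 'rV[R]_n -> R) (x : 'rV[R]_n) : 'rV[R]_n :=
  \row_(i < n) partial i f x.

Definition iter_derive (V W : normedModType R) (vs : seq V) (f : V -> W) :
  V -> W := foldr (fun v g => 'D_v g) f vs.

(* C^infinity on an open set U of a finite-dimensional space: all iterated
   directional derivatives exist and are continuous on U. *)
Definition smooth_on (V W : normedModType R) (U : set V) (f : V -> W) : Prop :=
  forall (vs : seq V) (x : V), U x ->
    (forall v, derivable (iter_derive vs f) x v) /\
    {for x, continuous (iter_derive vs f)}.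

Definition test_function n (eta : 'rV[R]_n -> R) : Prop :=
  smooth_on setT eta /\ compact (closure [set x | eta x != 0]).

Definition loc_integrable n (f : 'rV[R]_n -> R) : Prop :=
  measurable_fun setT f /\
  forall K, compact K -> (\int[lebesgue_rV n]_(x in K) `|f x|%:E < +oo)%E.

Definition weak_gradient n (f : 'rV[R]_n -> R) (g : 'rV[R]_n -> 'rV[R]_n) :
  Prop :=
  forall i : 'I_n, loc_integrable (fun x => g x ord0 i) /\
    forall eta, test_function eta ->
      (\int[lebesgue_rV n]_x (f x * partial i eta x)%:E =
       - \int[lebesgue_rV n]_x (g x ord0 i * eta x)%:E)%E.

Definition Linfty n (f : 'rV[R]_n -> R) : Prop := f \in Lfun (lebesgue_rV n) +oo%E.

Definition W1infty n (f : 'rV[R]_n -> R) : Prop :=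
  Linfty f /\
  exists2 g, weak_gradient f g & forall i : 'I_n, Linfty (fun x => g x ord0 i).

Definition bump n (x : 'rV[R]_n) : R :=
  if normsq x < 1 then expR (- (1 - normsq x)^-1) else 0.

Definition friedrichs n (x : 'rV[R]_n) : R :=
  bump x / (\int[lebesgue_rV n]_y bump y).

Definition friedrichs_eps n (eps : R) (x : 'rV[R]_n) : R :=
  eps ^- n * friedrichs (eps^-1 *: x).

Definition mollify n (f : 'rV[R]_n -> R) (eps : R) (x : 'rV[R]_n) : R :=
  \int[lebesgue_rV n]_y (f y * friedrichs_eps eps (x - y)).

End calculus.

(* Pairings with test functions are integrals in \bar R, so that smallness of a
   pairing also says that it is finite (Rintegral would send +oo to 0). *)
Section weak_asymptotic_solution.
Context {R : realType} {n : nat}.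
Local Notation mu := (lebesgue_rV n).

Definition o_distr (f : R -> 'rV[R]_n -> R) : Prop :=
  forall eta, test_function eta ->
    (\int[mu]_x (f eps x * eta x)%:E)%E @[eps --> 0^'+] --> 0%E.

Definition o_distr_unif (f : R -> 'rV[R]_n -> R -> R) : Prop :=
  forall eta, test_function eta -> forall delta : R, 0 < delta ->
    \forall eps \near 0^'+, forall t, 0 < t ->
      (`| \int[mu]_x (f eps x t * eta x)%:E | < delta%:E)%E.

(* u_t + (u . grad) u *)
Definition burgers_lhs (u : 'rV[R]_n -> R -> 'rV[R]_n) (x : 'rV[R]_n) (t : R) :
    'rV[R]_n :=
  derive1 (u x) t + \sum_(j < n) u x t ord0 j *: partial j (u ^~ t) x.

(* rho_t + div (rho u) *)
Definition continuity_lhs (u : 'rV[R]_n -> R -> 'rV[R]_n)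
    (rho : 'rV[R]_n -> R -> R) (x : 'rV[R]_n) (t : R) : R :=
  derive1 (rho x) t + \sum_(j < n) partial j (fun y => rho y t * u y t ord0 j) x.

(* A family of functions of (x, t), smooth for t > 0, whose values at t = 0 are
   the limits as t -> 0^+. *)
Definition smooth_family (V : normedModType R)
    (f : R -> 'rV[R]_n -> R -> V) : Prop :=
  forall eps, 0 < eps ->
    smooth_on [set p : 'rV[R]_n * R | 0 < p.2] (fun p => f eps p.1 p.2) /\
    forall x, f eps x t @[t --> 0^'+] --> f eps x 0.

Definition weak_asymptotic_solution (u0 : 'rV[R]_n -> 'rV[R]_n)
    (rho0 : 'rV[R]_n -> R) (u : R -> 'rV[R]_n -> R -> 'rV[R]_n)
    (rho : R -> 'rV[R]_n -> R -> R) : Prop :=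
  [/\ smooth_family u /\ smooth_family rho,
      forall i : 'I_n,
        o_distr_unif (fun eps x t => burgers_lhs (u eps) x t ord0 i),
      o_distr_unif (fun eps => continuity_lhs (u eps) (rho eps)),
      forall i : 'I_n, o_distr (fun eps x => (u eps x 0 - u0 x) ord0 i) &
      o_distr (fun eps x => rho eps x 0 - rho0 x)].

End weak_asymptotic_solution.

Section construction.
Context {R : realType} {n : nat}.
Local Notation mu := (lebesgue_rV n).

Definition gibbs (phi : 'rV[R]_n -> R) (eps : R) (x : 'rV[R]_n) (t : R)
    (y : 'rV[R]_n) : R :=
  expR (- eps^-1 * (normsq (x - y) / (2 * t) + phi y)).

Definition gibbs_average (phi : 'rV[R]_n -> R) (eps : R) (x : 'rV[R]_n) (t : R) :
    'rV[R]_n :=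
  \row_(i < n) ((\int[mu]_y (gradient phi y ord0 i * gibbs phi eps x t y)) /
                (\int[mu]_y gibbs phi eps x t y)).

Definition u_eps (phi0 : 'rV[R]_n -> R) (eps : R) (x : 'rV[R]_n) (t : R) :
    'rV[R]_n :=
  let v := gibbs_average (mollify phi0 eps) eps x in
  if 0 < t then v t else lim (v s @[s --> 0^'+]).

Definition integral_curve (v : 'rV[R]_n -> R -> 'rV[R]_n) (x : 'rV[R]_n) (t : R)
    (X : R -> 'rV[R]_n) : Prop :=
  [/\ X t = x, {within `[0, +oo[, continuous X} &
      forall s : R, 0 < s -> is_derive s 1 X (v (X s) s)].

(* X(x, t, .): the solution on [0, +oo[, by definite description; a family
   built on it has the required properties only if a solution does exist. *)
Definition flow (v : 'rV[R]_n -> R -> 'rV[R]_n) (x : 'rV[R]_n) (t : R) :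
    R -> 'rV[R]_n := get (integral_curve v x t).

Definition rho_eps (phi0 rho0 : 'rV[R]_n -> R) (eps : R) (x : 'rV[R]_n) (t : R) :
    R :=
  let foot y := flow (u_eps phi0 eps) y t 0 in
  mollify rho0 eps (foot x) * \det ('J foot x).

End construction.

(* Main.v *)
(* Cole-Hopf: the mean velocity u^eps solves the viscous Burgers equation with
   viscosity eps / 2 and |u^eps| is bounded by the Lipschitz constant of phi_0,
   so after two integrations by parts the first residual is O(eps), uniformly
   in t.  The second residual vanishes identically: the foot of the
   characteristics is constant along the trajectories of u^eps, and Jacobi's
   formula turns its Jacobian determinant into a solution of the continuity
   equation.  At t = 0 the data are the mollifications of u_0 and rho_0.

   Everything is carried out in the variables (x, tau) with tau = sqrt t: the
   Gaussian averages become integrals of G(x + tau z) against a fixed Gaussian,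
   smooth on the whole space including tau <= 0, so that the characteristics
   can be followed down to t = 0.  Differentiation under the integral sign
   rests on Taylor's inequality for functions with bounded derivatives, and
   smoothness of the flow on the fact that the pair (flow, tangent map) is
   itself a flow. *)

Require Import Defs.
From HB Require Import structures.
From mathcomp Require Import all_boot all_order all_algebra.
From mathcomp Require Import all_classical all_reals all_analysis.
From mathcomp Require Import perm measurable_realfun ess_sup_inf.
From mathcomp Require Import ring lra.

Set Implicit Arguments.
Unset Strict Implicit.
Unset Printing Implicit Defensive.

Import Order.TTheory GRing.Theory Num.Theory.
Import numFieldNormedType.Exports.

Local Open Scope classical_set_scope.
Local Open Scope ring_scope.

(** The variable [tau = sqrt t] succeeds because Gaussian integration by parts turns the
    [tau]-derivative of an average into [tau / (2 r)] times the average of a Laplacian; the factor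
    [tau] cancels the singular [1 / (2 tau)] of the chain rule. Three obstacles shape the rest. In
    [t] the velocity has only square-root regularity at [t = 0], where the feet of the
    characteristics lie; the backward trajectories are therefore rescaled to a fixed time interval
    and [tau] becomes a coordinate of the state. The data are bounded only almost everywhere; they
    are replaced by truncations, which have the same mollifications, and [u0], an arbitrary weak
    gradient, is compared with a bounded one through pairings with test functions. Derivatives of
    all orders must stay manageable: smoothness is expressed by iterated tangent maps, since a
    tangent map is again a map of the same kind, which makes the chain rule and the flow argument
    plain inductions; and functions whose derivatives are all bounded form a class closed under the
    operations that occur, usually proved by embedding a function into a family closed under
    differentiation. *)

Section directional_derivative.
Context {R : realType}.
Implicit Types U V W : normedModType R.

(** Clearing the denominator turns a derivative into an inequality that also holds at [h = 0]; such
    inequalities can be added, composed with linear maps and combined with the mean value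
    inequality. *)
Lemma is_deriveP V W (f : V -> W) x v l : is_derive x v f l <->
  forall e : R, 0 < e -> \forall h \near (0 : R),
    `|f (h *: v + x) - f x - h *: l| <= e * `|h|.
Proof.
split=> [[df <-] e e0|H].
  move/cvgrPdist_le : df => /(_ e e0).
  rewrite nearE /dnbhs /within /= => H; near=> h.
  have [->|h0] := eqVneq h 0.
    by rewrite !scale0r add0r !subrr !normr0 mulr0.
  have H' : `|'D_v f x - h^-1 *: (f (h *: v + x) - f x)| <= e.
    by move: h0; near: h; exact: H.
  rewrite -[X in _ - X]opprK -normrN opprB opprK.
  rewrite (_ : _ + _ = h *: ('D_v f x - h^-1 *: (f (h *: v + x) - f x))).
    by rewrite normrZ mulrC ler_wpM2r.
  by rewrite scalerBr scalerA divff// scale1r addrC.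
have C : h^-1 *: (f (h *: v + x) - f x) @[h --> 0^'] --> l.
  apply/cvgrPdist_le => e e0; have K := H _ e0.
  rewrite nearE /dnbhs /within /=; apply: filterS K => h K' h0.
  rewrite -[l](scalerK h0) -scalerBr normrZ normfV mulrC.
  by rewrite ler_pdivrMr ?normr_gt0// distrC.
have dfx : derivable f x v by apply/cvg_ex; exists l.
by apply: DeriveDef => //; exact/cvg_lim.
Unshelve. all: by end_near. Qed.

Lemma is_deriveP_ball V W (f : V -> W) x v l : is_derive x v f l <->
  forall e : R, 0 < e -> exists2 d : R, 0 < d & forall h : R, `|h| < d ->
    `|f (h *: v + x) - f x - h *: l| <= e * `|h|.
Proof.
by split=> [/is_deriveP|] H; [|apply/is_deriveP] => e /H /nbhs_norm0P.
Qed.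

(** A quadratic remainder is [o(h)]. Differentiation under the integral sign and differentiation of
    flows both end here, with an explicit [C]. *)
Lemma is_derive_quadratic V W (f : V -> W) x v l (C : R) :
  (forall h, `|h| <= 1 -> `|f (h *: v + x) - f x - h *: l| <= C * h ^+ 2) ->
  is_derive x v f l.
Proof.
move=> H; apply/is_deriveP_ball => e e0.
have C0 : 0 <= C.
  by have := H 1; rewrite normr1 lexx expr1n mulr1 => /(_ isT); apply: le_trans.
exists (Num.min 1 (e / (C + 1))).
  by rewrite lt_min ltr01 divr_gt0// ltr_wpDl.
move=> h; rewrite lt_min => /andP[h1 he].
rewrite (le_trans (H h (ltW h1)))// -real_normK ?num_real// expr2 mulrA ler_wpM2r//.
rewrite (le_trans (ler_wpM2l C0 (ltW he)))// mulrCA ger_pMr//.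
by rewrite ler_pdivrMr ?ltr_wpDl// mul1r lerDl.
Qed.

Lemma is_derive_scale V W (f : V -> W) x v l a :
  is_derive x v f l -> is_derive x (a *: v) f (a *: l).
Proof.
move/is_deriveP_ball => H; apply/is_deriveP_ball => e e0.
have a0 : 0 < `|a| + 1 by rewrite ltr_wpDl.
have [d d0 Hd] := H _ (divr_gt0 e0 a0).
exists (d / (`|a| + 1)); first exact: divr_gt0.
move=> h; rewrite ltr_pdivlMr// => hd; rewrite !scalerA.
have ha : `|h * a| <= `|h| * (`|a| + 1) by rewrite normrM ler_wpM2l// lerDl.
apply: (le_trans (Hd _ (le_lt_trans ha hd))).
by rewrite mulrAC ler_pdivrMr// -mulrA ler_wpM2l// ltW.
Qed.

Lemma deriveZv V W (f : V -> W) x v a :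
  derivable f x v -> 'D_(a *: v) f x = a *: 'D_v f x.
Proof. by move=> /derivableP /is_derive_scale H; apply: derive_val. Qed.

Lemma is_derive_line V W (f : V -> W) x v (s : R) :
  derivable f (x + s *: v) v ->
  is_derive s (1 : R) (fun r => f (x + r *: v)) ('D_v f (x + s *: v)).
Proof.
move=> /derivableP /is_deriveP H; apply/is_deriveP => e /H.
apply: filterS => h.
by rewrite [h *: 1]mulr1 scalerDl addrCA.
Qed.

(** Continuous induction: [phi] is subadditive over adjacent intervals, and [|dg| <= dh] makes it at
    most [e] times the length near each point, hence on all of [[a, b]]. The argument works in every
    normed space [W]. *)
Lemma vector_MVT W (g dg : R -> W) (h dh : R -> R) (a b : R) : a <= b ->
  (forall s, a <= s <= b -> is_derive s 1 g (dg s)) ->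
  (forall s, a <= s <= b -> is_derive s 1 h (dh s)) ->
  (forall s, a <= s <= b -> `|dg s| <= dh s) ->
  `|g b - g a| <= h b - h a.
Proof.
move=> ab Dg Dh gh.
pose phi x y := `|g y - g x| - (h y - h x).
suff key e : 0 < e -> phi a b <= e * (b - a).
  rewrite -subr_le0; apply/ler_addgt0Pr => e e0; rewrite add0r.
  have ba0 : 0 < b - a + 1 by rewrite ltr_wpDl// subr_ge0.
  apply: (le_trans (key (e / (b - a + 1)) (divr_gt0 e0 ba0))).
  by rewrite mulrAC ler_pdivrMr// ler_wpM2l ?ltW// ltrDl.
move=> e0.
have loc s : a <= s <= b -> exists2 d, 0 < d & forall y, `|y - s| < d ->
    (s <= y -> phi s y <= e * (y - s)) /\ (y <= s -> phi y s <= e * (s - y)).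
  move=> sab; have e20 : 0 < e / 2 by rewrite divr_gt0.
  have [d1 d10 H1] := (is_deriveP_ball _ _ _ _).1 (Dg _ sab) _ e20.
  have [d2 d20 H2] := (is_deriveP_ball _ _ _ _).1 (Dh _ sab) _ e20.
  exists (Num.min d1 d2); first by rewrite lt_min d10.
  move=> y; rewrite lt_min => /andP[/H1 {}H1 /H2 {}H2].
  move: H1 H2; rewrite [(y - s) *: 1]mulr1 subrK => H1 H2.
  have H3 := gh _ sab.
  have H4 : `|g y - g s| <= e / 2 * `|y - s| + `|y - s| * dh s.
    rewrite -[g y - g s](subrK ((y - s) *: dg s)) (le_trans (ler_normD _ _))//.
    by rewrite lerD// normrZ ler_wpM2l.
  rewrite -[(y - s) *: dh s]/((y - s) * dh s) in H2.
  rewrite /phi; split=> ys.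
    have ysE : `|y - s| = y - s by rewrite ger0_norm ?subr_ge0.
    move: H2 H4; rewrite ysE ler_norml => /andP[? ?] ?; lra.
  have ysE : `|y - s| = s - y by rewrite distrC ger0_norm ?subr_ge0.
  move: H2 H4; rewrite ysE ler_norml => /andP[? ?]; rewrite distrC => ?.
  have sy0 : 0 <= s - y by rewrite subr_ge0.
  lra.
have phiD x y z : phi x z <= phi x y + phi y z.
  rewrite /phi; have := ler_normD (g z - g y) (g y - g x).
  by rewrite addrA subrK; lra.
pose S := [set y | a <= y <= b /\ phi a y <= e * (y - a)].
have Sa : S a by rewrite /S/= lexx ab /phi !subrr normr0 mulr0 subr0.
have supS : has_sup S by split; [exists a|exists b => y [/andP[]]].
have Sb y : S y -> y <= sup S by move=> Sy; apply: sup_upper_bound.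
have aS : a <= sup S by exact: Sb.
have Sleb : sup S <= b by apply: ge_sup; [exists a|move=> y [/andP[]]].
(* The supremum belongs to [S] by the left half of [loc]; if it were less than [b], the right half
   would produce a larger element [y] of [S]. *)
have SS : S (sup S).
  have [d d0 Hd] := loc _ (introT andP (conj aS Sleb)).
  have [z Sz zS] := sup_adherent d0 supS.
  have zle := Sb _ Sz.
  have [|_ /(_ zle) H] := Hd z.
    by rewrite distrC ger0_norm ?subr_ge0// ltrBlDr -ltrBlDl.
  split; first by rewrite aS.
  apply: (le_trans (phiD _ z _)); move: Sz => [_ Sz]; lra.
have [<-|Sneb] := eqVneq (sup S) b; first exact: SS.2.
have [d d0 Hd] := loc _ (introT andP (conj aS Sleb)).
pose y := Num.min (sup S + d / 2) b.
have Slty : sup S < y.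
  by rewrite lt_min ltrDl divr_gt0//= lt_neqAle Sneb.
have yd : y <= sup S + d / 2 by rewrite ge_min lexx.
have [|/(_ (ltW Slty)) H _] := Hd y.
  by rewrite gtr0_norm ?subr_gt0//; lra.
have : S y.
  split; first by rewrite (le_trans aS (ltW Slty)) ge_min lexx orbT.
  apply: (le_trans (phiD _ (sup S) _)); move: SS => [_ SS]; lra.
by move/Sb; rewrite leNgt Slty.
Qed.

(* Joint continuity of the derivative makes a directionally differentiable map
   Hadamard differentiable, which is what the chain rule needs. *)
Lemma is_derive_chain U V W (f : V -> W) (g : U -> V) x w l :
  (forall y v, derivable f y v) ->
  continuous (fun z : V * V => 'D_z.2 f z.1) ->
  is_derive x w g l ->
  is_derive x w (f \o g) ('D_l f (g x)).
Proof.
move=> df Tf /is_deriveP_ball dg; apply/is_deriveP_ball => e e0.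
have /cvgrPdist_le /(_ _ e0) := Tf (g x, l).
rewrite near_simpl => /nbhs_ballP[r r0 Hr].
have {}Hr y k : `|y - g x| < r -> `|k - l| < r -> `|'D_k f y - 'D_l f (g x)| <= e.
  move=> y1 k1; rewrite distrC; apply: (Hr (y, k)); split => /=.
    by rewrite -ball_normE /= distrC.
  by rewrite -ball_normE /= distrC.
have r20 : 0 < r / 2 by rewrite divr_gt0.
have [d d0 Hd] := dg _ r20.
have c0 : 0 < `|l| + r by rewrite ltr_wpDl.
exists (Num.min d (r / (`|l| + r))); first by rewrite lt_min d0 divr_gt0.
move=> h; rewrite lt_min => /andP[/Hd gh hr].
have [->|h0] := eqVneq h 0.
  by rewrite !scale0r add0r subr0 subrr !normr0 mulr0.
pose k := h^-1 *: (g (h *: w + x) - g x).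
have hk : h *: k = g (h *: w + x) - g x by rewrite scalerA divff// scale1r.
have kl : `|k - l| < r.
  rewrite (@le_lt_trans _ _ (r / 2)) ?ltr_pdivrMr ?ltr_pMr ?ltr1n//.
  by rewrite -(@ler_pM2l _ `|h|) ?normr_gt0// -normrZ scalerBr hk mulrC.
have kb : `|k| < `|l| + r.
  by rewrite -[k](subrK l) addrC (le_lt_trans (ler_normD _ _))// ltrD2l.
have hkr : `|h| * `|k| < r.
  rewrite (@le_lt_trans _ _ (`|h| * (`|l| + r)))//.
    by rewrite ler_wpM2l// ltW.
  by rewrite -ltr_pdivlMr.
pose G (s : R) := f (g x + s *: (h *: k)) - s *: (h *: 'D_l f (g x)).
have := @vector_MVT W G (fun s => h *: 'D_k f (g x + s *: (h *: k)) -
  h *: 'D_l f (g x)) (fun s => e * `|h| * s) (fun _ => e * `|h|) 0 1 ler01.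
rewrite /G !scale1r !scale0r subr0 addr0 mulr1 mulr0 subr0 hk.
rewrite [g x + (_ - _)]addrC subrK addrAC; apply.
- move=> s _; apply: is_deriveB.
    by rewrite -hk -deriveZv//; exact/is_derive_line/df.
  apply/is_deriveP => e1 e10; near=> t.
  by rewrite [t *: 1]mulr1 scalerDl addrK subrr normr0 mulr_ge0// ltW.
- move=> s _; apply/is_deriveP => e1 e10; near=> t.
  rewrite [t *: 1]mulr1 mulrDr addrK mulrC subrr normr0 mulr_ge0// ltW//.
- move=> s /andP[s0 s1]; rewrite -scalerBr normrZ mulrC ler_wpM2r//.
  apply: Hr => //; rewrite addrAC subrr add0r !normrZ ger0_norm//.
  by rewrite (le_lt_trans _ hkr)// -normrZ hk ler_piMl.
Unshelve. all: by end_near. Qed.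

End directional_derivative.

(** * Smoothness through iterated tangent maps *)

Section smooth_maps.
Context {R : realType}.
Implicit Types (U V W : normedModType R) (P Q : topologicalType).

(* [Ck k f]: the maps [f p] are C^k in the sense of Bastiani, that is, the
   iterated tangent maps exist and are continuous, jointly with the parameter. *)
Fixpoint Ck P W k V (f : P -> V -> W) : Prop :=
  continuous (fun z : P * V => f z.1 z.2) /\
  if k is k'.+1 then (forall p x v, derivable (f p) x v) /\
    Ck k' (fun p (z : V * V) => 'D_z.2 (f p) z.1) else True.

Lemma Ck_cont P W k V (f : P -> V -> W) : Ck k f ->
  continuous (fun z : P * V => f z.1 z.2).
Proof. by case: k => [|k] []. Qed.

Lemma CkS P W k V (f : P -> V -> W) : Ck k.+1 f -> Ck k f.
Proof.
elim: k V f => [|k IH] V f [cf [df Tf]] //.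
by split=> //; split=> //; exact: IH.
Qed.

Lemma Ck_leq P W j k V (f : P -> V -> W) : (j <= k)%N -> Ck k f -> Ck j f.
Proof.
elim: k => [|k IH]; first by rewrite leqn0 => /eqP ->.
by rewrite leq_eqVlt => /predU1P[->//|/IH H] /CkS.
Qed.

Lemma Ck_derivable P W k V (f : P -> V -> W) p x v :
  Ck k.+1 f -> derivable (f p) x v.
Proof. by case=> _ []. Qed.

Lemma Ck_tangent P W k V (f : P -> V -> W) :
  Ck k.+1 f -> Ck k (fun p (z : V * V) => 'D_z.2 (f p) z.1).
Proof. by case=> _ []. Qed.

Lemma Ck_ext P W k V (f g : P -> V -> W) : (forall p x, f p x = g p x) ->
  Ck k f -> Ck k g.
Proof.
by move=> fg; rewrite (_ : f = g)//; apply/funext => p; apply/funext => x.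
Qed.

(** The standard way to gain one order: give the tangent map by an explicit formula and let an
    induction hypothesis supply its regularity. *)
Lemma CkSI P W k V (f : P -> V -> W) (Tf : P -> V * V -> W) :
  continuous (fun z : P * V => f z.1 z.2) ->
  (forall p x v, is_derive x v (f p) (Tf p (x, v))) ->
  Ck k Tf -> Ck k.+1 f.
Proof.
move=> cf df CTf; split => //; split; first by move=> p x v; have [] := df p x v.
apply: Ck_ext CTf => p [x v] /=.
by have df' := df p x v; rewrite derive_val.
Qed.

Definition bounded_linear U V (A : U -> V) := linear A /\ continuous A.

Lemma bounded_linearB U V (A : U -> V) : bounded_linear A ->
  {morph A : x y / x - y}.
Proof.
move=> [lA _] x y; have := lA (-1) y x.
by rewrite !scaleN1r ![- y + _]addrC ![- _ + _]addrC.
Qed.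

Lemma bounded_linear_canonical U V (A : {linear U -> V}) :
  continuous A -> bounded_linear A.
Proof. by move=> cA; split=> //; exact: linearP. Qed.

Lemma bounded_linear_fst U V : bounded_linear (fst : (U * V)%type -> U).
Proof. by split=> // z; exact: cvg_fst. Qed.

Lemma bounded_linear_snd U V : bounded_linear (snd : (U * V)%type -> V).
Proof. by split=> // z; exact: cvg_snd. Qed.

Lemma bounded_linear_comp U V W (A : U -> V) (B : V -> W) :
  bounded_linear A -> bounded_linear B -> bounded_linear (B \o A).
Proof.
move=> [lA cA] [lB cB]; split; first by move=> a x y /=; rewrite lA lB.
by move=> x; apply: continuous_comp; [exact: cA|exact: cB].
Qed.

Lemma bounded_linear_pair U V W (A : U -> V) (B : U -> W) :
  bounded_linear A -> bounded_linear B ->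
  bounded_linear (fun x => (A x, B x) : (V * W)%type).
Proof.
move=> [lA cA] [lB cB]; split; first by move=> a x y; rewrite lA lB.
by move=> x; apply: cvg_pair; [exact: cA|exact: cB].
Qed.

Lemma bounded_linear_prod U V U' V' (A : U -> V) (B : U' -> V') :
  bounded_linear A -> bounded_linear B ->
  bounded_linear (fun x : U * U' => (A x.1, B x.2) : (V * V')%type).
Proof.
move=> hA hB; apply: bounded_linear_pair.
- exact: bounded_linear_comp (bounded_linear_fst _ _) hA.
- exact: bounded_linear_comp (bounded_linear_snd _ _) hB.
Qed.

Lemma is_derive_comp_linear U V W (A : U -> V) (f : V -> W) x v l :
  linear A -> is_derive (A x) (A v) f l -> is_derive x v (f \o A) l.
Proof.
move=> lA /is_deriveP H; apply/is_deriveP => e /H; apply: filterS => h.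
by rewrite /= lA.
Qed.

Lemma is_derive_linear_comp U V W (A : V -> W) (f : U -> V) x v l :
  bounded_linear A -> is_derive x v f l -> is_derive x v (A \o f) (A l).
Proof.
move=> [lA cA].
pose A' : {linear V -> W} := HB.pack A (GRing.isLinear.Build _ _ _ _ A lA).
have [k k0 Ak] := @linear_lipschitz _ _ _ A' cA.
move=> /is_deriveP H; apply/is_deriveP => e e0.
have := H _ (divr_gt0 e0 k0); apply: filterS => h H'.
have AB := bounded_linearB (conj lA cA).
have AZ : A (h *: l) = h *: A l by exact: (linearZZ A').
rewrite /= -AZ -!AB (le_trans (Ak _))//.
by rewrite -ler_pdivlMl// mulrA [_ * e]mulrC.
Qed.

Lemma is_derive_bounded_linear V W (A : V -> W) x v :
  linear A -> is_derive x v A (A v).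
Proof.
move=> lA; apply/is_deriveP => e e0; near=> h.
by rewrite lA addrK subrr normr0 mulr_ge0// ltW.
Unshelve. all: by end_near. Qed.

Lemma continuous_param_comp P Q (U V W : topologicalType) (f : P -> V -> W)
    (p : Q -> U -> P) (g : Q -> U -> V) :
  continuous (fun z : P * V => f z.1 z.2) ->
  continuous (fun z : Q * U => p z.1 z.2) ->
  continuous (fun z : Q * U => g z.1 z.2) ->
  continuous (fun z : Q * U => f (p z.1 z.2) (g z.1 z.2)).
Proof.
move=> cf cp cg z.
apply: (@continuous_comp _ _ _ (fun z => (p z.1 z.2, g z.1 z.2))
  (fun z => f z.1 z.2)); last exact: cf.
by apply: cvg_pair; [exact: cp|exact: cg].
Qed.

Lemma continuous_pair (T U V : topologicalType) (f : T -> U) (g : T -> V) :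
  continuous f -> continuous g -> continuous (fun z => (f z, g z)).
Proof. by move=> cf cg z; apply: cvg_pair; [exact: cf|exact: cg]. Qed.

Lemma continuous_fst' (U V : topologicalType) : continuous (@fst U V).
Proof. by move=> z; exact: cvg_fst. Qed.

Lemma Ck_reparam P Q U V W k (c : Q -> P) (A : U -> V) (f : P -> V -> W) :
  continuous c -> bounded_linear A -> Ck k f -> Ck k (fun q x => f (c q) (A x)).
Proof.
elim: k U V A f => [|k IH] U V A f cc hA Cf.
- split=> //; apply: (@continuous_param_comp _ _ _ _ _ _ (fun q _ => c q) (fun _ => A)).
  + exact: Ck_cont Cf.
  + by move=> z; apply: (@continuous_comp _ _ _ fst c); [exact: cvg_fst|exact: cc].
  + by move=> z; apply: (@continuous_comp _ _ _ snd A); [exact: cvg_snd|exact: hA.2].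
- apply: (@CkSI _ _ _ _ _ (fun q z => 'D_(A z.2) (f (c q)) (A z.1))).
  + have /= := IH _ _ A f cc hA (CkS Cf); exact: Ck_cont.
  + move=> q x v; apply: is_derive_comp_linear; first exact: hA.1.
    exact: derivableP (Ck_derivable Cf).
  + apply: (IH _ _ (fun z : U * U => (A z.1, A z.2)) _ cc _ (Ck_tangent Cf)).
    exact: bounded_linear_prod.
Qed.

Lemma Ck_comp_linear P U V W k (A : U -> V) (f : P -> V -> W) :
  bounded_linear A -> Ck k f -> Ck k (fun p x => f p (A x)).
Proof. by move=> hA Cf; apply: (@Ck_reparam P P U V W k id A f) => // p; exact: cvg_id. Qed.

Lemma Ck_linear_comp P U V W k (A : V -> W) (f : P -> U -> V) :
  bounded_linear A -> Ck k f -> Ck k (fun p x => A (f p x)).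
Proof.
move=> hA.
have cA U' (g : P -> U' -> V) : continuous (fun z : P * U' => g z.1 z.2) ->
    continuous (fun z : P * U' => A (g z.1 z.2)).
  move=> cg z; apply: (@continuous_comp _ _ _ (fun z => g z.1 z.2) A); first exact: cg.
  exact: hA.2.
elim: k U f => [|k IH] U f Cf.
  by split=> //; apply: cA; exact: Ck_cont Cf.
apply: (@CkSI _ _ _ _ _ (fun q z => A ('D_z.2 (f q) z.1))).
- by apply: cA; exact: Ck_cont Cf.
- move=> q x v; apply: is_derive_linear_comp => //.
  exact: derivableP (Ck_derivable Cf).
- exact: IH (Ck_tangent Cf).
Qed.

Lemma Ck_param P V W k (c : P -> W) : continuous c -> Ck k (fun p (_ : V) => c p).
Proof.
elim: k V W c => [|k IH] V W c cc.
  by split=> // z; apply: (@continuous_comp _ _ _ fst c); [exact: cvg_fst|exact: cc].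
apply: (@CkSI _ _ _ _ _ (fun _ _ => 0)) => //.
- by move=> z; apply: (@continuous_comp _ _ _ fst c); [exact: cvg_fst|exact: cc].
- by apply: (IH _ _ (cst 0)); exact: cst_continuous.
Qed.

Lemma Ck_cst P V W k (c : W) : Ck k (fun (_ : P) (_ : V) => c).
Proof. by apply: Ck_param; exact: cst_continuous. Qed.

Lemma Ck_id P V k : Ck k (fun (_ : P) (x : V) => x).
Proof.
elim: k V => [|k IH] V; first by split=> // z; exact: cvg_snd.
apply: (@CkSI _ _ _ _ _ (fun _ z => z.2)) => //; first by move=> z; exact: cvg_snd.
by apply: (@Ck_comp_linear _ _ _ _ _ _ (fun _ => id)) => //; exact: bounded_linear_snd.
Qed.

Lemma Ck_linear P V W k (A : V -> W) : bounded_linear A -> Ck k (fun _ : P => A).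
Proof. by move=> hA; exact: (Ck_linear_comp hA (Ck_id P V k)). Qed.

Lemma is_derive_pair U V W (f : U -> V) (g : U -> W) x v df dg :
  is_derive x v f df -> is_derive x v g dg ->
  is_derive x v (fun y => (f y, g y) : (V * W)%type) (df, dg).
Proof.
move=> /is_deriveP Df /is_deriveP Dg; apply/is_deriveP => e e0.
have Hf := Df _ e0; have Hg := Dg _ e0.
near=> h; rewrite prod_normE ge_max; apply/andP; split => /=.
- by near: h; exact: Hf.
- by near: h; exact: Hg.
Unshelve. all: by end_near. Qed.

Lemma Ck_pair P U V W k (f : P -> U -> V) (g : P -> U -> W) :
  Ck k f -> Ck k g -> Ck k (fun p x => (f p x, g p x) : (V * W)%type).
Proof.
have cpair U' (f' : P -> U' -> V) (g' : P -> U' -> W) : Ck 0 f' -> Ck 0 g' ->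
    continuous (fun z : P * U' => (f' z.1 z.2, g' z.1 z.2)).
  by move=> [cf _] [cg _] z; apply: cvg_pair; [exact: cf|exact: cg].
elim: k U f g => [|k IH] U f g Cf Cg; first by split=> //; exact: cpair.
apply: (@CkSI _ _ _ _ _ (fun q z => ('D_z.2 (f q) z.1, 'D_z.2 (g q) z.1))).
- by apply: cpair; [exact: Ck_leq Cf|exact: Ck_leq Cg].
- by move=> q x v; apply: is_derive_pair; apply: derivableP;
    [exact: Ck_derivable Cf|exact: Ck_derivable Cg].
- exact: IH (Ck_tangent Cf) (Ck_tangent Cg).
Qed.

Lemma CkD P V W k (f g : P -> V -> W) : Ck k f -> Ck k g ->
  Ck k (fun p x => f p x + g p x).
Proof.
move=> Cf Cg; have := Ck_pair Cf Cg.
apply: (@Ck_linear_comp _ _ _ _ _ (fun z : W * W => z.1 + z.2)).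
split; last by move=> z; exact: add_continuous.
by move=> a x y /=; rewrite scalerDr addrACA.
Qed.

Lemma is_derive_scaler V W (f : V -> R) (g : V -> W) x v df dg :
  is_derive x v f df -> is_derive x v g dg ->
  is_derive x v (fun y => f y *: g y) (f x *: dg + df *: g x).
Proof.
move=> [fd <-] [gd <-].
pose qf h := h^-1 *: (f (h *: v + x) - f x).
pose qg h := h^-1 *: (g (h *: v + x) - g x).
(* [f x + h * qf h] is [f (h *: v + x)] written through the difference quotient, so that continuity
   of [f] along [v] comes out of its derivability. *)
have Cq : (f x + h * qf h) *: qg h + qf h *: g x @[h --> (0 : R)^'] -->
    f x *: 'D_v g x + 'D_v f x *: g x.
  rewrite -[X in X *: 'D_v g x]addr0 -[X in f x + X](mul0r ('D_v f x)).
  apply: cvgD; last by apply: cvgZr_tmp; exact: fd.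
  apply: cvgZ; last exact: gd.
  apply: cvgD; first exact: cvg_cst.
  by apply: cvgM; [exact: cvg_within_filter cvg_id|exact: fd].
have C : h^-1 *: (f (h *: v + x) *: g (h *: v + x) - f x *: g x)
    @[h --> (0 : R)^'] --> f x *: 'D_v g x + 'D_v f x *: g x.
  apply: cvg_trans Cq; apply: near_eq_cvg; near=> h.
  have h0 : h != 0 by near: h; exact: nbhs_dnbhs_neq.
  rewrite /qf /qg -[h * _]/(h *: _) !scalerA !mulfV// scale1r [f x + _]addrC subrK.
  rewrite mulrC -scalerA -[h^-1 *: (f _ - f x)]/(h^-1 * _) -scalerA -scalerDr.
  by rewrite scalerBr scalerBl subrKA.
by split; [apply/cvg_ex; eexists; exact: C|exact/cvg_lim].
Unshelve. all: by end_near. Qed.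

Lemma CkZ P V W k (f : P -> V -> R) (g : P -> V -> W) :
  Ck k f -> Ck k g -> Ck k (fun p x => f p x *: g p x).
Proof.
have cZ U' (f' : P -> U' -> R) (g' : P -> U' -> W) : Ck 0 f' -> Ck 0 g' ->
    continuous (fun z : P * U' => f' z.1 z.2 *: g' z.1 z.2).
  by move=> [cf _] [cg _] z; apply: cvgZ; [exact: cf|exact: cg].
elim: k V f g => [|k IH] V f g Cf Cg; first by split=> //; exact: cZ.
apply: (@CkSI _ _ _ _ _ (fun q z => f q z.1 *: 'D_z.2 (g q) z.1 +
  'D_z.2 (f q) z.1 *: g q z.1)).
- by apply: cZ; [exact: Ck_leq Cf|exact: Ck_leq Cg].
- move=> q x v.
  by apply: is_derive_scaler; apply: derivableP; [exact: Ck_derivable Cf|exact: Ck_derivable Cg].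
- apply: CkD; apply: IH.
  + exact: Ck_comp_linear (bounded_linear_fst _ _) (CkS Cf).
  + exact: Ck_tangent.
  + exact: Ck_tangent.
  + exact: Ck_comp_linear (bounded_linear_fst _ _) (CkS Cg).
Qed.

Lemma CkM P V k (f g : P -> V -> R) : Ck k f -> Ck k g ->
  Ck k (fun p x => f p x * g p x).
Proof. exact: CkZ. Qed.

Lemma CkN P V W k (f : P -> V -> W) : Ck k f -> Ck k (fun p x => - f p x).
Proof.
by move=> Cf; apply: Ck_ext (CkZ (Ck_cst P V k (-1 : R)) Cf) => p x; exact: scaleN1r.
Qed.

Lemma CkB P V W k (f g : P -> V -> W) : Ck k f -> Ck k g ->
  Ck k (fun p x => f p x - g p x).
Proof. by move=> Cf Cg; exact: CkD Cf (CkN Cg). Qed.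

Lemma Ck_sum P V W k (I : Type) (r : seq I) (f : I -> P -> V -> W) :
  (forall i, Ck k (f i)) -> Ck k (fun p x => \sum_(i <- r) f i p x).
Proof.
move=> Cf; elim: r => [|i r IH].
  by apply: Ck_ext (Ck_cst P V k 0) => p x; rewrite big_nil.
by apply: Ck_ext (CkD (Cf i) IH) => p x; rewrite big_cons.
Qed.

Lemma CkX P V k (f : P -> V -> R) m : Ck k f -> Ck k (fun p x => f p x ^+ m).
Proof.
move=> Cf; elim: m => [|m IH]; first exact: Ck_cst.
by apply: Ck_ext (CkM Cf IH) => p x; rewrite exprS.
Qed.

Lemma Ck_prod P V k (I : Type) (r : seq I) (f : I -> P -> V -> R) :
  (forall i, Ck k (f i)) -> Ck k (fun p x => \prod_(i <- r) f i p x).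
Proof.
move=> Cf; elim: r => [|i r IH].
  by apply: Ck_ext (Ck_cst P V k (1 : R)) => p x; rewrite big_nil.
by apply: Ck_ext (CkM (Cf i) IH) => p x; rewrite big_cons.
Qed.

Lemma continuous_Ck_tangent P V W k (f : P -> V -> W) p : Ck k.+1 f ->
  continuous (fun z : V * V => 'D_z.2 (f p) z.1).
Proof.
move=> Cf z; apply: (@continuous_comp _ _ _ (fun z => (p, z))
  (fun z : P * (V * V) => 'D_z.2.2 (f z.1) z.2.1)).
  exact: (cvg_pair (cvg_cst p) cvg_id).
exact: (Ck_cont (Ck_tangent Cf)).
Qed.

(** Tangent maps are functorial: the tangent map of a composition is the tangent map of [f]
    evaluated at [g] and the tangent map of [g]. This is again a composition, so the induction
    closes at once. *)
Lemma Ck_comp P U V W k (f : P -> V -> W) (g : P -> U -> V) :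
  Ck k f -> Ck k g -> Ck k (fun p x => f p (g p x)).
Proof.
have c0 U' V' (f' : P -> V' -> W) (g' : P -> U' -> V') : Ck 0 f' -> Ck 0 g' ->
    continuous (fun z : P * U' => f' z.1 (g' z.1 z.2)).
  move=> [cf _] [cg _].
  apply: (@continuous_param_comp _ _ _ _ _ f' (fun p _ => p) g') => // z.
  exact: cvg_fst.
elim: k U V f g => [|k IH] U V f g Cf Cg.
  by split=> //; exact: (c0 _ _ f g).
apply: (@CkSI _ _ _ _ _ (fun q z => 'D_('D_z.2 (g q) z.1) (f q) (g q z.1))).
- by apply: (c0 _ _ f g); [exact: Ck_leq Cf|exact: Ck_leq Cg].
- move=> q x v; apply: (@is_derive_chain _ _ _ _ (f q) (g q)).
  + by move=> y w; exact: Ck_derivable Cf.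
  + by move=> z; exact: (@continuous_Ck_tangent P V W k f q Cf z).
  + exact: derivableP (Ck_derivable Cg).
- apply: (IH _ _ (fun q z => 'D_z.2 (f q) z.1) (fun q z => (g q z.1, 'D_z.2 (g q) z.1))).
  + exact: Ck_tangent.
  + apply: Ck_pair; last exact: Ck_tangent.
    exact: Ck_comp_linear (bounded_linear_fst _ _) (CkS Cg).
Qed.

Lemma CkV P V k (f : P -> V -> R) : (forall p x, f p x != 0) -> Ck k f ->
  Ck k (fun p x => (f p x)^-1).
Proof.
have cV U' (f' : P -> U' -> R) : (forall p x, f' p x != 0) -> Ck 0 f' ->
    continuous (fun z : P * U' => (f' z.1 z.2)^-1).
  by move=> f0 [cf _] z; apply: cvgV => //; exact: cf.
elim: k V f => [|k IH] V f f0 Cf; first by split=> //; exact: cV.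
apply: (@CkSI _ _ _ _ _ (fun q z => - ((f q z.1)^-1 * (f q z.1)^-1 * 'D_z.2 (f q) z.1))).
- by apply: cV => //; exact: Ck_leq Cf.
- move=> q x v; have Df := Ck_derivable Cf : derivable (f q) x v.
  split; first exact: derivableV.
  by rewrite deriveV// /= -scaleNr -exprVn expr2.
- apply: CkN; apply: CkM; last exact: Ck_tangent.
  by apply: CkM; apply: (Ck_comp_linear (bounded_linear_fst _ _)) (IH _ _ f0 (CkS Cf)).
Qed.

End smooth_maps.

(** * Concrete smooth functions; symmetry and linearity of derivatives *)

Section smooth_functions.
Context {R : realType}.
Implicit Types (U V W : normedModType R) (P Q : topologicalType).

(* A single map [f] is smooth when [smooth (fun _ : R => f)]: the parameter is then a dummy. *)
Definition smooth P V W (f : P -> V -> W) := forall k, Ck k f.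

Lemma Ck_derive P V W k (f : P -> V -> W) v : Ck k.+1 f ->
  Ck k (fun p x => 'D_v (f p) x).
Proof.
move=> /Ck_tangent Cf.
exact: (Ck_comp Cf (Ck_pair (Ck_id P V k) (Ck_cst P V k v))).
Qed.

Lemma Ck_continuous P V W k (f : P -> V -> W) p : Ck k f -> continuous (f p).
Proof.
move=> Cf x; apply: (@continuous_comp _ _ _ (fun x => (p, x)) (fun z : P * V => f z.1 z.2)).
  exact: (cvg_pair (cvg_cst p) cvg_id).
exact: (Ck_cont Cf).
Qed.

Lemma smooth_derive P V W (f : P -> V -> W) v :
  smooth f -> smooth (fun p => 'D_v (f p)).
Proof. by move=> Cf k; exact: Ck_derive. Qed.

Lemma smooth_derivable P V W (f : P -> V -> W) p x v :
  smooth f -> derivable (f p) x v.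
Proof. by move=> /(_ 1%N); exact: Ck_derivable. Qed.

Lemma smooth_continuous P V W (f : P -> V -> W) p : smooth f -> continuous (f p).
Proof. by move=> /(_ 0%N); exact: Ck_continuous. Qed.

Lemma smooth_iter_derive P V W (f : P -> V -> W) vs :
  smooth f -> smooth (fun p => iter_derive vs (f p)).
Proof. by move=> Cf; elim: vs => //= v vs IH; exact: smooth_derive. Qed.

Lemma smooth_smooth_on P V W (f : P -> V -> W) p A : smooth f -> smooth_on A (f p).
Proof.
move=> /smooth_iter_derive Cf vs x _; split; last exact: (@smooth_continuous _ _ _ _ p (Cf vs) x).
by move=> v; exact: smooth_derivable (Cf vs).
Qed.

(** Meant for families closed under differentiation: [DF] is built from members of [F], so the order
    of smoothness rises for all indices [j] at once. *)
Lemma smooth_real (F : nat -> R -> R) (DF : nat -> R -> R) P :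
  (forall j x, is_derive x (1 : R) (F j) (DF j x)) ->
  (forall k, (forall j, Ck k (fun _ : P => F j)) -> forall j, Ck k (fun _ : P => DF j)) ->
  forall j, smooth (fun _ : P => F j).
Proof.
move=> dF CF j k; elim: k j => [|k IH] j.
  split=> // z; apply: (@continuous_comp _ _ _ snd (F j)); first exact: cvg_snd.
  apply: differentiable_continuous; apply/derivable1_diffP.
  by have [] := dF j z.2.
apply: (@CkSI R P R k R (fun=> F j) (fun _ (z : R * R) => z.2 * DF j z.1)).
- exact: Ck_cont (IH j).
- move=> _ x v; have := is_derive_scale v (dF j x).
  by rewrite [v *: 1]mulr1.
- apply: CkM; first exact: Ck_linear (bounded_linear_snd _ _).
  exact: Ck_comp_linear (bounded_linear_fst _ _) (CF _ IH j).
Qed.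

Lemma smooth_expR P : smooth (fun _ : P => @expR R).
Proof.
apply: (@smooth_real (fun _ => @expR R) (fun _ => @expR R) P _ _ 0%N) => //.
Qed.

(** The powers [s ^- j] make the family stable under differentiation; [flat 0] at [1 - normsq x] is
    the bump function. *)
Definition flat (j : nat) (s : R) : R := if 0 < s then s ^- j * expR (- s^-1) else 0.

Lemma flat_ge0 j s : 0 <= flat j s.
Proof.
by rewrite /flat; case: ifPn => // s0; rewrite mulr_ge0 ?expR_ge0// invr_ge0 exprn_ge0// ltW.
Qed.

(** The exponential series at [1 / s] contains the term [s ^- j / j!]. *)
Lemma flat_le j s : flat j s <= j`!%:R.
Proof.
rewrite /flat; case: ifPn => // s0.
have s1 : 0 <= s^-1 by rewrite invr_ge0 ltW.
rewrite expRN ler_pdivrMr ?expR_gt0// -exprVn.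
case: j => [|j]; first by rewrite expr0 fact0 mul1r -expR0 ler_expR.
have := expR_ge1Dxn j s1.
rewrite -ler_pdivrMl ?ltr0n ?fact_gt0// mulrC; apply: le_trans.
by rewrite lerDr.
Qed.

Lemma flatSS j s : flat j s = s ^+ 2 * flat j.+2 s.
Proof.
rewrite /flat; case: ifPn => s0; last by rewrite mulr0.
rewrite mulrA -!exprVn -(addn2 j) exprD mulrCA -exprMn mulfV ?expr1n ?mulr1//.
by rewrite gt_eqF.
Qed.

Lemma is_derive_flat j s : is_derive s (1 : R) (flat j) (flat j.+2 s - j%:R * flat j.+1 s).
Proof.
have [s0|s0|->] := ltgtP s 0.
- rewrite /flat ltNge (ltW s0)/= mulr0 subrr.
  apply: (@near_eq_is_derive _ _ _ (cst 0)) => //.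
  near=> x; rewrite ltNge ifF//; apply/negbTE; rewrite negbK.
  by apply/ltW; near: x; exact: lt_nbhsl.
- pose g (x : R) := (x^-1) ^+ j * expR (- x^-1).
  apply: (@near_eq_is_derive _ _ _ g).
    near=> x; rewrite /g /flat exprVn ifT//.
    by near: x; exact: lt_nbhsr.
  have dV : is_derive s 1 (fun x : R => x^-1) (- s ^- 2).
    have := @is_deriveV R id s 1 1; rewrite gt_eqF// => /(_ isT (is_derive_id _ _)).
    by rewrite [_ *: 1]mulr1.
  have dE : is_derive s 1 (fun x : R => expR (- x^-1)) (expR (- s^-1) * s ^- 2).
    have := @is_derive1_comp R expR (fun x => - x^-1) s _ _ (is_derive_expR _) (is_deriveN dV).
    by rewrite opprK.
  have dX := is_deriveX j dV.
  have -> : g = (fun x => x^-1) ^+ j * (fun x => expR (- x^-1)).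
    by apply/funext => x; rewrite /g mulrfctE exprfctE.
  apply: (is_derive_eq (is_deriveM dX dE)); rewrite exprfctE.
  rewrite /flat s0 -[X in X + _]/(_ * _) -[X in _ + X = _]/(_ * (_ * _)) -!exprVn.
  case: j {dX g} => [|j]; first by rewrite !expr0 !mul0r mulr0 addr0 subr0 mul1r mulrC.
  by rewrite /= !exprS; ring.
(* At the origin [flat j h] is [h ^+ 2] times the bounded [flat j.+2 h]: a quadratic remainder, with
   derivative 0. *)
- rewrite {2 3}/flat ltxx mulr0 subrr.
  apply: (@is_derive_quadratic _ _ _ _ _ _ _ j.+2`!%:R) => h _.
  rewrite [h *: 1]mulr1 addr0 scaler0 subr0 {2}/flat ltxx subr0.
  rewrite ger0_norm ?flat_ge0// flatSS mulrC ler_wpM2r ?sqr_ge0//.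
  exact: flat_le.
Unshelve. all: by end_near. Qed.

Lemma smooth_flat P j : smooth (fun _ : P => flat j).
Proof.
apply: smooth_real => [i s|k CF i]; first exact: is_derive_flat.
by apply: CkB => //; apply: CkM => //; exact: Ck_cst.
Qed.

Lemma bounded_linear_coord n (i : 'I_n) :
  bounded_linear (fun x : 'rV[R]_n => x ord0 i).
Proof. by split; [move=> a x y; rewrite !mxE|exact: coord_continuous]. Qed.

Lemma smooth_coord P n (i : 'I_n) : smooth (fun (_ : P) (x : 'rV[R]_n) => x ord0 i).
Proof. by move=> k; apply: Ck_linear; exact: bounded_linear_coord. Qed.

Lemma smooth_normsq P n : smooth (fun (_ : P) => @normsq R n).
Proof. by move=> k; apply: Ck_sum => i; apply: CkX; exact: smooth_coord. Qed.

Lemma bumpE n (x : 'rV[R]_n) : Defs.bump x = flat 0 (1 - normsq x).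
Proof. by rewrite /Defs.bump /flat subr_gt0 expr0 invr1 mul1r. Qed.

Lemma smooth_bump P n : smooth (fun _ : P => @Defs.bump R n).
Proof.
move=> k; apply: (@Ck_ext _ _ _ _ _ (fun _ x => flat 0 (1 - normsq x))).
  by move=> _ x; rewrite bumpE.
apply: (@Ck_comp _ _ _ _ _ _ (fun _ => flat 0) (fun _ x => 1 - normsq x)).
  exact: smooth_flat.
by apply: CkB; [exact: Ck_cst|exact: smooth_normsq].
Qed.

Lemma smooth_scale_arg P n (c : R) W (f : P -> 'rV[R]_n -> W) :
  smooth f -> smooth (fun p x => f p (c *: x)).
Proof.
move=> Cf k; apply: Ck_comp; first exact: Cf.
by apply: CkZ; [exact: Ck_cst|exact: Ck_id].
Qed.

Lemma smooth_friedrichs_eps P n eps : smooth (fun _ : P => @friedrichs_eps R n eps).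
Proof.
move=> k; apply: CkM; first exact: Ck_cst.
apply: (@smooth_scale_arg _ _ _ _ (fun _ => @friedrichs R n)) => {}k.
by apply: CkM; [exact: smooth_bump|exact: Ck_cst].
Qed.

Lemma is_derive_scalel W (l : W) (s : R) : is_derive s (1 : R) (fun t => t *: l) l.
Proof.
apply/is_deriveP => e e0; near=> t.
by rewrite [t *: 1]mulr1 scalerDl addrK subrr normr0 mulr_ge0// ltW.
Unshelve. all: by end_near. Qed.

Lemma is_derive_mull (l s : R) : is_derive s (1 : R) (fun t => l * t) l.
Proof.
by have := is_derive_scalel l s; rewrite (_ : (fun _ => _) = fun t => l * t)//;
  apply/funext => t; exact: mulrC.
Qed.

Lemma continuous_pairr (U V : topologicalType) (x : U) : continuous (fun y : V => (x, y)).
Proof. by move=> y; exact: (cvg_pair (cvg_cst x) cvg_id). Qed.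

(** The mean value inequality is used twice, along [w] for the inner difference and along [v] for
    the outer one; continuity of the iterated derivative at [x] controls it on the whole
    parallelogram. *)
Lemma second_difference P V W (f : P -> V -> W) p x v w (e : R) :
  Ck 2 f -> 0 < e -> exists2 d : R, 0 < d & forall h, 0 < h < d ->
  `|f p (x + h *: v + h *: w) - f p (x + h *: v) - (f p (x + h *: w) - f p x) -
    h *: (h *: 'D_w ('D_v (f p)) x)| <= e * h * h.
Proof.
move=> Cf e0.
have C1 : Ck 1 (fun p => 'D_v (f p)) by exact: Ck_derive.
have cD := Ck_continuous (p:=p) (Ck_derive w C1).
have /cvgrPdist_le /(_ _ e0) := cD x.
rewrite near_simpl => /nbhs_normP[r /= r0 Hr].
have c0 : 0 < `|v| + `|w| + 1 by rewrite ltr_wpDl ?addr_ge0.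
exists (r / (`|v| + `|w| + 1)); first by rewrite divr_gt0.
move=> h /andP[h0 hr].
have small s t : 0 <= s <= h -> 0 <= t <= h ->
    `|'D_w ('D_v (f p)) (x + s *: v + t *: w) - 'D_w ('D_v (f p)) x| <= e.
  move=> /andP[s0 sh] /andP[t0 th]; rewrite distrC; apply: Hr => /=.
  rewrite opprD addrA opprD addrA subrr sub0r -opprD normrN.
  rewrite (le_lt_trans (ler_normD _ _))// !normrZ !ger0_norm//.
  move: hr; rewrite ltr_pdivlMr// => hr.
  have : s * `|v| <= h * `|v| by rewrite ler_wpM2r.
  have : t * `|w| <= h * `|w| by rewrite ler_wpM2r.
  by move: hr; rewrite !mulrDr mulr1; lra.
have df y u : derivable (f p) y u by exact: Ck_derivable Cf.
have ddf y u : derivable ('D_v (f p)) y u by exact: (Ck_derivable C1).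
have inner s : 0 <= s <= h -> `|'D_v (f p) (x + s *: v + h *: w) -
    'D_v (f p) (x + s *: v) - h *: 'D_w ('D_v (f p)) x| <= e * h.
  move=> sh; pose g t := 'D_v (f p) (x + s *: v + t *: w) - t *: 'D_w ('D_v (f p)) x.
  have := @vector_MVT R W g (fun t => 'D_w ('D_v (f p)) (x + s *: v + t *: w) -
    'D_w ('D_v (f p)) x) (fun t => e * t) (fun => e) 0 h (ltW h0).
  rewrite /g scale0r addr0 scale0r subr0 mulr0 subr0 addrAC; apply.
  - by move=> t _; apply: is_deriveB; [exact: is_derive_line|exact: is_derive_scalel].
  - by move=> t _; exact: is_derive_mull.
  - by move=> t th; exact: small.
pose g s := f p (x + s *: v + h *: w) - f p (x + s *: v) -
  s *: (h *: 'D_w ('D_v (f p)) x).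
have := @vector_MVT R W g (fun s => 'D_v (f p) (x + s *: v + h *: w) -
    'D_v (f p) (x + s *: v) - h *: 'D_w ('D_v (f p)) x)
  (fun t => e * h * t) (fun => e * h) 0 h (ltW h0).
rewrite /g !scale0r !addr0 subr0 mulr0 subr0 addrAC; apply.
- move=> t _; apply: is_deriveB; last exact: is_derive_scalel.
  apply: is_deriveB; last exact: is_derive_line.
  have := @is_derive_line _ _ _ (f p) (x + h *: w) v t.
  rewrite addrAC => /(_ (df _ _)).
  by under eq_fun do rewrite addrAC.
- by move=> t _; exact: is_derive_mull.
- by move=> t th; exact: inner.
Qed.

(** Schwarz's theorem: the second difference is symmetric in [v] and [w], and divided by [h * h] it
    approximates the mixed derivative in either order. *)
Lemma derive_symmetric P V W (f : P -> V -> W) p x v w :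
  Ck 2 f -> 'D_v ('D_w (f p)) x = 'D_w ('D_v (f p)) x.
Proof.
move=> Cf; suff key (e : R) : 0 < e -> `|'D_v ('D_w (f p)) x - 'D_w ('D_v (f p)) x| <= e.
  by apply/eqP; rewrite -subr_eq0 -normr_le0; apply/ler_addgt0Pr => e /key; rewrite add0r.
move=> e0; have e20 : 0 < e / 2 by rewrite divr_gt0.
have [d1 d10 H1] := second_difference p x v w Cf e20.
have [d2 d20 H2] := second_difference p x w v Cf e20.
pose h := Num.min d1 d2 / 2.
have m0 : 0 < Num.min d1 d2 by rewrite lt_min d10.
have h0 : 0 < h by rewrite divr_gt0.
have hm : h < Num.min d1 d2 by rewrite ltr_pdivrMr// ltr_pMr// ltr1n.
move: hm; rewrite lt_min => /andP[hd1 hd2].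
have {}H1 := H1 h; rewrite h0 hd1 in H1; have {}H1 := H1 isT.
have {}H2 := H2 h; rewrite h0 hd2 in H2; have {}H2 := H2 isT.
have hh0 : 0 < h * h by rewrite mulr_gt0.
rewrite -(@ler_pM2l _ (h * h))// -[X in X * `|_|](ger0_norm (ltW hh0)).
rewrite -normrZ scalerBr.
set D := f p (x + h *: v + h *: w) - f p (x + h *: v) - (f p (x + h *: w) - f p x) in H1.
have DE : f p (x + h *: w + h *: v) - f p (x + h *: w) - (f p (x + h *: v) - f p x) = D.
  by rewrite /D [x + _ + h *: v]addrAC !opprB addrACA [RHS]addrACA [X in _ + X]addrC.
rewrite DE in H2; rewrite !scalerA in H1 H2.
have -> : (h * h) *: 'D_v ('D_w (f p)) x - (h * h) *: 'D_w ('D_v (f p)) x =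
  (D - (h * h) *: 'D_w ('D_v (f p)) x) - (D - (h * h) *: 'D_v ('D_w (f p)) x).
  by rewrite opprB [RHS]addrC subrKA.
rewrite (le_trans (ler_normB _ _))// (le_trans (lerD H1 H2))//.
by rewrite (_ : _ + _ = h * h * e)//; field.
Qed.

(** Uniformity in the base point [y] is what additivity of the derivative in its direction requires:
    there the increment along [v] starts at [x + h *: w] and not at [x]. *)
Lemma strict_derive P V W (f : P -> V -> W) p x v (e : R) : Ck 1 f -> 0 < e ->
  exists2 d : R, 0 < d & forall y h, `|y - x| < d -> `|h| < d ->
    `|f p (y + h *: v) - f p y - h *: 'D_v (f p) x| <= e * `|h|.
Proof.
move=> Cf e0; have /cvgrPdist_le /(_ _ e0) := Ck_continuous (p:=p) (Ck_derive v Cf) (x:=x).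
rewrite near_simpl => /nbhs_normP[r /= r0 Hr].
have r20 : 0 < r / 2 by rewrite divr_gt0.
have v0 : 0 < `|v| + 1 by rewrite ltr_wpDl.
exists (Num.min (r / 2) (r / 2 / (`|v| + 1))); first by rewrite lt_min r20 divr_gt0.
move=> y h; rewrite !lt_min => /andP[yx _] /andP[_ hv].
rewrite ltr_pdivlMr// in hv.
pose g s := f p (y + s *: (h *: v)) - s *: (h *: 'D_v (f p) x).
have := @vector_MVT R W g (fun s => h *: 'D_v (f p) (y + s *: (h *: v)) -
  h *: 'D_v (f p) x) (fun s => s *: (e * `|h|)) (fun _ => e * `|h|) 0 1 ler01.
rewrite /g !scale1r !scale0r !subr0 addr0 addrAC; apply.
- move=> s _; apply: is_deriveB; last exact: is_derive_scalel.
  rewrite -deriveZv; last exact: Ck_derivable Cf.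
  by apply: is_derive_line; exact: Ck_derivable Cf.
- by move=> s _; exact: is_derive_scalel.
- move=> s /andP[s0 s1]; rewrite -scalerBr normrZ mulrC ler_wpM2r// distrC.
  apply: Hr => /=; rewrite opprD addrA (le_lt_trans (ler_normB _ _))// distrC.
  rewrite [r]splitr ltrD// !normrZ ger0_norm//.
  apply: le_lt_trans hv; apply: (@le_trans _ _ (`|h| * `|v|)).
    by rewrite ler_piMl// mulr_ge0.
  by rewrite ler_wpM2l// lerDl.
Qed.

Lemma tangentD P V W (f : P -> V -> W) p x v w :
  Ck 1 f -> 'D_(v + w) (f p) x = 'D_v (f p) x + 'D_w (f p) x.
Proof.
move=> Cf; suff : is_derive x (v + w) (f p) ('D_v (f p) x + 'D_w (f p) x).
  by move=> ?; rewrite derive_val.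
apply/is_deriveP_ball => e e0; have e20 : 0 < e / 2 by rewrite divr_gt0.
have [d1 d10 H1] := strict_derive p x v Cf e20.
have [d2 d20 H2] := strict_derive p x w Cf e20.
have w0 : 0 < `|w| + 1 by rewrite ltr_wpDl.
exists (Num.min (d1 / (`|w| + 1)) (Num.min d1 d2)); first by rewrite !lt_min divr_gt0//= d10.
move=> h; rewrite !lt_min ltr_pdivlMr// => /and3P[hw h1 h2].
have {}H2 := H2 x h; rewrite subrr normr0 in H2; have {}H2 := H2 d20 h2.
have {}H1 : `|f p (x + h *: w + h *: v) - f p (x + h *: w) - h *: 'D_v (f p) x| <= e / 2 * `|h|.
  apply: H1 => //; rewrite [x + _]addrC addrK normrZ (le_lt_trans _ hw)//.
  by rewrite ler_wpM2l// lerDl.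
rewrite scalerDr [_ + x]addrC [h *: v + _]addrC addrA scalerDr.
set a := f p (x + h *: w + h *: v) in H1 *; set b := f p (x + h *: w) in H1 H2.
have -> : a - f p x - (h *: 'D_v (f p) x + h *: 'D_w (f p) x) =
    (a - b - h *: 'D_v (f p) x) + (b - f p x - h *: 'D_w (f p) x).
  by rewrite [RHS]addrACA -opprD subrKA.
by rewrite (le_trans (ler_normD _ _))// [e]splitr mulrDl lerD.
Qed.

Lemma tangentZ P V W (f : P -> V -> W) p x a v :
  Ck 1 f -> 'D_(a *: v) (f p) x = a *: 'D_v (f p) x.
Proof. by move=> Cf; rewrite deriveZv//; exact: Ck_derivable Cf. Qed.

Lemma tangent_sum P V W (f : P -> V -> W) p x I (r : seq I) (F : I -> V) :
  Ck 1 f -> 'D_(\sum_(i <- r) F i) (f p) x = \sum_(i <- r) 'D_(F i) (f p) x.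
Proof.
move=> Cf; elim: r => [|i r IH]; first by rewrite !big_nil derive0.
by rewrite !big_cons tangentD// IH.
Qed.

Lemma tangent_row P n W (f : P -> 'rV[R]_n -> W) p x (v : 'rV[R]_n) :
  Ck 1 f -> 'D_v (f p) x = \sum_i v ord0 i *: partial i (f p) x.
Proof.
move=> Cf; rewrite [v in LHS]row_sum_delta tangent_sum//.
by apply: eq_bigr => i _; rewrite tangentZ.
Qed.

Lemma rV_norm_ge n (x : 'rV[R]_n) i : `|x ord0 i| <= `|x|.
Proof.
by rewrite [leRHS]/Num.Def.normr/= mx_normrE; apply: (le_bigmax _ _ (ord0, i)).
Qed.

(** The Jacobian matrix is defined from the Frechet differential. In finite dimension the direction
    splits along the basis, so continuity of the [n] partial derivatives makes the remainder uniform
    in the direction. *)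
Lemma Ck_differentiable P n W (f : P -> 'rV[R]_n -> W) p x :
  Ck 1 f -> differentiable (f p) x.
Proof.
move=> Cf; pose A v := 'D_v (f p) x.
have lA : linear A by move=> a v w; rewrite /A tangentD// tangentZ.
pose A' : {linear 'rV[R]_n -> W} := HB.pack A (GRing.isLinear.Build _ _ _ _ A lA).
have cA : continuous A.
  move=> v; apply: (@continuous_comp _ _ _ (fun v => (x, v))
    (fun z : 'rV[R]_n * 'rV[R]_n => 'D_z.2 (f p) z.1)).
    exact: continuous_pairr.
  exact: (@continuous_Ck_tangent _ _ _ _ _ _ _ Cf).
have H : f p \o shift x = cst (f p x) + A' +o_ 0 id.
  apply/eqaddoP => e e0.
  have n0 : 0 < n%:R + 1 :> R by rewrite ltr_wpDl.
  have en : 0 < e / (n%:R + 1) by rewrite divr_gt0.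
  have : \forall y \near x, forall i,
      `|partial i (f p) x - partial i (f p) y| <= e / (n%:R + 1).
    apply: (@filter_forall _ _ (fun i y =>
      `|partial i (f p) x - partial i (f p) y| <= e / (n%:R + 1)) (nbhs x)) => i.
    have /cvgrPdist_le := Ck_continuous (p:=p)
      (Ck_derive (delta_mx ord0 i) Cf) (x:=x).
    exact.
  move=> /nbhs_normP[d /= d0 Hd].
  have : \forall v \near (0 : 'rV[R]_n), `|v| < d by exact: nbhs0_lt.
  apply: filterS => v vd; rewrite -[X in `|X|]/(f p (v + x) - (f p x + A v)).
  pose g s := f p (x + s *: v) - s *: A v.
  have := @vector_MVT R W g (fun s => 'D_v (f p) (x + s *: v) - A v)
    (fun s => e * `|v| * s) (fun _ => e * `|v|) 0 1 ler01.
  rewrite /g !scale1r !scale0r !subr0 addr0 mulr0 subr0 mulr1 opprD addrA addrAC.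
  rewrite [v + x]addrC; apply.
  - move=> s _; apply: is_deriveB; last exact: is_derive_scalel.
    by apply: is_derive_line; exact: Ck_derivable Cf.
  - by move=> s _; exact: is_derive_mull.
  - move=> s /andP[s0 s1]; rewrite /A !(@tangent_row _ _ _ f p _ _ Cf) -sumrB.
    rewrite (le_trans (ler_norm_sum _ _ _))//.
    apply: (@le_trans _ _ (\sum_(i < n) `|v| * (e / (n%:R + 1)))).
      apply: ler_sum => i _; rewrite -scalerBr normrZ ler_pM// ?rV_norm_ge//.
      rewrite distrC Hd//= opprD addrA subrr sub0r normrN normrZ ger0_norm//.
      by rewrite (le_lt_trans _ vd)// ler_piMl.
    rewrite sumr_const card_ord -[_ *+ n]mulr_natl mulrCA [leRHS]mulrC ler_wpM2l//.
    by rewrite mulrA ler_pdivrMr// mulrC ler_wpM2l ?ltW// ltrDl.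
have dE : 'd (f p) x = A' :> (_ -> _) by exact: diff_unique.
by apply/diff_locallyP; rewrite dE.
Qed.

(** Vectors are rows, so the row index is the direction of differentiation: the matrix is the
    transpose of the usual one, with the same determinant. *)
Lemma jacobianE P n m (f : P -> 'rV[R]_n -> 'rV[R]_m) p x i j :
  Ck 1 f -> 'J (f p) x i j = partial i (f p) x ord0 j.
Proof.
move=> Cf; rewrite /partial deriveEjacobian; last exact: Ck_differentiable Cf.
by have /rowP/(_ j) := rowE i ('J (f p) x); rewrite mxE.
Qed.

Lemma is_derive_sqrtXN (s : R) j : 0 < s -> is_derive s (1 : R)
  (fun s => Num.sqrt s ^- j) (- (j%:R / 2) * Num.sqrt s ^- j.+2).
Proof.
move=> s0; have r0 : 0 < Num.sqrt s by rewrite sqrtr_gt0.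
have dV := is_deriveV (f := Num.sqrt) (negbT (gt_eqF r0)) (is_derive1_sqrt s0).
have dX := is_deriveX j dV.
have -> : (fun s => Num.sqrt s ^- j) = (fun s : R => (Num.sqrt s)^-1) ^+ j.
  by apply/funext => t; rewrite exprfctE exprVn.
apply: (is_derive_eq dX).
rewrite -[_ *: _]/(_ * (_ * _)) -!exprVn.
case: j dX => [|j] _; first by rewrite !mul0r oppr0 mul0r.
rewrite /= !exprS expr0 mulr1 invfM.
by field; rewrite gt_eqF.
Qed.

Lemma is_derive_sqrt_snd n (z v : 'rV[R]_n * R) : 0 < z.2 ->
  is_derive z v (fun z : 'rV[R]_n * R => (z.1, Num.sqrt z.2))
    (v.1, v.2 / (2 * Num.sqrt z.2)).
Proof.
move=> z0; have H : is_derive z v (fun z : 'rV[R]_n * R => Num.sqrt z.2)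
    (v.2 / (2 * Num.sqrt z.2)).
  have := is_derive_scale v.2 (is_derive1_sqrt z0); rewrite [v.2 *: 1]mulr1.
  by apply: (@is_derive_comp_linear _ _ _ _ (@snd 'rV[R]_n R) (@Num.sqrt R)).
apply/is_deriveP => e e0; move/is_deriveP : H => /(_ _ e0); apply: filterS => h Hh.
by rewrite prod_normE /= ge_max Hh andbT addrK subrr normr0 mulr_ge0// ltW.
Qed.

(** Every iterated derivative keeps the shape [form g j], a negative power of [sqrt t] times a
    function smooth in [(x, sqrt t)], and this shape is continuous where [t] is positive. *)
Lemma smooth_on_sqrt P n W (f : P -> 'rV[R]_n * R -> W) p : smooth f ->
  smooth_on [set z : 'rV[R]_n * R | 0 < z.2] (fun z => f p (z.1, Num.sqrt z.2)).
Proof.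
pose form (g : P -> 'rV[R]_n * R -> W) j (z : 'rV[R]_n * R) :=
  (Num.sqrt z.2) ^- j *: g p (z.1, Num.sqrt z.2).
have pos_near (z : 'rV[R]_n * R) : 0 < z.2 -> \forall y \near z, 0 < y.2.
  move=> z0; have : \forall s \near z.2, 0 < s by exact: lt_nbhsr.
  by move=> H; exact: (@cvg_snd _ _ (nbhs z.1) (nbhs z.2) _ _ H).
(* The chain rule contributes [1 / (2 tau)] and the prefactor contributes [tau ^- j.+2]. Over the
   common power [tau ^- j.+2] the other terms acquire the smooth factors [tau ^ 2] and [tau]; in the
   formula for [g'] the coordinate [z.2] stands for [tau]. *)
have form_derive g j (v : 'rV[R]_n * R) : smooth g -> exists2 g' : P -> 'rV[R]_n * R -> W,
    smooth g' & forall z : 'rV[R]_n * R, 0 < z.2 -> is_derive z v (form g j) (form g' j.+2 z).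
  move=> Cg.
  exists (fun q z => z.2 ^+ 2 *: 'D_(v.1, 0) (g q) z +
      ((v.2 / 2) * z.2) *: 'D_((0, 1) : 'rV[R]_n * R) (g q) z -
      (j%:R / 2 * v.2) *: g q z).
    have snd_smooth k : Ck k (fun (_ : P) (z : 'rV[R]_n * R) => z.2).
      by apply: Ck_linear; exact: bounded_linear_snd.
    move=> k; apply: CkB; last by apply: CkZ; [exact: Ck_cst|exact: Cg].
    by apply: CkD; apply: CkZ; [exact: CkX|exact: smooth_derive|
      apply: CkM => //; exact: Ck_cst|exact: smooth_derive].
  move=> z z0; have r0 : 0 < Num.sqrt z.2 by rewrite sqrtr_gt0.
  have dr : is_derive z v (fun z : 'rV[R]_n * R => Num.sqrt z.2 ^- j)
      (v.2 * (- (j%:R / 2) * Num.sqrt z.2 ^- j.+2)).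
    have := is_derive_scale v.2 (is_derive_sqrtXN j z0); rewrite [v.2 *: 1]mulr1.
    by apply: (@is_derive_comp_linear _ _ _ _ (@snd 'rV[R]_n R)
      (fun s : R => Num.sqrt s ^- j)).
  have dg := @is_derive_chain _ _ _ _ (g p) _ z v _
    (fun y w => @smooth_derivable _ _ _ _ p y w Cg)
    (@continuous_Ck_tangent _ _ _ _ _ _ p (Cg 1%N)) (is_derive_sqrt_snd v z0).
  apply: (is_derive_eq (is_derive_scaler dr dg)).
  have -> : (v.1, v.2 / (2 * Num.sqrt z.2)) =
      (v.1, 0) + (v.2 / (2 * Num.sqrt z.2)) *: (0, 1) :> 'rV[R]_n * R.
    by congr (_, _) => /=; rewrite ?scaler0 ?addr0// add0r [_ *: 1]mulr1.
  rewrite (@tangentD P _ W g p _ _ _ (Cg 1%N)) (@tangentZ P _ W g p _ _ _ (Cg 1%N)).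
  rewrite /form /= !scalerDr scalerN -scaleNr !scalerA -!exprVn !exprS; congr (_ *: _ + _ *: _ + _ *: _).
  - by field; rewrite gt_eqF.
  - by field; rewrite gt_eqF.
  - by field; rewrite gt_eqF.
have form_cont g j (z : 'rV[R]_n * R) : smooth g -> 0 < z.2 -> {for z, continuous (form g j)}.
  move=> Cg z0; have r0 : 0 < Num.sqrt z.2 by rewrite sqrtr_gt0.
  have cr : Num.sqrt y.2 @[y --> z] --> Num.sqrt z.2.
    apply: (@continuous_comp _ _ _ (@snd 'rV[R]_n R) (@Num.sqrt R)); first exact: cvg_snd.
    exact: sqrt_continuous.
  apply: cvgZ.
    apply: cvgV; first by rewrite expf_neq0// gt_eqF.
    exact: (cvg_comp _ _ cr (@exprn_continuous R j _)).
  apply: (@continuous_comp _ _ _ (fun z : 'rV[R]_n * R => (z.1, Num.sqrt z.2)) (g p)).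
    exact: (cvg_pair cvg_fst cr).
  exact: (@smooth_continuous _ _ _ _ p Cg).
move=> Cf vs.
have [g Cg [j Hg]] : exists2 g, smooth g & exists j, forall z : 'rV[R]_n * R, 0 < z.2 ->
    iter_derive vs (fun z => f p (z.1, Num.sqrt z.2)) z = form g j z.
  elim: vs => [|v vs [g Cg [j Hg]]] /=.
    by exists f => //; exists 0%N => z z0; rewrite /form expr0 invr1 scale1r.
  have [g' Cg' dg'] := form_derive g j v Cg; exists g' => //; exists j.+2 => z z0.
  have /@derive_val <- := dg' z z0.
  by apply: near_eq_derive; near=> y; apply: Hg; near: y; exact: pos_near.
move=> z z0; have gE : \forall y \near z, form g j y =
    iter_derive vs (fun z => f p (z.1, Num.sqrt z.2)) y.
  by near=> y; apply/esym/Hg; near: y; exact: pos_near.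
split=> [v|].
  have [g' Cg' dg'] := form_derive g j v Cg.
  by apply: near_eq_derivable gE _; have [] := dg' z z0.
rewrite /prop_for/= /continuous_at Hg//.
by apply: cvg_trans (form_cont g j z Cg z0); apply: near_eq_cvg.
Unshelve. all: by end_near. Qed.

End smooth_functions.

(** * Gronwall's inequality, uniqueness for differential equations, tools for iteration *)

Section gronwall.
Context {R : realType}.

Lemma normsq_ge n (x : 'rV[R]_n) : `|x| ^+ 2 <= normsq x.
Proof.
have [x0|/mx_norm_neq0[[i j] /= xE]] := eqVneq (mx_norm x) 0.
  by rewrite /Num.Def.normr/= x0 expr0n sumr_ge0// => i _; exact: sqr_ge0.
rewrite [`|x|]/Num.Def.normr/= xE (ord1 i) real_normK ?num_real// /normsq.
by rewrite (bigD1 j)//= lerDl sumr_ge0// => k _; exact: sqr_ge0.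
Qed.

Lemma normsq_le n (x : 'rV[R]_n) : normsq x <= n%:R * `|x| ^+ 2.
Proof.
rewrite mulr_natl -[X in _ *+ X]card_ord -sumr_const.
apply: ler_sum => i _; rewrite -real_normK ?num_real//.
by rewrite lerXn2r ?nnegrE// rV_norm_ge.
Qed.

Lemma normsq_continuous n : continuous (@normsq R n).
Proof. exact: (smooth_continuous (p := 0 : R) (@smooth_normsq R R n)). Qed.

Lemma is_derive_coord n (X : R -> 'rV[R]_n) s dX i : is_derive s (1 : R) X dX ->
  is_derive s (1 : R) (fun t => X t ord0 i) (dX ord0 i).
Proof. exact: is_derive_linear_comp (bounded_linear_coord i). Qed.

Lemma is_derive_normsq n (X : R -> 'rV[R]_n) s dX : is_derive s (1 : R) X dX ->
  is_derive s (1 : R) (@normsq R n \o X) (\sum_i (2 * X s ord0 i * dX ord0 i)).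
Proof.
move=> DX; have H i := is_deriveX 2 (is_derive_coord i DX).
rewrite (_ : @normsq R n \o X = \sum_(i < n) (fun t => X t ord0 i) ^+ 2); last first.
  by apply/funext => t; rewrite fct_sumE; apply: eq_bigr => i _; rewrite exprfctE.
by apply: (is_derive_eq (is_derive_sum (fun i => H i))); apply: eq_bigr => i _;
  rewrite -[_ *: _]/(_ * _) expr1.
Qed.

(* The sup norm is not differentiable, so the estimate goes through [normsq]. *)
Lemma gronwall n (e de : R -> 'rV[R]_n) (K c T : R) :
  0 <= T -> 0 <= K -> 0 <= c -> {within `[0, T], continuous e} ->
  (forall s, 0 < s < T -> is_derive s (1 : R) e (de s)) ->
  (forall s, 0 < s < T -> `|de s| <= K * `|e s| + c) ->
  forall s, 0 <= s <= T ->
    `|e s| <= (n%:R * `|e 0| + c) * expR (n%:R * (2 * K + 1) * T).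
Proof.
move=> T0 K0 c0 ce De He s /andP[s0 sT].
(* The rate comes from [2 E (K E + c) <= (2 K + 1) E ^ 2 + c ^ 2] with [E = |e t|], summed over [n]
   coordinates. It makes [q] below nonincreasing; the summand [c ^+ 2] in [q] absorbs the
   inhomogeneous term, as [n <= a]. *)
set a := n%:R * (2 * K + 1).
have a0 : 0 <= a by rewrite mulr_ge0// addr_ge0// mulr_ge0.
have na : n%:R <= a by rewrite -[leLHS]mulr1 ler_wpM2l// lerDr mulr_ge0.
pose q t := (normsq (e t) + c ^+ 2) * expR (- a * t).
have Dexp t : is_derive t (1 : R) (fun t => expR (- a * t)) (expR (- a * t) * - a).
  exact: (is_derive1_comp (is_derive_expR _) (is_derive_mull (- a) t)).
have Dq t : 0 < t < T -> is_derive t (1 : R) q ((\sum_i (2 * e t ord0 i * de t ord0 i)) *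
    expR (- a * t) + (normsq (e t) + c ^+ 2) * (expR (- a * t) * - a)).
  move=> tT; have D1 := is_derive_normsq (De _ tT).
  have D2 : is_derive t (1 : R) (fun t => normsq (e t) + c ^+ 2) (\sum_i (2 * e t ord0 i * de t ord0 i)).
    by have := is_deriveD D1 (is_derive_cst (c ^+ 2) t 1); rewrite addr0.
  apply: (is_derive_eq (is_deriveM D2 (Dexp t))).
  by rewrite -![_ *: _]/(_ * _) addrC; congr (_ + _); rewrite mulrC.
have qs0 : q s <= q 0.
  apply: (@ler0_derive1_le_cc _ q 0 T) => //.
  - by move=> t /[!in_itv]/= tT; have [] := Dq _ tT.
  - move=> t /[!in_itv]/= tT; rewrite derive1E; have /@derive_val -> := Dq _ tT.
    rewrite mulrA -[X in _ + X]mulrA [X in _ + _ * X]mulrC mulrA -mulrDl pmulr_lle0 ?expR_gt0//.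
    rewrite mulrN subr_le0.
    have := He _ tT; have := normsq_ge (e t).
    set E := `|e t| => E2 dE.
    have H1 : \sum_i (2 * e t ord0 i * de t ord0 i) <= \sum_(i < n) (2 * E * (K * E + c)).
      apply: ler_sum => i _; apply: le_trans (ler_norm _) _.
      rewrite !normrM (ger0_norm (ler0n _ 2)) ler_pM ?mulr_ge0//.
        by rewrite ler_wpM2l// rV_norm_ge.
      exact: le_trans (rV_norm_ge _ _) dE.
    apply: (le_trans H1); rewrite sumr_const card_ord -[_ *+ n]mulr_natl.
    apply: (@le_trans _ _ (n%:R * ((2 * K + 1) * normsq (e t) + c ^+ 2))).
      rewrite ler_wpM2l//; have : 0 <= (E - c) ^+ 2 by exact: sqr_ge0.
      have : 0 <= (2 * K + 1) * (normsq (e t) - E ^+ 2).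
        by rewrite mulr_ge0 ?subr_ge0// addr_ge0// mulr_ge0.
      by rewrite sqrrB; nra.
    rewrite mulrDr mulrA -/a [leRHS]mulrDl [normsq _ * a]mulrC lerD2l.
    by rewrite mulrC ler_wpM2l// sqr_ge0.
  - move=> t; apply: cvgM.
      apply: cvgD; last exact: cvg_cst.
      exact: (cvg_comp _ _ (ce t) (@normsq_continuous n (e t))).
    apply: (@continuous_subspaceT _ _ _ (fun t => expR (- a * t))) => {}t.
    by apply: differentiable_continuous; apply/derivable1_diffP; have [] := Dexp t.
  - by rewrite in_itv/= s0 sT.
  - by rewrite in_itv/= lexx.
have Ex1 : 1 <= expR (a * T) by rewrite -expR0 ler_expR mulr_ge0.
have {}qs0 : normsq (e s) + c ^+ 2 <= (n%:R * `|e 0| ^+ 2 + c ^+ 2) * expR (a * T).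
  have : q 0 <= n%:R * `|e 0| ^+ 2 + c ^+ 2.
    by rewrite /q mulr0 expR0 mulr1 lerD2r normsq_le.
  move=> /(le_trans qs0); rewrite /q mulNr expRN ler_pdivrMr ?expR_gt0// => H.
  apply: (le_trans H); rewrite ler_wpM2l ?ler_expR ?ler_wpM2l//.
  by rewrite addr_ge0// mulr_ge0// sqr_ge0.
have r0 : 0 <= (n%:R * `|e 0| + c) * expR (a * T).
  by rewrite mulr_ge0 ?expR_ge0// addr_ge0// mulr_ge0.
rewrite -(@ler_pXn2r _ 2) ?nnegrE//.
apply: (le_trans (normsq_ge _)); apply: (@le_trans _ _ (normsq (e s) + c ^+ 2)).
  by rewrite lerDl sqr_ge0.
apply: (le_trans qs0); rewrite exprMn.
apply: ler_pM; rewrite ?expR_ge0 ?addr_ge0 ?mulr_ge0 ?sqr_ge0//; last first.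
  by rewrite expr2 ler_peMr// expR_ge0.
rewrite sqrrD exprMn lerD2r (@le_trans _ _ (n%:R ^+ 2 * `|e 0| ^+ 2))//.
  by rewrite ler_wpM2r ?sqr_ge0// -natrX ler_nat; case: (n) => // m; rewrite leq_pmull.
by rewrite lerDl mulrn_wge0// !mulr_ge0.
Qed.

Lemma within_continuous_precomp (W : topologicalType) (A B : set R) (g : R -> R) (f : R -> W) :
  continuous g -> (forall s, A s -> B (g s)) -> {within B, continuous f} ->
  {within A, continuous (f \o g)}.
Proof.
move=> cg AB /subspace_continuousP cf; apply/subspace_continuousP => x Ax.
apply: cvg_comp (cf _ (AB _ Ax)) => C /= H.
have H' : \forall y \near g x, B y -> C y by exact: H.
have {}H' : \forall y \near x, B (g y) -> C (g y) := cg x _ H'.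
suff : nbhs x (fun y => A y -> C (g y)) by [].
by apply: filterS H' => y /= Hy Ay; exact/Hy/AB.
Qed.

Lemma is_derive_affine (W : normedModType R) (X : R -> W) (a b s : R) l :
  is_derive (b + a * s) (1 : R) X l -> is_derive s (1 : R) (fun r => X (b + a * r)) (a *: l).
Proof.
move=> /(is_derive_scale a) /is_deriveP H; apply/is_deriveP => e /H; apply: filterS => h.
have -> : h *: (a *: 1) + (b + a * s) = b + a * (h *: 1 + s).
  by rewrite -![_ *: _]/(_ * _); ring.
by [].
Qed.

Lemma continuous_affine (a b : R) : continuous (fun r : R => b + a * r).
Proof.
move=> r; apply: cvgD; first exact: cvg_cst.
by apply: cvgM; [exact: cvg_cst|exact: cvg_id].
Qed.

(* The two solutions are compared forwards and backwards from [t]. *)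
Lemma ode_unique n (f : 'rV[R]_n -> R -> 'rV[R]_n) (L t : R) (X Y : R -> 'rV[R]_n) :
  0 <= L -> 0 <= t ->
  (forall x y s, `|f x s - f y s| <= L * `|x - y|) ->
  {within `[0, +oo[, continuous X} -> {within `[0, +oo[, continuous Y} ->
  (forall s : R, 0 < s -> is_derive s (1 : R) X (f (X s) s)) ->
  (forall s : R, 0 < s -> is_derive s (1 : R) Y (f (Y s) s)) ->
  X t = Y t -> forall s, 0 <= s -> X s = Y s.
Proof.
move=> L0 t0 Lf cX cY DX DY XYt.
pose e s := X s - Y s.
have ce : {within `[0, +oo[, continuous e} by move=> s; apply: cvgB; [exact: cX|exact: cY].
have De (s : R) : 0 < s -> is_derive s (1 : R) e (f (X s) s - f (Y s) s).
  by move=> s0; apply: is_deriveB; [exact: DX|exact: DY].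
have et : e t = 0 by rewrite /e XYt subrr.
have key a T : 0 <= T -> `|a| <= 1 -> (forall r, 0 < r < T -> 0 < t + a * r) ->
    0 <= t + a * T -> e (t + a * T) = 0.
  move=> T0 a1 aT aT0; apply/eqP; rewrite -normr_le0.
  have := @gronwall n (fun r => e (t + a * r))
    (fun r => a *: (f (X (t + a * r)) (t + a * r) - f (Y (t + a * r)) (t + a * r)))
    L 0 T T0 L0 (lexx 0).
  have ta0 : t + a * 0 = t by rewrite mulr0 addr0.
  rewrite ta0 et normr0 mulr0 addr0 mul0r => /(_ _ _ _ T).
  rewrite T0 lexx; apply; last by [].
  - apply: (@within_continuous_precomp _ _ `[0, +oo[) ce => [|r /=].
      exact: continuous_affine.
    rewrite !in_itv/= andbT => /andP[r0 rT].
    have [->|r0'] := eqVneq r 0; first by rewrite mulr0 addr0.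
    have [->|rT'] := eqVneq r T; first by [].
    by apply/ltW/aT; rewrite !lt_neqAle eq_sym r0' r0 rT' rT.
  - by move=> r rT; apply: is_derive_affine; apply: De; exact: aT.
  - move=> r rT; rewrite addr0 normrZ; set u := f _ _ - f _ _.
    by apply: (@le_trans _ _ `|u|); [rewrite ler_piMl|exact: Lf].
move=> s s0; apply/eqP; rewrite -subr_eq0; apply/eqP; rewrite -/(e s).
have [st|ts] := leP s t.
- have := key (-1) (t - s); rewrite (_ : t + -1 * (t - s) = s); last by ring.
  rewrite subr_ge0; apply => //.
    by rewrite normrN normr1.
  by move=> r /andP[_ rt]; rewrite mulN1r subr_gt0 (lt_le_trans rt)// gerBl.
- have := key 1 (s - t); rewrite (_ : t + 1 * (s - t) = s); last by ring.
  rewrite subr_ge0; apply => //; first exact: ltW.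
    by rewrite normr1.
  by move=> r /andP[r0 _]; rewrite mul1r ltr_wpDl.
Qed.

(* Primitives are taken from the base point -2, so that they are differentiable
   on a neighbourhood of [-1, +oo[. *)
Lemma primitive_exists n (g : R -> 'rV[R]_n) (t : R) : continuous g ->
  exists2 G : R -> 'rV[R]_n, G t = 0 &
    forall s : R, -2 < s -> is_derive s (1 : R) G (g s).
Proof.
move=> cg; pose I i s := (\int[lebesgue_measure]_(r in `[(-2)%R, s]) g r ord0 i)%R.
exists (fun s => \row_i (I i s - I i t)); first by apply/rowP => i; rewrite !mxE subrr.
move=> s s2.
have cgi i : continuous (fun r => g r ord0 i).
  move=> r; apply: (@continuous_comp _ _ _ g (fun x : 'rV[R]_n => x ord0 i)); first exact: cg.
  exact: coord_continuous.
have DI i : is_derive s (1 : R) (I i) (g s ord0 i).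
  have s1 : s < s + 1 by rewrite ltrDl.
  have int : lebesgue_measure.-integrable `[(-2)%R, (s + 1)%R] (EFin \o (fun r => g r ord0 i)).
    apply: continuous_compact_integrable; first exact: segment_compact.
    by apply: continuous_subspaceT => r; exact: cgi.
  have [d1 d2] := continuous_FTC1_closed s1 int s2 (cgi i s).
  by split; [exact: d1|rewrite -derive1E; exact: d2].
have DI' i : is_derive s (1 : R) (fun s => I i s - I i t) (g s ord0 i).
  by have := is_deriveB (DI i) (is_derive_cst (I i t) s 1); rewrite subr0.
have d : derivable (fun s => \row_i (I i s - I i t)) s 1.
  apply/derivable_mxP => i j; rewrite (_ : (fun _ => _) = fun s => I j s - I j t).
    by have [] := DI' j.
  by apply/funext => r; rewrite mxE.
split=> //; rewrite derive_mx//; apply/rowP => i; rewrite mxE.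
rewrite (_ : (fun _ => _) = fun s => I i s - I i t).
  by have [] := DI' i.
by apply/funext => r; rewrite mxE.
Qed.

Lemma le_geometric0 (a C : R) : (forall k, a <= C / 2 ^+ k) -> a <= 0.
Proof.
move=> H; rewrite leNgt; apply/negP => a0.
have C0 : 0 <= C by apply: le_trans (ltW a0) _; have := H 0%N; rewrite expr0 divr1.
pose K := Num.bound (C / a).
have : C / a < K%:R by apply: archi_boundP; rewrite divr_ge0// ltW.
rewrite ltr_pdivrMr// ltNge => /negP; apply.
have := H K; rewrite ler_pdivlMr ?exprn_gt0//; apply: le_trans.
by rewrite mulrC ler_pM2l// -natrX ler_nat ltnW// ltn_expl.
Qed.

Lemma geometric_cvg n (u : nat -> 'rV[R]_n) (C : R) :
  (forall k, `|u k.+1 - u k| <= C / 2 ^+ k) ->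
  exists l, forall k, `|l - u k| <= 2 * C / 2 ^+ k.
Proof.
move=> Hu.
have C0 : 0 <= C by have := Hu 0%N; rewrite expr0 divr1; apply: le_trans.
have p2 k : 0 < 2 ^+ k :> R by rewrite exprn_gt0.
have step k m : `|u (k + m)%N - u k| <= 2 * C / 2 ^+ k - 2 * C / 2 ^+ (k + m).
  elim: m => [|m IH]; first by rewrite addn0 !subrr normr0.
  rewrite addnS -(subrKA (u (k + m)%N)) (le_trans (ler_normD _ _))//.
  apply: (le_trans (lerD (Hu _) IH)).
  have -> : 2 * C / 2 ^+ (k + m).+1 = C / 2 ^+ (k + m).
    by rewrite exprS; field; rewrite gt_eqF.
  by have := p2 (k + m)%N; rewrite -!mulrA; set q := C / 2 ^+ (k + m); lra.
have step' k m : (k <= m)%N -> `|u m - u k| <= 2 * C / 2 ^+ k.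
  move=> /subnKC <-; apply: (le_trans (step _ _)).
  by rewrite gerBl divr_ge0 ?mulr_ge0// ltW.
have cu : cvgn u.
  apply/cauchy_cvgP/cauchy_exP => e e0.
  pose K := Num.bound (2 * C / e); exists (u K).
  exists K => // m /= Km; rewrite -ball_normE /= distrC (le_lt_trans (step' _ _ Km))//.
  have : 2 * C / e < K%:R by apply: archi_boundP; rewrite divr_ge0 ?mulr_ge0// ltW.
  rewrite !ltr_pdivrMr// => /lt_le_trans; apply.
  by rewrite mulrC ler_pM2l// -natrX ler_nat ltnW// ltn_expl.
exists (limn u) => k.
have H : `|u m - u k| @[m --> \oo] --> `|limn u - u k|.
  by apply: cvg_norm; apply: cvgB; [exact: cu|exact: cvg_cst].
by apply: (cvgr_to_le H); exists k => // m /= km; exact: step'.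
Qed.

End gronwall.

(** * Global existence by Picard iteration *)

Section picard.
Context {R : realType}.

Lemma continuous_at_pair (T U V : topologicalType) (f : T -> U) (g : T -> V) x :
  {for x, continuous f} -> {for x, continuous g} ->
  {for x, continuous (fun y => (f y, g y))}.
Proof. by move=> cf cg; apply: cvg_pair; [exact: cf|exact: cg]. Qed.

Lemma bounded_linear_mull (C : R) : bounded_linear (fun x : R => C * x).
Proof.
split; last by move=> x; apply: cvgM; [exact: cvg_cst|exact: cvg_id].
by move=> a x y; rewrite mulrDr; congr (_ + _); rewrite mulrCA.
Qed.

Lemma is_derive_expR_affine (a t s : R) :
  is_derive s (1 : R) (fun s => expR (a * (s - t))) (a * expR (a * (s - t))).
Proof.
have D1 : is_derive s (1 : R) (fun s => a * (s - t)) a.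
  have := is_derive_affine (b := - (a * t)) (is_derive_id (- (a * t) + a * s) (1 : R)).
  by rewrite [a *: 1]mulr1 (_ : (fun _ => _) = fun s => a * (s - t))//;
    apply/funext => r; ring.
have := @is_derive1_comp R expR (fun s => a * (s - t)) s _ _ (is_derive_expR _) D1.
by rewrite mulrC.
Qed.

(** Integrating the bound on [dg] from [t] returns the same exponential weight with the factor [L]
    removed. In the sup norm with this weight (Bielecki's norm) integration gains a factor [1 / L]
    on intervals of any length, on both sides of [t]. *)
Lemma exp_weight_bound (W : normedModType R) (a b t L C : R) (g dg : R -> W) :
  0 <= C -> g t = 0 -> a <= t <= b ->
  (forall s, a <= s <= b -> is_derive s (1 : R) g (dg s)) ->
  (forall s, a <= s <= b -> `|dg s| <= L * C * expR (L * `|s - t|)) ->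
  forall s, a <= s <= b -> `|g s| <= C * expR (L * `|s - t|).
Proof.
move=> C0 gt /andP[at_ tb] Dg Hg s /andP[as_ sb]; have [st|ts] := leP s t.
- have := @vector_MVT R W g dg (fun s => - C * expR (- L * (s - t)))
    (fun s => - C * (- L * expR (- L * (s - t)))) s t st.
  rewrite gt sub0r normrN subrr mulr0 expR0 mulr1 => H.
  have {}H : `|g s| <= - C - - C * expR (- L * (s - t)).
    apply: H => r /andP[sr rt].
    + by apply: Dg; rewrite (le_trans as_ sr) (le_trans rt tb).
    + exact: (is_derive_linear_comp (bounded_linear_mull (- C)) (is_derive_expR_affine _ t r)).
    + have := Hg r; rewrite (le_trans as_ sr) (le_trans rt tb) => /(_ isT).
      rewrite ler0_norm ?subr_le0// => /le_trans; apply.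
      have -> : L * - (r - t) = - L * (r - t) by ring.
      by rewrite le_eqVlt; apply/orP; left; apply/eqP; ring.
  apply: (le_trans H); rewrite ler0_norm ?subr_le0//.
  have -> : L * - (s - t) = - L * (s - t) by ring.
  by rewrite mulNr opprK gerDr oppr_le0.
- have := @vector_MVT R W g dg (fun s => C * expR (L * (s - t)))
    (fun s => C * (L * expR (L * (s - t)))) t s (ltW ts).
  rewrite gt subr0 subrr mulr0 expR0 mulr1 => H.
  have {}H : `|g s| <= C * expR (L * (s - t)) - C.
    apply: H => r /andP[tr rs].
    + by apply: Dg; rewrite (le_trans at_ tr) (le_trans rs sb).
    + exact: (is_derive_linear_comp (bounded_linear_mull C) (is_derive_expR_affine _ t r)).
    + have := Hg r; rewrite (le_trans at_ tr) (le_trans rs sb) => /(_ isT).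
      by rewrite ger0_norm ?subr_ge0// [C * (_ * _)]mulrCA mulrA.
  apply: (le_trans H); rewrite gtr0_norm ?subr_gt0// gerBl//.
Qed.

(** Picard iteration started from the constant [x0]. The solution is continued below time 0 so that
    it is differentiable there on both sides; time 0 is where the feet of the characteristics are
    taken. *)
Lemma ode_exists n (f : 'rV[R]_n -> R -> 'rV[R]_n) (L B t : R) (x0 : 'rV[R]_n) :
  0 < L -> 0 <= B -> 0 <= t ->
  continuous (fun z : 'rV[R]_n * R => f z.1 z.2) ->
  (forall x y s, `|f x s - f y s| <= L * `|x - y|) ->
  (forall s, `|f x0 s| <= B) ->
  exists2 X : R -> 'rV[R]_n, X t = x0 &
    forall s : R, -1 < s -> is_derive s (1 : R) X (f (X s) s).
Proof.
move=> L0 B0 t0 cf Lf Bf.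
(* The iterates are controlled only beyond -2. Freezing the argument below -1 makes the integrand
   continuous on the whole line and changes nothing where the equation is claimed. *)
pose cl (s : R) := Num.max s (-1).
have cl1 s : -1 <= cl s by rewrite le_max lexx orbT.
have clE s : -1 <= s -> cl s = s by move=> s1; rewrite /cl max_l.
have ccl : continuous cl.
  by move=> s; apply: (@continuous_max _ _ id (cst (-1))); [exact: cvg_id|exact: cst_continuous].
pose good (X : R -> 'rV[R]_n) := forall s : R, -2 < s -> {for s, continuous X}.
have goodG X : good X -> continuous (fun s => f (X (cl s)) s).
  move=> gX s; apply: (@continuous_comp _ _ _ (fun s => (X (cl s), s)) (fun z : 'rV[R]_n * R => f z.1 z.2)).
    have Xcl : X r @[r --> cl s] --> X (cl s).
      by apply: gX; rewrite (lt_le_trans _ (cl1 s))// ltrN2 ltr1n.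
    apply: continuous_at_pair; last exact: cvg_id.
    exact: (cvg_comp _ _ (ccl s) Xcl).
  exact: cf.
(* The iteration needs a total function of [X]; a Picard step is specified for good [X] and
   arbitrary otherwise. *)
have step X : {Y : R -> 'rV[R]_n | good X -> good Y /\ Y t = x0 /\
    forall s : R, -2 < s -> is_derive s (1 : R) Y (f (X (cl s)) s)}.
  apply: cid; have [gX|] := pselect (good X); last by exists X.
  have [G Gt DG] := primitive_exists t (goodG _ gX).
  have DY (s : R) : -2 < s -> is_derive s (1 : R) (fun s => x0 + G s) (f (X (cl s)) s).
    by move=> s2; have := is_deriveD (is_derive_cst x0 s 1) (DG _ s2); rewrite add0r.
  exists (fun s => x0 + G s) => _; split; last by split=> //; rewrite Gt addr0.
  move=> s s2; apply: differentiable_continuous; apply/derivable1_diffP.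
  by have [] := DY _ s2.
pose X k := iter k (fun X => sval (step X)) (cst x0).
have gX k : good (X k).
  elim: k => [|k IH]; first by move=> s _; exact: cst_continuous.
  by have [] := svalP (step (X k)) IH.
have Xt k : X k t = x0.
  by case: k => [//|k]; have [_ []] := svalP (step (X k)) (gX k).
have DX k (s : R) : -2 < s -> is_derive s (1 : R) (X k.+1) (f (X k (cl s)) s).
  by have [_ [_]] := svalP (step (X k)) (gX k); apply.
have {}DX k (s : R) : -1 <= s -> is_derive s (1 : R) (X k.+1) (f (X k s) s).
  by move=> s1; rewrite -{2}(clE _ s1); apply: DX; rewrite (lt_le_trans _ s1)// ltrN2 ltr1n.
(* The derivative of the first increment is bounded by [B = 2 * L * M]; with rate [2 * L] in the
   weight this gives the increment weighted size at most [M]. *)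
pose M := B / (2 * L).
have M0 : 0 <= M by rewrite divr_ge0// mulr_ge0// ltW.
pose E s := expR (2 * L * `|s - t|).
have p2 k : 0 < 2 ^+ k :> R by rewrite exprn_gt0.
have L2 : 0 < 2 * L by rewrite mulr_gt0.
(* with the weight E each Picard step halves the distance *)
have bnd k s : -1 <= s -> `|X k.+1 s - X k s| <= M / 2 ^+ k * E s.
  have base (g dg : R -> 'rV[R]_n) (C : R) : 0 <= C -> g t = 0 ->
      (forall s : R, -1 <= s -> is_derive s (1 : R) g (dg s)) ->
      (forall s, -1 <= s -> `|dg s| <= 2 * L * C * E s) ->
      forall s, -1 <= s -> `|g s| <= C * E s.
    move=> C0 gt Dg Hg {}s s1.
    apply: (@exp_weight_bound _ (-1) (Num.max s t) t (2 * L) C g dg) => //.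
    - by rewrite le_max lexx orbT (le_trans _ t0)// lerN10.
    - by move=> r /andP[r1 _]; exact: Dg.
    - by move=> r /andP[r1 _]; exact: Hg.
    - by rewrite s1 le_max lexx.
  elim: k s => [|k IH] s s1.
    rewrite expr0 divr1.
    apply: (base (fun s => X 1%N s - X 0%N s) (fun s => f x0 s) M) => //.
    + by rewrite !Xt subrr.
    + by move=> r r1; have := is_deriveB (DX 0%N r r1) (is_derive_cst x0 r 1); rewrite subr0.
    + move=> r r1; apply: (le_trans (Bf _)); rewrite /M [2 * L * _]mulrC divfK ?gt_eqF//.
      by rewrite ler_peMr// -expR0 ler_expR mulr_ge0// ltW.
  apply: (base (fun s => X k.+2 s - X k.+1 s) (fun s => f (X k.+1 s) s - f (X k s) s)) => //.
  + by rewrite divr_ge0// ltW.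
  + by rewrite !Xt subrr.
  + by move=> r r1; apply: is_deriveB; exact: DX.
  + move=> r r1; apply: (le_trans (Lf _ _ _)).
    have -> : 2 * L * (M / 2 ^+ k.+1) * E r = L * (M / 2 ^+ k * E r).
      by rewrite exprS; field; rewrite gt_eqF.
    by rewrite ler_pM2l//; exact: IH.
have [l Hl] : {l : R -> 'rV[R]_n | forall s, -1 <= s -> forall k,
    `|l s - X k s| <= 2 * (M * E s) / 2 ^+ k}.
  apply: cid.
  have : forall s, exists l : 'rV[R]_n, -1 <= s -> forall k,
      `|l - X k s| <= 2 * (M * E s) / 2 ^+ k.
    move=> s; have [s1|_] := leP (-1) s; last by exists 0.
    have [|l Hl] := @geometric_cvg R n (X ^~ s) (M * E s); last by exists l.
    by move=> k; have := bnd k s s1; rewrite mulrAC.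
  by move=> /choice[l Hl]; exists l => s s1; exact: Hl.
have t1 : -1 <= t by rewrite (le_trans _ t0)// lerN10.
exists l.
  apply/eqP; rewrite -subr_eq0 -normr_le0; apply: (@le_geometric0 _ _ (2 * (M * E t))) => k.
  by rewrite -(Xt k); exact: Hl.
move=> s s1.
pose E1 := expR (2 * L * (`|s - t| + 1)).
have HlE k r : -1 <= r -> `|r - s| <= 1 -> `|l r - X k r| <= 2 * (M * E1) / 2 ^+ k.
  move=> r1 rs; apply: (le_trans (Hl _ r1 k)).
  rewrite ler_wpM2r ?invr_ge0 ?(ltW (p2 k))// !ler_wpM2l// ler_expR ler_wpM2l ?(ltW L2)//.
  by rewrite -(subrKA s) addrC (le_trans (ler_normD _ _))// lerD2l.
have near1 : \forall r \near s, -1 <= r /\ `|r - s| <= 1.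
  near=> r; split; first by apply/ltW; near: r; exact: lt_nbhsr.
  rewrite distrC; near: r; exact: (@cvgr_dist_le _ _ _ _ _ id s cvg_id 1 ltr01).
have cl_s : l r @[r --> s] --> l s.
  apply/cvgrPdist_le => e e0.
  have [k Hk] : exists k, 2 * (M * E1) / 2 ^+ k <= e / 3.
    apply: contrapT => /forallNP H.
    suff : e / 3 <= 0 by rewrite leNgt divr_gt0.
    by apply: (@le_geometric0 _ _ (2 * (M * E1))) => k; apply/ltW; rewrite ltNge; exact/negP.
  have Xs : X k r @[r --> s] --> X k s.
    by apply: gX; rewrite (lt_trans _ s1)// ltrN2 ltr1n.
  have e3 : 0 < e / 3 by rewrite divr_gt0.
  have /cvgrPdist_le /(_ _ e3) nX := Xs.
  near=> r.
  have [r1 rs] : -1 <= r /\ `|r - s| <= 1 by near: r.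
  have h1 := le_trans (HlE k r r1 rs) Hk.
  have h2 : `|l s - X k s| <= e / 3.
    by apply: le_trans Hk; apply: HlE; rewrite ?(ltW s1)// subrr normr0.
  have h3 : `|X k s - X k r| <= e / 3 by near: r.
  rewrite -(subrKA (X k s)) (le_trans (ler_normD _ _))//.
  rewrite -(subrKA (X k r) (X k s)).
  have := ler_normD (X k s - X k r) (X k r - l r).
  by rewrite [`|X k r - l r|]distrC; lra.
have cfl : f (l r) r @[r --> s] --> f (l s) s.
  apply: (@continuous_comp _ _ _ (fun r => (l r, r)) (fun z : 'rV[R]_n * R => f z.1 z.2)).
    by apply: continuous_at_pair; [exact: cl_s|exact: cvg_id].
  exact: cf.
apply/is_deriveP_ball => e e0.
have e20 : 0 < e / 2 by rewrite divr_gt0.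
have /cvgrPdist_le /(_ _ e20) nf := cfl.
have : \forall r \near s, `|f (l s) s - f (l r) r| <= e / 2 /\
    (-1 <= r /\ `|r - s| <= 1) by near=> r; split; near: r.
move=> /nbhs_normP[d /= d0 Hd].
exists d => // h hd.
have hd' r : 0 <= r <= 1 -> `|s - (s + h * r)| < d.
  move=> /andP[r0 r1]; rewrite opprD addrA subrr sub0r normrN normrM (ger0_norm r0).
  by rewrite (le_lt_trans _ hd)// ler_piMr.
have hsE : h *: 1 + s = s + h * 1 by rewrite addrC.
rewrite hsE.
(* The equation passes to the limit through increments: the mean value inequality for [X k.+1] holds
   with an error geometric in [k], and letting [k] grow leaves the difference quotient estimate for
   [l]. *)
have main k : `|X k.+1 (s + h * 1) - X k.+1 s - h *: f (l s) s| <=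
    `|h| * (e / 2 + L * (2 * (M * E1) / 2 ^+ k)).
  set c := e / 2 + _.
  have := @vector_MVT R 'rV[R]_n (fun r => X k.+1 (s + h * r) - r *: (h *: f (l s) s))
    (fun r => h *: f (X k (s + h * r)) (s + h * r) - h *: f (l s) s)
    (fun r => (`|h| * c) * r) (fun _ => `|h| * c) 0 1 ler01.
  have s0E : s + h * 0 = s by rewrite mulr0 addr0.
  rewrite s0E scale1r scale0r subr0 mulr0 subr0 [_ * c * 1]mulr1 addrAC; apply.
  - move=> r /hd' rd; apply: is_deriveB; last exact: is_derive_scalel.
    by apply: is_derive_affine; apply: DX; have [_ []] := Hd _ rd.
  - by move=> r _; exact: is_derive_mull.
  - move=> r /hd' rd; rewrite -scalerBr normrZ ler_wpM2l//.
    have [/= h1 [h2 h3]] := Hd _ rd.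
    rewrite -(subrKA (f (l (s + h * r)) (s + h * r))) (le_trans (ler_normD _ _))//.
    rewrite addrC lerD//; first by rewrite distrC.
    by rewrite (le_trans (Lf _ _ _))// ler_pM2l// distrC; exact: HlE.
have [_ [h2 h3]] := Hd _ (hd' 1 (introT andP (conj ler01 (lexx 1)))).
rewrite -subr_le0; apply: (@le_geometric0 _ _ ((`|h| * L + 2) * (2 * (M * E1)))) => k.
have H1 := HlE k.+1 _ h2 h3.
have H2 : `|l s - X k.+1 s| <= 2 * (M * E1) / 2 ^+ k.+1.
  by apply: HlE; rewrite ?(ltW s1)// subrr normr0.
have p1 : 2 * (M * E1) / 2 ^+ k.+1 <= 2 * (M * E1) / 2 ^+ k.
  apply: ler_wpM2l; first by rewrite mulr_ge0// mulr_ge0// expR_ge0.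
  rewrite lef_pV2 ?posrE//.
  by rewrite exprS ler_peMl ?ler1n// ltW.
have : `|l (s + h * 1) - l s - h *: f (l s) s| <=
   `|l (s + h * 1) - X k.+1 (s + h * 1)| +
   `|X k.+1 (s + h * 1) - X k.+1 s - h *: f (l s) s| + `|l s - X k.+1 s|.
  rewrite [`|l s - _|]distrC.
  rewrite -[l (s + h * 1) - l s](subrKA (X k.+1 s)) -[l _ - X k.+1 s](subrKA (X k.+1 (s + h * 1))).
  rewrite [_ + (X k.+1 s - l s) - _]addrAC -[_ + _ - h *: _]addrA.
  by rewrite (le_trans (ler_normD _ _))// lerD2r ler_normD.
have := main k; rewrite mulrDr [`|h| * (L * _)]mulrA.
set a := 2 * (M * E1) / 2 ^+ k in p1 H1 H2 *.
rewrite -[X in _ -> _ -> _ <= X]mulrA -/a mulrDl.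
have : `|h| * (e / 2) <= e * `|h| by rewrite mulrC ler_wpM2r// ler_pdivrMr// ler_pMr// ler1n.
by lra.
Unshelve. all: by end_near. Qed.
End picard.

(** * Bounds for smooth fields on balls *)

Section flow_smoothness.
Context {R : realType}.

(** Extends a field or a curve known on [[0, 1]] to the whole line by its end values, since
    existence is available for fields defined at all times. *)
Definition clamp (s : R) := Num.max 0 (Num.min s 1).

Lemma clamp_itv s : 0 <= clamp s <= 1.
Proof. by rewrite /clamp le_max lexx/= ge_max ler01 ge_min lexx orbT. Qed.

Lemma clampE s : 0 <= s <= 1 -> clamp s = s.
Proof. by move=> /andP[s0 s1]; rewrite /clamp min_l// max_r. Qed.

Lemma continuous_clamp : continuous clamp.
Proof.
move=> s.
have cm : {for s, continuous ((@id R) \min (cst 1))}.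
  by apply: continuous_min; [exact: cvg_id|exact: cst_continuous].
have : {for s, continuous (cst 0 \max ((@id R) \min (cst 1)))}.
  by apply: continuous_max; [exact: cst_continuous|exact: cm].
exact.
Qed.

Lemma continuous_comp_clamp (W : topologicalType) (g : R -> W) :
  {within `[0, 1], continuous g} -> continuous (g \o clamp).
Proof.
move=> cg; apply/continuous_subspace_setT.
apply: (@within_continuous_precomp _ _ _ `[0, 1]) cg; first exact: continuous_clamp.
by move=> s _; rewrite /= in_itv/=; exact: clamp_itv.
Qed.

Lemma closed_ball_compact n (r : R) : compact [set x : 'rV[R]_n | `|x| <= r].
Proof.
apply: bounded_closed_compact.
  by exists r; split; [exact: num_real|move=> s rs x /= xr; exact/ltW/(le_lt_trans xr)].
apply: (@closed_comp _ _ (fun x : 'rV[R]_n => `|x|) [set s | s <= r]).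
  by move=> x _; exact: norm_continuous.
exact: closed_le.
Qed.

Lemma compact_bound n m (W : normedModType R) (G : R -> 'rV[R]_n * 'rV[R]_m -> W) r :
  continuous (fun z : R * ('rV[R]_n * 'rV[R]_m) => G z.1 z.2) ->
  exists2 K, 0 <= K & forall s x u, 0 <= s <= 1 -> `|x| <= r -> `|u| <= 1 ->
    `|G s (x, u)| <= K.
Proof.
move=> cG.
pose A : set (R * ('rV[R]_n * 'rV[R]_m)) :=
  `[0, 1] `*` ([set x : 'rV[R]_n | `|x| <= r] `*` [set u : 'rV[R]_m | `|u| <= 1]).
have cA : compact A.
  apply: compact_setX; first exact: segment_compact.
  by apply: compact_setX; exact: closed_ball_compact.
have : compact ((fun z : R * ('rV[R]_n * 'rV[R]_m) => `|G z.1 z.2|) @` A).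
  apply: continuous_compact => //; apply: continuous_subspaceT => z.
  by apply: (@continuous_comp _ _ _ (fun z : R * ('rV[R]_n * 'rV[R]_m) => G z.1 z.2)
    (fun w : W => `|w|)); [exact: cG|exact: norm_continuous].
move=> /compact_bounded[M [_ HM]].
exists (Num.max 0 (M + 1)); first by rewrite le_max lexx.
move=> s x u s01 xr u1; rewrite -[`|G _ _|]normr_id le_max; apply/orP; right.
apply: (HM (M + 1)); first by rewrite ltrDl.
by exists (s, (x, u)).
Qed.

Lemma is_derive_fst (U V W : normedModType R) (F : U * V -> W) x u w l :
  is_derive (x, u) (w, 0) F l -> is_derive x w (fun y => F (y, u)) l.
Proof.
move=> /is_deriveP H; apply/is_deriveP => e /H; apply: filterS => h.
by rewrite -[h *: (w, 0) + (x, u)]/(h *: w + x, h *: (0 : V) + u) scaler0 add0r.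
Qed.

(** A single [K] serves the tangent map, the Lipschitz bound and the Taylor remainder. It comes from
    compactness of times, ball and unit directions; homogeneity extends the bounds to all
    directions, and convexity of the ball keeps segments inside. *)
Lemma smooth_ball_bounds n (f : R -> 'rV[R]_n -> 'rV[R]_n) (r : R) : smooth f ->
  exists2 K, 0 <= K & forall s, 0 <= s <= 1 -> forall x, `|x| <= r ->
    (forall w, `|'D_w (f s) x| <= K * `|w|) /\
    (forall x', `|x'| <= r -> `|f s x' - f s x| <= K * `|x' - x| /\
      `|f s x' - f s x - 'D_(x' - x) (f s) x| <= K * `|x' - x| ^+ 2).
Proof.
move=> Cf; have C1 := Cf 1%N; have C2 := Cf 2%N.
have [K1 K10 HK1] := @compact_bound n n _ _ r (Ck_cont (Ck_tangent C1)).
(* The second derivative along [u] is the derivative of the tangent map at [(x, u)] in the direction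
   [(u, 0)], hence jointly continuous in time, point and direction. *)
have DD s x u : is_derive x u ('D_u (f s))
    ('D_(u, 0) (fun z : 'rV[R]_n * 'rV[R]_n => 'D_z.2 (f s) z.1) (x, u)).
  apply: (is_derive_fst (F := fun z : 'rV[R]_n * 'rV[R]_n => 'D_z.2 (f s) z.1)).
  exact: derivableP (Ck_derivable (Ck_tangent C2)).
have [K2 K20 HK2] : exists2 K, 0 <= K & forall s x u, 0 <= s <= 1 -> `|x| <= r -> `|u| <= 1 ->
    `|'D_u ('D_u (f s)) x| <= K.
  have bl : bounded_linear (fun z : 'rV[R]_n * 'rV[R]_n => ((z.1, z.2), (z.2, 0 : 'rV[R]_n))).
    have b1 := bounded_linear_fst 'rV[R]_n 'rV[R]_n.
    have b2 := bounded_linear_snd 'rV[R]_n 'rV[R]_n.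
    apply: bounded_linear_pair; first exact: bounded_linear_pair b1 b2.
    apply: bounded_linear_pair; first exact: b2.
    by split; [move=> a u v; rewrite scaler0 addr0|exact: cst_continuous].
  have cT : continuous (fun z : R * ('rV[R]_n * 'rV[R]_n) =>
      'D_(z.2.2, 0) (fun y : 'rV[R]_n * 'rV[R]_n => 'D_y.2 (f z.1) y.1) (z.2.1, z.2.2)).
    exact: (Ck_cont (Ck_comp_linear bl (Ck_tangent (Ck_tangent C2)))).
  have [K K0 HK] := @compact_bound n n _ (fun s z =>
      'D_(z.2, 0) (fun y : 'rV[R]_n * 'rV[R]_n => 'D_y.2 (f s) y.1) (z.1, z.2)) r cT.
  exists K; first exact: K0.
  move=> s x u s01 xr u1; have /= := HK s x u s01 xr u1.
  by have /@derive_val -> := DD s x u.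
have scale_norm (w : 'rV[R]_n) : w != 0 -> `| `|w|^-1 *: w | <= 1.
  by move=> w0; rewrite normrZ normfV normr_id mulVf// normr_eq0.
have T1 s x w : 0 <= s <= 1 -> `|x| <= r -> `|'D_w (f s) x| <= K1 * `|w|.
  move=> s01 xr; have [->|w0] := eqVneq w 0; first by rewrite derive0 !normr0 mulr0.
  have -> : w = `|w| *: (`|w|^-1 *: w) by rewrite scalerA divff ?scale1r// normr_eq0.
  rewrite (@tangentZ _ _ _ _ f s _ _ _ C1) !normrZ normr_id mulrC.
  rewrite normfV normr_id mulVf ?normr_eq0// mulr1 ler_wpM2r//.
  exact: (HK1 s x _ s01 xr (scale_norm _ w0)).
have T2 s x w : 0 <= s <= 1 -> `|x| <= r -> `|'D_w ('D_w (f s)) x| <= K2 * `|w| ^+ 2.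
  move=> s01 xr; have [->|w0] := eqVneq w 0.
    by rewrite derive0 !normr0 expr0n mulr0.
  have -> : w = `|w| *: (`|w|^-1 *: w) by rewrite scalerA divff ?scale1r// normr_eq0.
  set u := `|w|^-1 *: w.
  have -> : 'D_(`|w| *: u) (f s) = (fun y => `|w| *: 'D_u (f s) y).
    by apply/funext => y; rewrite (@tangentZ _ _ _ _ f s _ _ _ C1).
  have D1 := derivableP (@Ck_derivable _ _ _ _ _ (fun s => 'D_u (f s)) s x u (Ck_derive u C2)).
  have D2 := is_derive_scale `|w| (is_deriveZ `|w| D1).
  have /@derive_val -> := D2.
  rewrite scalerA normrZ normrM normr_id -expr2 mulrC.
  have -> : `| `|w| *: u | = `|w|.
    by rewrite scalerA divff ?scale1r// normr_eq0.
  by rewrite ler_wpM2r ?sqr_ge0//; apply: HK2 => //; exact: scale_norm.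
exists (K1 + K2); first by rewrite addr_ge0.
move=> s s01 x xr; split.
  by move=> w; apply: (le_trans (T1 s x w s01 xr)); rewrite ler_wpM2r// lerDl.
move=> x' xr'.
have segr t : 0 <= t <= 1 -> `|x + t *: (x' - x)| <= r.
  move=> /andP[t0 t1].
  have -> : x + t *: (x' - x) = (1 - t) *: x + t *: x'.
    by rewrite scalerBr scalerBl scale1r addrCA addrC -addrA [X in _ + X]addrC.
  rewrite (le_trans (ler_normD _ _))// !normrZ !ger0_norm ?subr_ge0//.
  have : (1 - t) * `|x| <= (1 - t) * r by rewrite ler_wpM2l ?subr_ge0.
  have : t * `|x'| <= t * r by rewrite ler_wpM2l.
  by lra.
have seg t : is_derive t (1 : R) (fun t => f s (x + t *: (x' - x))) ('D_(x' - x) (f s) (x + t *: (x' - x))).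
  by apply: is_derive_line; exact: Ck_derivable C1.
set d := x' - x in segr seg *.
have x'E : x' = x + d by rewrite addrC subrK.
split.
  have := @vector_MVT R _ (fun t => f s (x + t *: d)) _
    (fun t => (K1 * `|d|) * t) (fun _ => K1 * `|d|) 0 1 ler01.
  rewrite scale1r scale0r addr0 mulr1 mulr0 subr0 -x'E => H.
  apply: (@le_trans _ _ (K1 * `|d|)); last by rewrite ler_wpM2r// lerDl.
  apply: (H _ (fun t _ => seg t)) => [t _|t t01]; first exact: is_derive_mull.
  by apply: T1 => //; exact: segr.
have inner t : 0 <= t <= 1 -> `|'D_d (f s) (x + t *: d) - 'D_d (f s) x| <= K2 * `|d| ^+ 2.
  move=> /andP[t0 t1].
  have := @vector_MVT R _ (fun t => 'D_d (f s) (x + t *: d))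
    (fun t => 'D_d ('D_d (f s)) (x + t *: d))
    (fun t => (K2 * `|d| ^+ 2) * t) (fun _ => K2 * `|d| ^+ 2) 0 t t0.
  rewrite scale0r addr0 mulr0 subr0 => H.
  apply: (@le_trans _ _ (K2 * `|d| ^+ 2 * t)); last first.
    by rewrite ler_piMr// mulr_ge0// sqr_ge0.
  apply: H => [q _|q _|q /andP[q0 qt]].
  - by apply: is_derive_line; exact: (Ck_derivable (Ck_derive d C2)).
  - exact: is_derive_mull.
  - by apply: T2 => //; apply: segr; rewrite q0 (le_trans qt).
have := @vector_MVT R _ (fun t => f s (x + t *: d) - t *: 'D_d (f s) x)
  (fun t => 'D_d (f s) (x + t *: d) - 'D_d (f s) x)
  (fun t => (K2 * `|d| ^+ 2) * t) (fun _ => K2 * `|d| ^+ 2) 0 1 ler01.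
rewrite !scale1r !scale0r addr0 !subr0 mulr1 mulr0 subr0 -x'E addrAC => H.
apply: (@le_trans _ _ (K2 * `|d| ^+ 2)); last by rewrite ler_wpM2r ?sqr_ge0// lerDr.
apply: H => [t _|t _|t t01].
- exact: (is_deriveB (seg t) (is_derive_scalel _ t)).
- exact: is_derive_mull.
- exact: inner.
Qed.

End flow_smoothness.

(** * Smooth dependence of flows on the initial point *)

Section flow.
Context {R : realType}.

Definition flow_of n (f : R -> 'rV[R]_n -> 'rV[R]_n) (Psi : 'rV[R]_n -> R -> 'rV[R]_n) :=
  forall y, [/\ Psi y 0 = y, {within `[0, 1], continuous (Psi y)} &
    forall s : R, 0 < s < 1 -> is_derive s (1 : R) (Psi y) (f s (Psi y s))].

(** The derivative of the tangent field grows with the tangent vector, so global Lipschitz bounds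
    need not survive the induction on the order of smoothness. Boundedness on bounded sets of
    initial points does survive it. *)
Definition locally_bounded n m (Psi : 'rV[R]_n -> R -> 'rV[R]_m) := forall r : R,
  exists B, forall y s, `|y| <= r -> 0 <= s <= 1 -> `|Psi y s| <= B.

Lemma itv_oo_cc (s : R) : 0 < s < 1 -> 0 <= s <= 1.
Proof. by move=> /andP[/ltW -> /ltW ->]. Qed.

Section tangent_flow.
Variables (n : nat) (f : R -> 'rV[R]_n -> 'rV[R]_n) (Psi : 'rV[R]_n -> R -> 'rV[R]_n).
Hypotheses (Cf : smooth f) (fl : flow_of f Psi) (lb : locally_bounded Psi).

Lemma flow_lipschitz r : exists2 C, 0 <= C & forall y y' s,
  `|y| <= r -> `|y'| <= r -> 0 <= s <= 1 -> `|Psi y' s - Psi y s| <= C * `|y' - y|.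
Proof.
have [B HB] := lb r; have [K K0 HK] := smooth_ball_bounds B Cf.
exists (n%:R * expR (n%:R * (2 * K + 1) * 1)); first by rewrite mulr_ge0// expR_ge0.
move=> y y' s yr yr' s01; have [P0 Pc PD] := fl y; have [P0' Pc' PD'] := fl y'.
have := @gronwall R n (fun s => Psi y' s - Psi y s)
  (fun s => f s (Psi y' s) - f s (Psi y s)) K 0 1 ler01 K0 (lexx 0).
rewrite P0 P0' addr0 mulrAC; apply => //.
- by move=> t; apply: cvgB; [exact: Pc'|exact: Pc].
- by move=> t t01; exact: (is_deriveB (PD' _ t01) (PD _ t01)).
- move=> t t01; have t01' := itv_oo_cc t01.
  have [_ /(_ (Psi y' t) (HB _ _ yr' t01')) [H _]] := HK t t01' _ (HB _ _ yr t01').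
  by rewrite addr0.
Qed.

(** The variational equation is linear in [m]. A trajectory stays in a ball, so the coefficients
    along it are bounded, which gives the global Lipschitz constant required for existence; clamping
    the time extends the equation beyond [[0, 1]]. *)
Lemma tangent_flow_exists : exists m : 'rV[R]_n -> 'rV[R]_n -> R -> 'rV[R]_n,
  forall y w, [/\ m y w 0 = w, {within `[0, 1], continuous (m y w)} &
    forall s : R, 0 < s < 1 ->
      is_derive s (1 : R) (m y w) ('D_(m y w s) (f s) (Psi y s))].
Proof.
suff H y w : exists m : R -> 'rV[R]_n, [/\ m 0 = w, {within `[0, 1], continuous m} &
    forall s : R, 0 < s < 1 -> is_derive s (1 : R) m ('D_(m s) (f s) (Psi y s))].
  have /choice[m Hm] : forall z : 'rV[R]_n * 'rV[R]_n, exists m : R -> 'rV[R]_n,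
      [/\ m 0 = z.2, {within `[0, 1], continuous m} & forall s : R, 0 < s < 1 ->
        is_derive s (1 : R) m ('D_(m s) (f s) (Psi z.1 s))] by move=> [y w]; exact: H.
  by exists (fun y w => m (y, w)) => y w; exact: (Hm (y, w)).
have [P0 Pc PD] := fl y.
have [B HB] := lb `|y|; have [K K0 HK] := smooth_ball_bounds B Cf.
pose F (x : 'rV[R]_n) (s : R) := 'D_x (f (clamp s)) (Psi y (clamp s)).
have cP := continuous_comp_clamp Pc.
have cF : continuous (fun z : 'rV[R]_n * R => F z.1 z.2).
  have cP2 : continuous (fun z : 'rV[R]_n * R => Psi y (clamp z.2)).
    by move=> z; apply: (@continuous_comp _ _ _ (@snd 'rV[R]_n R) (Psi y \o clamp));
      [exact: cvg_snd|exact: cP].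
  apply: (@continuous_param_comp R _ _ _ _ (fun s (z : 'rV[R]_n * 'rV[R]_n) =>
    'D_z.2 (f s) z.1) (fun _ s => clamp s) (fun x s => (Psi y (clamp s), x))).
  - exact: (Ck_cont (Ck_tangent (Cf 1%N))).
  - by move=> z; apply: (@continuous_comp _ _ _ (@snd 'rV[R]_n R) clamp);
      [exact: cvg_snd|exact: continuous_clamp].
  - exact: (continuous_pair cP2 (@continuous_fst' 'rV[R]_n R)).
have K1 : 0 < K + 1 by rewrite ltr_wpDl.
have FB x s : `|F x s| <= (K + 1) * `|x|.
  have [H _] := HK _ (clamp_itv s) _ (HB _ _ (lexx _) (clamp_itv s)).
  by apply: (le_trans (H x)); rewrite ler_wpM2r// lerDl.
have FL x x' s : `|F x s - F x' s| <= (K + 1) * `|x - x'|.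
  have -> : F x s - F x' s = F (x - x') s; last exact: FB.
  rewrite /F -scaleN1r -(@tangentZ _ _ _ _ f (clamp s) _ _ _ (Cf 1%N)).
  by rewrite -(@tangentD _ _ _ _ f (clamp s) _ _ _ (Cf 1%N)) scaleN1r.
have [|m m0 Dm] := @ode_exists R n F (K + 1) ((K + 1) * `|w|) 0 w K1 _ (lexx 0) cF FL (FB w).
  by rewrite mulr_ge0// ltW.
exists m; split => //.
  apply: derivable_within_continuous => s; rewrite in_itv/= => /andP[s0 _].
  by have [] := Dm s (lt_le_trans (ltrN10 R) s0).
move=> s s01; have /andP[s0 _] := s01.
have := Dm s (lt_trans (ltrN10 R) s0).
by rewrite /F (clampE (itv_oo_cc s01)).
Qed.

Variable m : 'rV[R]_n -> 'rV[R]_n -> R -> 'rV[R]_n.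
Hypothesis Hm : forall y w, [/\ m y w 0 = w, {within `[0, 1], continuous (m y w)} &
    forall s : R, 0 < s < 1 ->
      is_derive s (1 : R) (m y w) ('D_(m y w s) (f s) (Psi y s))].

Lemma tangent_flow_bounded r : exists B, forall y w s,
  `|y| <= r -> `|w| <= r -> 0 <= s <= 1 -> `|m y w s| <= B.
Proof.
have [B HB] := lb r; have [K K0 HK] := smooth_ball_bounds B Cf.
exists (n%:R * r * expR (n%:R * (2 * K + 1) * 1)).
move=> y w s yr wr s01; have [m0 mc mD] := Hm y w.
have := @gronwall R n (m y w) (fun s => 'D_(m y w s) (f s) (Psi y s)) K 0 1 ler01 K0 (lexx 0).
rewrite m0 addr0 => H; apply: (le_trans (H mc mD _ s s01)).
  move=> t t01; have t01' := itv_oo_cc t01; rewrite addr0.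
  by have [H' _] := HK t t01' _ (HB _ _ yr t01').
by rewrite ler_wpM2r ?expR_ge0// ler_wpM2l.
Qed.

(** Gronwall applied to [Psi (h *: w + y) - Psi y - h *: m y w], which vanishes at time 0. Its
    equation is the linearised one up to the Taylor remainder of [f], at most [D * h ^+ 2] because
    the two trajectories separate by at most [C * |h *: w|]. *)
Lemma is_derive_flow y w s : 0 <= s <= 1 -> is_derive y w (Psi ^~ s) (m y w s).
Proof.
move=> s01; set r := `|y| + `|w|.
have [C C0 HC] := flow_lipschitz r.
have [B HB] := lb r; have [K K0 HK] := smooth_ball_bounds B Cf.
have yr : `|y| <= r by rewrite lerDl.
have [P0 Pc PD] := fl y; have [m0 mc mD] := Hm y w.
set D := K * (C * `|w|) ^+ 2.
have D0 : 0 <= D by rewrite mulr_ge0// sqr_ge0.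
apply: (@is_derive_quadratic _ _ _ _ _ _ _ (D * expR (n%:R * (2 * K + 1) * 1))) => h h1.
have yr' : `|h *: w + y| <= r.
  rewrite /r addrC (le_trans (ler_normD _ _))// lerD2l normrZ ler_piMl//.
have [P0' Pc' PD'] := fl (h *: w + y).
have D1 : 0 <= D * h ^+ 2 by rewrite mulr_ge0// sqr_ge0.
have := @gronwall R n (fun s => Psi (h *: w + y) s - Psi y s - h *: m y w s)
  (fun s => f s (Psi (h *: w + y) s) - f s (Psi y s) - h *: 'D_(m y w s) (f s) (Psi y s))
  K (D * h ^+ 2) 1 ler01 K0 D1.
rewrite P0 P0' m0 addrK subrr normr0 mulr0 add0r => H; rewrite [leRHS]mulrAC; apply: H => //.
- move=> t; apply: cvgB; first by apply: cvgB; [exact: Pc'|exact: Pc].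
  by apply: cvgZ; [exact: cvg_cst|exact: mc].
- move=> t t01.
  exact: (is_deriveB (is_deriveB (PD' _ t01) (PD _ t01)) (is_deriveZ h (mD _ t01))).
- move=> t t01; have t01' := itv_oo_cc t01.
  have [H1 /(_ (Psi (h *: w + y) t) (HB _ _ yr' t01')) [_ H2]] :=
    HK t t01' _ (HB _ _ yr t01').
  set d := Psi (h *: w + y) t - Psi y t in H2 *.
  have -> : f t (Psi (h *: w + y) t) - f t (Psi y t) - h *: 'D_(m y w t) (f t) (Psi y t) =
      (f t (Psi (h *: w + y) t) - f t (Psi y t) - 'D_d (f t) (Psi y t)) +
      'D_(d - h *: m y w t) (f t) (Psi y t).
    rewrite (@tangentD _ _ _ _ f t (Psi y t) d (- (h *: m y w t)) (Cf 1%N)).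
    rewrite -[- (h *: m y w t)]scaleNr.
    by rewrite (@tangentZ _ _ _ _ f t (Psi y t) (- h) (m y w t) (Cf 1%N)) scaleNr subrKA.
  rewrite (le_trans (ler_normD _ _))// addrC lerD//.
  apply: (le_trans H2); rewrite /D -mulrA ler_wpM2l// -exprMn.
  rewrite -[(_ * h) ^+ 2]real_normK ?num_real// lerXn2r ?nnegrE//.
  have := HC y _ t yr yr' t01'; rewrite addrK normrZ => H3.
  by rewrite !normrM normr_id (ger0_norm C0) -mulrA [`|w| * _]mulrC.
Qed.

End tangent_flow.

Lemma bounded_linear_row_mx n m :
  bounded_linear (fun z : 'rV[R]_n * 'rV[R]_m => row_mx z.1 z.2).
Proof.
split; first by move=> a x y; rewrite /= scale_row_mx add_row_mx.
move=> z; apply/cvgrPdist_le => e e0.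
have /cvgrPdist_le/(_ _ e0) n1 := (bounded_linear_fst 'rV[R]_n 'rV[R]_m).2 z.
have /cvgrPdist_le/(_ _ e0) n2 := (bounded_linear_snd 'rV[R]_n 'rV[R]_m).2 z.
near=> y; rewrite opp_row_mx add_row_mx.
rewrite [leLHS]/Num.Def.normr/= mx_normrE; apply: bigmax_le => /=; first exact: ltW.
move=> [i j] _ /=; rewrite mxE; case: fintype.split => k.
- have : `|z.1 - y.1| <= e by near: y; exact: n1.
  by apply: le_trans; rewrite (ord1 i); exact: rV_norm_ge.
- have : `|z.2 - y.2| <= e by near: y; exact: n2.
  by apply: le_trans; rewrite (ord1 i); exact: rV_norm_ge.
Unshelve. all: by end_near. Qed.

Lemma bounded_linear_lsubmx n m : bounded_linear (fun z : 'rV[R]_(n + m) => lsubmx z).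
Proof. by apply: bounded_linear_canonical; exact: continuous_lsubmx. Qed.

Lemma bounded_linear_rsubmx n m : bounded_linear (fun z : 'rV[R]_(n + m) => rsubmx z).
Proof. by apply: bounded_linear_canonical; exact: continuous_rsubmx. Qed.

Lemma lsubmx_norm n m (z : 'rV[R]_(n + m)) : `|lsubmx z| <= `|z|.
Proof.
rewrite [leLHS]/Num.Def.normr/= mx_normrE; apply: bigmax_le => //= -[i j] _.
by rewrite mxE (ord1 i); exact: rV_norm_ge.
Qed.

Lemma rsubmx_norm n m (z : 'rV[R]_(n + m)) : `|rsubmx z| <= `|z|.
Proof.
rewrite [leLHS]/Num.Def.normr/= mx_normrE; apply: bigmax_le => //= -[i j] _.
by rewrite mxE (ord1 i); exact: rV_norm_ge.
Qed.

Lemma row_mx_norm n m (x : 'rV[R]_n) (y : 'rV[R]_m) B : `|x| <= B -> `|y| <= B ->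
  `|row_mx x y| <= B.
Proof.
move=> xB yB; rewrite [leLHS]/Num.Def.normr/= mx_normrE; apply: bigmax_le => /=.
  exact: le_trans (normr_ge0 _) xB.
move=> [i j] _ /=; rewrite mxE; case: fintype.split => k; rewrite (ord1 i).
- exact: le_trans (rV_norm_ge _ _) xB.
- exact: le_trans (rV_norm_ge _ _) yB.
Qed.

Lemma locally_lipschitz_continuous (V W : normedModType R) (f : V -> W) :
  (forall r : R, exists2 C : R, 0 <= C & forall x y, `|x| <= r -> `|y| <= r ->
    `|f y - f x| <= C * `|y - x|) -> continuous f.
Proof.
move=> Lf x; apply/cvgrPdist_le => e e0; have [C C0 HC] := Lf (`|x| + 1).
have C1 : 0 < C + 1 by rewrite ltr_wpDl.
near=> y; have : `|x - y| <= Num.min 1 (e / (C + 1)).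
  near: y; apply: cvgr_dist_le; first exact: cvg_id.
  by rewrite lt_min ltr01 divr_gt0.
rewrite le_min => /andP[y1 ye].
have yr : `|y| <= `|x| + 1.
  by rewrite -[y](subrK x) addrC (le_trans (ler_normD _ _))// lerD2l distrC.
have xr : `|x| <= `|x| + 1 by rewrite lerDl.
apply: (le_trans (HC _ _ yr xr)); rewrite (le_trans (ler_wpM2l C0 ye))//.
by rewrite mulrA ler_pdivrMr// mulrC ler_wpM2l ?ltW// ltrDl.
Unshelve. all: by end_near. Qed.

(* The flow together with its tangent map is again a flow, of the tangent field. *)
Lemma flow_smooth n (f : R -> 'rV[R]_n -> 'rV[R]_n) (Psi : 'rV[R]_n -> R -> 'rV[R]_n) :
  smooth f -> flow_of f Psi -> locally_bounded Psi ->
  forall s, 0 <= s <= 1 -> smooth (fun (_ : R) y => Psi y s).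
Proof.
move=> Cf fl lb s s01 k; elim: k n f Psi Cf fl lb => [|k IH] n f Psi Cf fl lb.
  have cP : continuous (Psi ^~ s).
    apply: locally_lipschitz_continuous => r.
    have [C C0 HC] := flow_lipschitz Cf fl lb r.
    by exists C => // x y xr yr; exact: HC.
  split=> // z; apply: (@continuous_comp _ _ _ (@snd R 'rV[R]_n) (Psi ^~ s)); first exact: cvg_snd.
  exact: cP.
have [m Hm] := tangent_flow_exists Cf fl lb.
have Dm y w := is_derive_flow Cf fl lb Hm y w s01.
(* The pair is packed into one row vector of length [n + n], so the induction hypothesis is used in
   another dimension. *)
pose f' (t : R) (z : 'rV[R]_(n + n)) := row_mx (f t (lsubmx z)) ('D_(rsubmx z) (f t) (lsubmx z)).
pose Psi' (z : 'rV[R]_(n + n)) t := row_mx (Psi (lsubmx z) t) (m (lsubmx z) (rsubmx z) t).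
have Cf' : smooth f'.
  move=> j; have bl := bounded_linear_lsubmx n n; have br := bounded_linear_rsubmx n n.
  apply: (Ck_linear_comp (bounded_linear_row_mx n n)
    (f := fun t z => (f t (lsubmx z), 'D_(rsubmx z) (f t) (lsubmx z)))).
  apply: Ck_pair; first exact: (Ck_comp_linear bl (Cf j)).
  exact: (Ck_comp_linear (bounded_linear_pair bl br) (Ck_tangent (Cf j.+1))).
have fl' : flow_of f' Psi'.
  move=> z; have [P0 Pc PD] := fl (lsubmx z); have [m0 mc mD] := Hm (lsubmx z) (rsubmx z).
  split.
  - by rewrite /Psi' P0 m0 hsubmxK.
  - move=> t; have cp : {for t, continuous ((fun t => (Psi (lsubmx z) t, m (lsubmx z) (rsubmx z) t)) : subspace `[0, 1] -> _)}.
      by apply: continuous_at_pair; [exact: Pc|exact: mc].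
    exact: (cvg_comp _ _ cp ((bounded_linear_row_mx n n).2 _)).
  - move=> t t01; rewrite /f' /Psi' row_mxKl row_mxKr.
    exact: (is_derive_linear_comp (bounded_linear_row_mx n n) (is_derive_pair (PD _ t01) (mD _ t01))).
have lb' : locally_bounded Psi'.
  move=> r; have [B HB] := lb r; have [B' HB'] := tangent_flow_bounded Cf lb Hm r.
  exists (Num.max B B') => z t zr t01; apply: row_mx_norm.
  - by rewrite le_max HB// (le_trans (lsubmx_norm _)).
  - by rewrite le_max HB' ?orbT// ?(le_trans (lsubmx_norm _))// (le_trans (rsubmx_norm _)).
apply: (@CkSI _ _ _ _ _ _ (fun _ z => m z.1 z.2 s)).
- exact: (Ck_cont (IH _ _ _ Cf fl lb)).
- have := Ck_comp_linear (bounded_linear_row_mx n n) (Ck_linear_comp (bounded_linear_rsubmx n n) (IH _ _ _ Cf' fl' lb')).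
  by apply: Ck_ext => _ z; rewrite /Psi' row_mxKr row_mxKr row_mxKl.
Qed.

End flow.

(** * Measurability, affine changes of variable and linearity of integrals on row vectors *)

Section measure_rV.
Context {R : realType}.

Lemma measurable_box n (A : 'I_n -> set R) : (forall i, measurable (A i)) ->
  measurable [set x : 'rV[R]_n | forall i, A i (x ord0 i)].
Proof.
move=> mA; rewrite (_ : mkset _ = \bigcap_(i in [set: 'I_n])
    ((fun x : 'rV[R]_n => x ord0 i) @^-1` A i)); last first.
  by apply/seteqP; split => x /= Bx i; [move=> _|]; exact: Bx.
apply: fin_bigcap_measurable => // i _.
by rewrite -[X in measurable X]setTI; exact: measurable_coord.
Qed.

(** Rational centres and radii [1 / (k + 1)] give countably many boxes, and an open set is the union
    of those it contains. *)
Lemma open_measurable_rV n (U : set 'rV[R]_n) : open U -> measurable U.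
Proof.
move=> oU; pose box (q : 'rV[rat]_n * nat) : set 'rV[R]_n :=
  [set x | forall i, ball (ratr (q.1 ord0 i) : R) (q.2.+1%:R^-1) (x ord0 i)].
rewrite (_ : U = \bigcup_(q in setT) (if `[< box q `<=` U >] then box q else set0)); last first.
  apply/seteqP; split => x; last by move=> [q _]; case: asboolP => // qU Bx; exact: qU.
  move=> Ux; have /nbhs_ballP[e /= e0 xU] : nbhs x U by exact: open_nbhs_nbhs.
  have e2 : 0 < e / 2 by rewrite divr_gt0.
  have [k /= ke] := ltr_add_invr e2.
  have k0 : (0 : R) < k.+1%:R^-1 by rewrite invr_gt0.
  have H i : exists q : rat, ball (ratr q : R) k.+1%:R^-1 (x ord0 i).
    have [q /itvP qx] := @rat_in_itvoo R (x ord0 i - k.+1%:R^-1) (x ord0 i + k.+1%:R^-1)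
      ltac:(by rewrite ltrBlDr -addrA ltrDl addr_gt0).
    exists q; rewrite /ball/= distrC ltr_distlC.
    by rewrite !qx.
  have [q Hq] := choice H.
  exists (\row_i q i, k) => //; case: asboolP => [_ i|]; first by rewrite mxE; exact: Hq.
  case => y /= By; apply: xU; split => // i j; rewrite (ord1 i).
  have Hj := Hq j; have Bj := By j; rewrite /= mxE in Bj.
  rewrite add0r in ke; rewrite -ball_normE/= in Hj Bj *.
  apply: le_lt_trans (ler_distD (ratr (q j)) _ _) _.
  rewrite [e]splitr ltrD//; first by rewrite distrC (lt_trans Hj).
  exact: (lt_trans Bj).
apply: countable_bigcupT_measurable => [|q]; first exact: countableP.
case: asboolP => // _; apply: (@measurable_box n (fun i => ball (ratr (q.1 ord0 i) : R) (q.2.+1%:R^-1))) => i.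
exact: measurable_ball.
Qed.

Lemma continuous_measurable_rV n (f : 'rV[R]_n -> R) : continuous f ->
  measurable_fun setT f.
Proof.
move=> cf; apply: (measurability _ (RGenOInfty.measurableE R)) => _ [_ [a ->] <-].
rewrite setTI; apply: open_measurable_rV; apply: open_comp => [x _|]; first exact: cf.
exact: interval_open.
Qed.

Local Notation mu := (@lebesgue_measure R).

(** Uniqueness of Lebesgue measure: its image under [x |-> a + c * x], multiplied by [c], gives each
    half-open interval its length. *)
Lemma ge0_integral_lebesgue_affine (a c : R) (F : R -> \bar R) : 0 < c ->
  measurable_fun setT F -> (forall x, 0 <= F x)%E ->
  (\int[mu]_x F x = c%:E * \int[mu]_x F (a + c * x)%R)%E.
Proof.
move=> c0 mF F0; pose phi : R -> measurableTypeR R := fun x => a + c * x.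
have mphi : measurable_fun setT phi by exact: measurable_funD.
pose c' := NngNum (ltW c0).
pose pm : {measure set (measurableTypeR R) -> \bar R} :=
  measure_function_pushforward__canonical__measure_function_Measure mu mphi.
transitivity (\int[mscale c' pm]_x F x)%E.
  apply: eq_measure_integral => A mA _.
  apply: (@lebesgue_measure_unique R (mscale c' pm)) => // _ [[x y]] _ <-.
 transitivity (c%:E * mu (phi @^-1` `]x, y]))%E => //.
  rewrite (_ : phi @^-1` `]x, y] = `](x - a) / c, (y - a) / c]%classic); last first.
    apply/seteqP; split => z /=; rewrite !in_itv/= ltr_pdivrMr// ler_pdivlMr// /phi;
      by rewrite ltrBlDl lerBrDl mulrC.
  rewrite !lebesgue_measure_itv/= !lte_fin ltr_pM2r ?invr_gt0// ltrD2r.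
  case: ifP => _; last by rewrite mule0.
  by rewrite -!EFinD -EFinM; congr (_%:E); field; rewrite gt_eqF.
rewrite ge0_integral_mscale//=; congr (_ * _)%E.
by rewrite ge0_integral_pushforward.
Qed.

Lemma ge0_integral_rVS n (F : 'rV[R]_n.+1 -> \bar R) :
  measurable_fun setT F -> (forall x, 0 <= F x)%E ->
  (\int[lebesgue_rV n.+1]_x F x =
   \int[mu]_s \int[lebesgue_rV n]_y F (cons_rV (s, y)))%E.
Proof.
move=> mF F0.
transitivity (\int[pushforward (mu \x lebesgue_rV n)%E (@cons_rV R n)]_x F x)%E => //.
have mc := @measurable_cons_rV R n.
rewrite ge0_integral_pushforward//= fubini_tonelli1//.
exact: measurableT_comp.
Qed.

Lemma ge0_integral_rV0 (F : 'rV[R]_0 -> \bar R) :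
  measurable_fun setT F -> (\int[lebesgue_rV 0]_x F x = F 0%R)%E.
Proof. by move=> mF; rewrite integral_dirac// diracT mul1e. Qed.

Lemma measurable_affine_rV n (a : 'rV[R]_n) (c : R) :
  measurable_fun setT (fun x : 'rV[R]_n => a + c *: x).
Proof.
apply: measurable_fun_rVP => i; under eq_fun do rewrite !mxE.
by apply: measurable_funD => //; apply: measurable_funM => //; exact: measurable_coord.
Qed.

(** Tonelli peels off one coordinate at a time, each contributing a factor [c]. *)
Lemma ge0_integral_affine n (a : 'rV[R]_n) (c : R) (F : 'rV[R]_n -> \bar R) : 0 < c ->
  measurable_fun setT F -> (forall x, 0 <= F x)%E ->
  (\int[lebesgue_rV n]_x F x =
   (c ^+ n)%:E * \int[lebesgue_rV n]_x F (a + c *: x)%R)%E.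
Proof.
move=> c0; have mphi m (b : 'rV[R]_m) := measurable_affine_rV b c.
elim: n a F => [|n IHn] a F mF F0.
  rewrite !ge0_integral_rV0//; last exact: (measurableT_comp mF (mphi _ a)).
  by rewrite mul1e; congr F; apply/rowP => -[].
have mFa : measurable_fun setT (fun x : 'rV[R]_n.+1 => F (a + c *: x)).
  exact: (measurableT_comp mF (mphi _ a)).
rewrite !ge0_integral_rVS//.
pose a' : 'rV[R]_n := \row_i a ord0 (lift ord0 i).
have mG (G : 'rV[R]_n.+1 -> \bar R) : measurable_fun setT G -> (forall x, 0 <= G x)%E ->
    measurable_fun setT (fun s : R => \int[lebesgue_rV n]_y G (cons_rV (s, y)))%E.
  move=> mG G0; exact: (@measurable_fun_fubini_tonelli_F _ _ _ _ _ (lebesgue_rV n)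
    (fun z : R * 'rV[R]_n => G (cons_rV z))
    (measurableT_comp mG (@measurable_cons_rV R n)) (fun=> G0 _)).
rewrite (ge0_integral_lebesgue_affine (a ord0 ord0) c0)//; last 2 first.
- exact: (mG F).
- by move=> x; exact: integral_ge0.
rewrite exprS EFinM -muleA; congr (_ * _)%E.
rewrite -ge0_integralZl//; last 3 first.
- exact: (mG (fun x => F (a + c *: x)) mFa (fun=> F0 _)).
- by move=> x _; exact: integral_ge0.
- by rewrite lee_fin exprn_ge0// ltW.
apply: eq_integral => s _; rewrite (IHn a')//; last first.
  apply: (measurableT_comp mF).
  exact: (measurableT_comp (@measurable_cons_rV R n) (pair1_measurable _)).
congr (_ * _)%E; apply: eq_integral => y _; congr F; apply/rowP => i; rewrite !mxE.
by case: unliftP => [j ->|->] /=; rewrite ?mxE.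
Qed.

Definition integ n (f : 'rV[R]_n -> R) := (lebesgue_rV n).-integrable setT (EFin \o f).

Definition intg n (f : 'rV[R]_n -> R) : R := \int[lebesgue_rV n]_x f x.

Section linear.
Variable n : nat.
Implicit Types f g w : 'rV[R]_n -> R.

Lemma integ_measurable f : integ f -> measurable_fun setT f.
Proof. by move=> /integrableP[/measurable_EFinP]. Qed.

Lemma integ_dominated C w f : measurable_fun setT f -> integ w ->
  (forall x, `|f x| <= C * w x) -> integ f.
Proof.
move=> mf iw fw; apply: (@le_integrable _ _ _ _ _ _ _ (EFin \o (fun x => C * w x))) => //=.
- exact/measurable_EFinP.
- by move=> x _; rewrite lee_fin (le_trans (fw x))// ler_norm.
- by move/(integrableZl measurableT C): iw; rewrite /comp; under eq_fun do rewrite -EFinM.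
Qed.

Lemma integD f g : integ f -> integ g -> integ (fun x => f x + g x).
Proof. by move=> /(integrableD measurableT); apply. Qed.

Lemma integZ c f : integ f -> integ (fun x => c * f x).
Proof.
by move=> /(integrableZl measurableT c); rewrite /integ/comp; under eq_fun do rewrite -EFinM.
Qed.

Lemma integN f : integ f -> integ (fun x => - f x).
Proof. by move=> /(integZ (-1)); rewrite (_ : (fun x => _) = (fun x => - f x))//; apply/funext => x; rewrite mulN1r. Qed.

Lemma integB f g : integ f -> integ g -> integ (fun x => f x - g x).
Proof. by move=> fi gi; apply: integD => //; exact: integN. Qed.

Lemma integ0 : integ (fun _ : 'rV[R]_n => 0).
Proof. exact: integrable0. Qed.

Lemma integ_sum I (r : seq I) (F : I -> 'rV[R]_n -> R) : (forall i, integ (F i)) ->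
  integ (fun x => \sum_(i <- r) F i x).
Proof.
move=> iF; elim: r => [|i r IH]; first by under eq_fun do rewrite big_nil; exact: integ0.
by under eq_fun do rewrite big_cons; exact: integD.
Qed.

Lemma intgD f g : integ f -> integ g -> intg (fun x => f x + g x) = intg f + intg g.
Proof. exact: RintegralD. Qed.

Lemma intgZ c f : integ f -> intg (fun x => c * f x) = c * intg f.
Proof. exact: RintegralZl. Qed.

Lemma intgB f g : integ f -> integ g -> intg (fun x => f x - g x) = intg f - intg g.
Proof. exact: RintegralB. Qed.

Lemma intg0 : intg (fun _ : 'rV[R]_n => 0) = 0.
Proof. by rewrite /intg/Rintegral integral0. Qed.

Lemma intgN f : integ f -> intg (fun x => - f x) = - intg f.
Proof. by move=> fi; rewrite -mulN1r -intgZ//; congr intg; apply/funext => x; rewrite mulN1r. Qed.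

Lemma intg_sum I (r : seq I) (F : I -> 'rV[R]_n -> R) : (forall i, integ (F i)) ->
  intg (fun x => \sum_(i <- r) F i x) = \sum_(i <- r) intg (F i).
Proof.
move=> iF; elim: r => [|i r IH].
  by rewrite big_nil -[RHS]intg0; congr intg; apply/funext => x; rewrite big_nil.
rewrite big_cons -IH -intgD//; last exact: integ_sum.
by congr intg; apply/funext => x; rewrite big_cons.
Qed.

Lemma le_intg f g : integ f -> integ g -> (forall x, f x <= g x) -> intg f <= intg g.
Proof. by move=> fi gi fg; apply: le_Rintegral. Qed.

Lemma intg_ge0 f : (forall x, 0 <= f x) -> 0 <= intg f.
Proof. by move=> f0; apply: Rintegral_ge0. Qed.

Lemma integ_norm f : integ f -> integ (fun x => `|f x|).
Proof. exact: integrable_norm. Qed.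

Lemma norm_intg_le w f : integ f -> integ w -> (forall x, `|f x| <= w x) ->
  `|intg f| <= intg w.
Proof.
move=> fi wi fw; apply: le_trans (le_normr_Rintegral _ fi) _ => //.
by apply: le_intg => //; exact: integ_norm.
Qed.

Lemma integ_affine (a : 'rV[R]_n) c f : 0 < c -> integ f -> integ (fun x => f (a + c *: x)).
Proof.
move=> c0 fi; have mf := integ_measurable fi.
have mphi := measurable_affine_rV a c.
apply/integrableP; split; first by apply/measurable_EFinP; exact: (measurableT_comp mf mphi).
move/integrableP: fi => [_].
rewrite (ge0_integral_affine a c0)//; last first.
  by apply: measurableT_comp => //; exact/measurable_EFinP.
have : (0 <= \int[lebesgue_rV n]_x `|(EFin \o f) (a + c *: x)%R|)%E by exact: integral_ge0.
by case: integral => [r _ _||]//=; [exact: ltry|rewrite gt0_muley// lte_fin exprn_gt0].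
Qed.

(** The formula for nonnegative integrands is transferred by splitting [f] into its positive and
    negative parts. *)
Lemma intg_affine (a : 'rV[R]_n) c f : 0 < c -> integ f ->
  intg f = c ^+ n * intg (fun x => f (a + c *: x)).
Proof.
move=> c0; have pos g : integ g -> (forall x, 0 <= g x) ->
    intg g = c ^+ n * intg (fun x => g (a + c *: x)).
  move=> gi g0; have mg : measurable_fun setT (EFin \o g).
    by apply/measurable_EFinP; exact: integ_measurable.
  rewrite /intg/Rintegral (ge0_integral_affine (F := EFin \o g) a c0)//=.
  by rewrite fineM//; exact: (integrable_fin_num measurableT (integ_affine a c0 gi)).
move=> fi; have mf := integ_measurable fi.
pose p x := Num.max (f x) 0; pose q x := Num.max (- f x) 0.
have pi : integ p.
  apply: (integ_dominated (C := 1) _ (integ_norm fi)) => [|x].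
    exact: measurable_maxr.
  by rewrite mul1r /p; case: (leP 0 (f x)) => fx; rewrite ?normr0.
have qi : integ q.
  apply: (integ_dominated (C := 1) _ (integ_norm fi)) => [|x].
    by apply: measurable_maxr => //; exact: measurable_funN.
  by rewrite mul1r /q; case: (leP 0 (- f x)) => fx; rewrite ?normr0 ?normrN.
have fE : f = fun x => p x - q x.
  by apply/funext => x; rewrite /p/q; case: (leP (f x) 0); case: (leP (- f x) 0) => *; lra.
have p0 x : 0 <= p x by rewrite le_max lexx orbT.
have q0 x : 0 <= q x by rewrite le_max lexx orbT.
rewrite fE !intgB//; [|exact: integ_affine..].
by rewrite mulrBr (pos p pi p0) (pos q qi q0).
Qed.

End linear.

End measure_rV.

(** * Gaussian weights and translation invariance *)

Section gaussian_weights.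
Context {R : realType}.
Local Notation mu := (@lebesgue_measure R).

Lemma normsq_ge0 n (x : 'rV[R]_n) : 0 <= normsq x.
Proof. by apply: sumr_ge0 => i _; exact: sqr_ge0. Qed.

Lemma normsq_cons n s (y : 'rV[R]_n) : normsq (cons_rV (s, y)) = s ^+ 2 + normsq y.
Proof.
rewrite /normsq big_ord_recl !mxE unlift_none; congr (_ + _).
by apply: eq_bigr => i _; rewrite !mxE liftK.
Qed.

Lemma normsqZ n c (x : 'rV[R]_n) : normsq (c *: x) = c ^+ 2 * normsq x.
Proof. by rewrite /normsq mulr_sumr; apply: eq_bigr => i _; rewrite !mxE exprMn. Qed.

Lemma normsqN n (x : 'rV[R]_n) : normsq (- x) = normsq x.
Proof. by apply: eq_bigr => i _; rewrite mxE sqrrN. Qed.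

Lemma normsq0 n : normsq (0 : 'rV[R]_n) = 0.
Proof. by apply: big1 => i _; rewrite mxE expr0n. Qed.

Lemma smooth_gauss (P : normedModType R) n r :
  smooth (fun (_ : P) (x : 'rV[R]_n) => expR (- (r * normsq x))).
Proof.
move=> k; apply: (@Ck_comp _ P _ _ _ _ (fun _ => @expR R)); first exact: smooth_expR.
by apply/CkN/CkM; [exact: Ck_cst|exact: smooth_normsq].
Qed.

Lemma continuous_gauss n r : continuous (fun x : 'rV[R]_n => expR (- (r * normsq x))).
Proof. exact: (smooth_continuous (p := 0 : R) (@smooth_gauss R n r)). Qed.

Lemma integ_gauss1 n : integ (fun x : 'rV[R]_n => expR (- normsq x)).
Proof.
have mg m : measurable_fun setT (fun x : 'rV[R]_m => (expR (- normsq x))%:E).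
  apply/measurable_EFinP; apply: continuous_measurable_rV.
  by have := @continuous_gauss m 1; under eq_fun do rewrite mul1r.
suff H : (\int[lebesgue_rV n]_x (expR (- normsq (x : 'rV[R]_n)))%:E < +oo)%E.
  apply/integrableP; split; first exact: mg.
  by under eq_integral do rewrite /= ger0_norm ?expR_ge0//.
elim: n => [|n IHn]; first by rewrite ge0_integral_rV0// ltry.
rewrite ge0_integral_rVS//.
set J := (\int[_]_x _)%E in IHn.
have J0 : (0 <= J)%E by apply: integral_ge0 => x _; rewrite lee_fin expR_ge0.
have JE : J = (fine J)%:E by rewrite fineK// ge0_fin_numE.
under eq_integral => s _.
  under eq_integral => y _ do rewrite normsq_cons opprD expRD EFinM.
  rewrite ge0_integralZl//=; last exact: mg.
  rewrite -/J JE.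
  over.
rewrite ge0_integralZr//=; last 2 first.
- apply/(@measurable_EFinP _ (measurableTypeR R)); exact: measurable_gauss_fun.
- by rewrite lee_fin fine_ge0.
rewrite muleC lte_mul_pinfty// ?lee_fin ?fine_ge0//.
have /integrableP[_] := @integrableT_gauss R.
by under eq_integral do rewrite /= ger0_norm ?gauss_fun_ge0//.
Qed.

Lemma integ_gauss n r : 0 < r -> integ (fun x : 'rV[R]_n => expR (- (r * normsq x))).
Proof.
move=> r0; have := integ_affine (0 : 'rV[R]_n) (c := Num.sqrt r) _ (integ_gauss1 n).
rewrite sqrtr_gt0 => /(_ r0); congr integ; apply/funext => x.
by rewrite add0r normsqZ sqr_sqrtr// ltW.
Qed.

Lemma mulr_expRN_le1 (s : R) : s * expR (- s) <= 1.
Proof. by rewrite expRN ler_pdivrMr ?expR_gt0// mul1r (le_trans _ (expR_ge1Dx s))// lerDr. Qed.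

(** Half of the exponent absorbs the polynomial, because [s * expR (- s) <= 1] at
    [s = r / 2 * normsq x]; hence the constant [1 + 2 / r]. *)
Lemma integ_gauss_poly n r : 0 < r ->
  integ (fun x : 'rV[R]_n => (1 + normsq x) * expR (- (r * normsq x))).
Proof.
move=> r0; have r20 : 0 < r / 2 by rewrite divr_gt0.
apply: (integ_dominated (C := 1 + 2 / r) _ (integ_gauss n r20)) => [|x].
  apply: continuous_measurable_rV; apply: (@smooth_continuous R R _ _ (fun _ (x : 'rV[R]_n) => (1 + normsq x) * expR (- (r * normsq x))) 0) => k.
  by apply: CkM; [apply: CkD; [exact: Ck_cst|exact: smooth_normsq]|exact: smooth_gauss].
rewrite ger0_norm; last by rewrite mulr_ge0 ?expR_ge0// addr_ge0// normsq_ge0.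
have -> : - (r * normsq x) = - (r / 2 * normsq x) + - (r / 2 * normsq x) by lra.
rewrite expRD mulrA ler_wpM2r ?expR_ge0// mulrDl mul1r lerD//.
  by rewrite -[leRHS]expR0 ler_expR oppr_le0 mulr_ge0 ?normsq_ge0// ltW.
have := mulr_expRN_le1 (r / 2 * normsq x); set E := expR _ => H.
have : r * (normsq x * E) <= 2 by lra.
by rewrite -ler_pdivlMl// [_^-1 * _]mulrC.
Qed.

(** By continuity [f] exceeds [f 0 / 2] on a small cube with a corner at 0, of volume
    [(d / 2) ^+ n]. The lemma makes the normalising integrals invertible. *)
Lemma intg_gt0 n (f : 'rV[R]_n -> R) : integ f -> continuous f -> (forall x, 0 <= f x) ->
  0 < f 0 -> 0 < intg f.
Proof.
move=> fi cf f0 f00; have e0 : 0 < f 0 / 2 by rewrite divr_gt0.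
have /nbhs_norm0P[d /= d0 Hd] : \forall x \near (0 : 'rV[R]_n), f 0 / 2 < f x.
  by apply: (cvgr_gt _ (cf 0)); lra.
pose A (i : 'I_n) : set R := `[0, d / 2]%classic.
pose B := [set x : 'rV[R]_n | forall i, A i (x ord0 i)].
have mA i : measurable (A i) by exact: measurable_itv.
have mB : measurable B by exact: (measurable_box mA).
have muB : lebesgue_rV n B = (\prod_(i < n) (d / 2)%:E)%E.
  rewrite lebesgue_rV_box//; apply: eq_bigr => i _.
  by rewrite lebesgue_measure_itv/= lte_fin divr_gt0// sube0.
have muB' : lebesgue_rV n B = ((d / 2) ^+ n)%:E.
  rewrite muB -[X in _ ^+ X]card_ord -prodr_const.
  by elim/big_ind2 : _ => // x1 x2 y1 y2 -> ->; rewrite EFinM.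
have iE : (\int[lebesgue_rV n]_x (\1_B x)%:E = ((d / 2) ^+ n)%:E)%E.
  by rewrite integral_indic// setIT; exact: muB'.
have iB : integ (fun x => \1_B x : R).
  apply/integrableP; split; first by apply/measurable_EFinP; exact: measurable_indic.
  under eq_integral do rewrite /= ger0_norm//.
  by rewrite iE ltry.
have dn : 0 < (d / 2) ^+ n by rewrite exprn_gt0// divr_gt0.
apply: (@lt_le_trans _ _ (intg (fun x => f 0 / 2 * \1_B x))).
  by rewrite intgZ// mulr_gt0// /intg/Rintegral iE.
apply: le_intg => //; first exact: integZ.
move=> x; rewrite indicE; case: (boolP (x \in B)) => [|_]; last by rewrite mulr0.
rewrite inE mulr1 => Bx; apply/ltW/Hd.
rewrite /= [ltLHS]/Num.Def.normr/= mx_normrE (le_lt_trans (y := d / 2))//; last by lra.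
apply/bigmax_leP; split; first by rewrite divr_ge0// ltW.
move=> [i j] _ /=; rewrite (ord1 i).
have /= := Bx j; rewrite /A/= in_itv/= => /andP[x0 x1]; by rewrite ger0_norm.
Qed.

(* Translation invariance makes the difference quotients of [p] integrate to 0. *)
Lemma intg_derive0 n (p q w : 'rV[R]_n -> R) (v : 'rV[R]_n) :
  integ p -> integ q -> integ w ->
  (forall h z, 0 < h <= 1 -> `|p (z + h *: v) - p z - h * q z| <= h ^+ 2 * w z) ->
  intg q = 0.
Proof.
move=> pi qi wi H; apply/eqP; rewrite -normr_eq0 eq_le normr_ge0 andbT.
have w0 : 0 <= intg w.
  by apply: intg_ge0 => z; have := H 1 z; rewrite lexx ltr01 expr1n => /(_ isT) /(le_trans (normr_ge0 _)); rewrite mul1r.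
have key h : 0 < h <= 1 -> `|intg q| <= h * intg w.
  move=> /[dup] h01 /andP[h0 _].
  have ti : integ (fun z => p (z + h *: v)).
    have := integ_affine (h *: v) ltr01 pi; congr integ; apply/funext => z.
    by rewrite scale1r addrC.
  have tE : intg (fun z => p (z + h *: v)) = intg p.
    rewrite [RHS](intg_affine (h *: v) ltr01 pi) expr1n mul1r; congr intg; apply/funext => z.
    by rewrite scale1r addrC.
  have : `|intg (fun z => p (z + h *: v) - p z - h * q z)| <= intg (fun z => h ^+ 2 * w z).
    apply: norm_intg_le => [||z]; last exact: H.
    - by apply: integB; [exact: integB|exact: integZ].
    - exact: integZ.
  rewrite !intgB//; [|exact: integB|exact: integZ].
  rewrite !intgZ// tE subrr sub0r normrN normrM gtr0_norm// expr2 -mulrA ler_pM2l//.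
apply/ler_addgt0Pl => e e0; rewrite addr0.
pose h := Num.min 1 (e / (intg w + 1)).
have w1 : 0 < intg w + 1 by rewrite ltr_wpDl.
have h0 : 0 < h by rewrite lt_min ltr01 divr_gt0.
apply: le_trans (key h _) _; first by rewrite h0 ge_min lexx.
apply: (@le_trans _ _ (e / (intg w + 1) * (intg w + 1))); last by rewrite divfK// gt_eqF.
apply: ler_pM => //; [exact: ltW|by rewrite ge_min lexx orbT|by rewrite lerDl].
Qed.

End gaussian_weights.

(** * Functions with bounded derivatives of every order *)

Section bounded_derivatives.
Context {R : realType}.

(** Two applications of the mean value inequality. The bound on the second derivative is asked only
    along the segment, so that [C] may depend on [x] and later carry an integrable weight. *)
Lemma taylor2 (V W : normedModType R) (f : V -> W) x v C h :
  (forall y, derivable f y v) -> (forall y, derivable ('D_v f) y v) ->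
  (forall s, `|s| <= `|h| -> `|'D_v ('D_v f) (x + s *: v)| <= C) ->
  `|f (x + h *: v) - f x - h *: 'D_v f x| <= C * h ^+ 2.
Proof.
move=> df ddf HC.
have C0 : 0 <= C by apply: le_trans (HC 0 _); rewrite ?normr0.
pose u := h *: v.
have dfu y : derivable f y u /\ 'D_u f y = h *: 'D_v f y.
  by have [H E] := is_derive_scale h (derivableP (df y)).
have Du : 'D_u f = fun y => h *: 'D_v f y by apply/funext => y; case: (dfu y).
have ddfu y : is_derive y u ('D_u f) (h *: (h *: 'D_v ('D_v f) y)).
  by rewrite Du; apply: is_deriveZ; exact: is_derive_scale (derivableP (ddf y)).
have H1 s : 0 <= s <= 1 -> `|'D_u f (x + s *: u) - 'D_u f x| <= C * h ^+ 2 * s.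
  move=> /andP[s0 s1].
  have := @vector_MVT R W (fun r => 'D_u f (x + r *: u))
    (fun r => 'D_u ('D_u f) (x + r *: u)) (fun r => C * h ^+ 2 * r) (fun _ => C * h ^+ 2) 0 s s0.
  rewrite scale0r addr0 mulr0 subr0; apply.
  - by move=> r _; apply: is_derive_line; have [] := ddfu (x + r *: u).
  - by move=> r _; exact: is_derive_mull.
  - move=> r /andP[r0 rs]; have [_ ->] := ddfu (x + r *: u).
    rewrite !normrZ mulrA -expr2 -normrX ger0_norm ?sqr_ge0// mulrC ler_wpM2r ?sqr_ge0//.
    rewrite /u scalerA; apply: HC; rewrite normrM ger0_norm// ler_piMl//.
    exact: le_trans rs s1.
have := @vector_MVT R W (fun r => f (x + r *: u) - r *: 'D_u f x)
  (fun r => 'D_u f (x + r *: u) - 'D_u f x) (fun r => C * h ^+ 2 * r) (fun _ => C * h ^+ 2) 0 1 ler01.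
rewrite !scale1r !scale0r addr0 subr0 mulr1 mulr0 subr0 addrAC => H2.
rewrite -/u -[h *: 'D_v f x](dfu x).2; apply: H2.
- move=> r _; apply: is_deriveB; last exact: is_derive_scalel.
  by apply: is_derive_line; have [] := dfu (x + r *: u).
- by move=> r _; exact: is_derive_mull.
- move=> r r01; rewrite (le_trans (H1 r r01))// ler_piMr//.
    by rewrite mulr_ge0// sqr_ge0.
  by case/andP: r01.
Qed.

(** The path from [x] to [y] changes one coordinate at a time. In the sup norm all of it stays
    within distance [|y - x|] of [x], so a local bound on the partial derivatives suffices. *)
Lemma increment_partial n (W : normedModType R) (f : 'rV[R]_n -> W) (C : R) x y :
  (forall i z, derivable f z (delta_mx ord0 i)) ->
  (forall i z, `|z - x| <= `|y - x| -> `|partial i f z| <= C) ->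
  `|f y - f x| <= n%:R * C * `|y - x|.
Proof.
move=> df HC.
pose a k : 'rV[R]_n := \row_i (if (i < k)%N then y ord0 i else x ord0 i).
have a0 : a 0%N = x by apply/rowP => i; rewrite mxE.
have an : a n = y by apply/rowP => i; rewrite mxE ltn_ord.
suff H k : (k <= n)%N -> `|f (a k) - f x| <= k%:R * C * `|y - x|.
  by rewrite -[in leLHS]an H.
elim: k => [_|k IH kn]; first by rewrite a0 subrr normr0 !mul0r.
have C0 : 0 <= C by apply: le_trans (HC (Ordinal kn) x _); rewrite ?subrr ?normr0.
rewrite -(subrKA (f (a k))) (le_trans (ler_normD _ _))//.
rewrite -natr1 [X in _ <= X * _]mulrDl mul1r [leRHS]mulrDl addrC lerD//; first exact/IH/ltnW.
pose i := Ordinal kn; pose u : 'rV[R]_n := (y - x) ord0 i *: delta_mx ord0 i.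
have aS : a k.+1 = a k + u.
  apply/rowP => j; rewrite !mxE eqxx/= ltnS leq_eqVlt -[j == i]/(j == k :> nat).
  case: eqVneq => [jk|_] /=; last by rewrite mulr0 addr0.
  have -> : j = i by apply: val_inj.
  by rewrite ltnn mulr1 addrC subrK.
have ax r : 0 <= r <= 1 -> `|a k + r *: u - x| <= `|y - x|.
  move=> /andP[r0 r1]; rewrite [leLHS]/Num.Def.normr/= mx_normrE.
  apply/bigmax_leP; split => // -[i0 j] _ /=; rewrite (ord1 i0) {i0}.
  rewrite !mxE eqxx/= -[j == i]/(j == k :> nat).
  have H := rV_norm_ge (y - x) j; rewrite !mxE in H.
  case: ltnP => [jk|kj]; first by rewrite (ltn_eqF jk) !mulr0 addr0.
  case: eqVneq => [jk|_] /=; last by rewrite !mulr0 addr0 subrr normr0.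
  have -> : i = j by apply: val_inj.
  rewrite mulr1 addrAC subrr add0r normrM ger0_norm// (le_trans _ H)//.
  by rewrite ler_piMl.
have du z : is_derive z u f ((y - x) ord0 i *: partial i f z).
  by apply: is_derive_scale; apply: derivableP.
have := @vector_MVT R W (fun r => f (a k + r *: u)) (fun r => 'D_u f (a k + r *: u))
  (fun r => C * `|y - x| * r) (fun _ => C * `|y - x|) 0 1 ler01.
rewrite !scale1r scale0r addr0 mulr1 mulr0 subr0 -aS; apply.
- by move=> r _; apply: is_derive_line; have [] := du (a k + r *: u).
- by move=> r _; exact: is_derive_mull.
- move=> r r01; have [_ ->] := du (a k + r *: u).
  by rewrite normrZ mulrC ler_pM ?rV_norm_ge// HC// ax.
Qed.

Lemma lipschitz_partial n (W : normedModType R) (f : 'rV[R]_n -> W) (C : R) :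
  (forall i x, derivable f x (delta_mx ord0 i)) ->
  (forall i x, `|partial i f x| <= C) ->
  forall x y, `|f y - f x| <= n%:R * C * `|y - x|.
Proof. by move=> df HC x y; apply: increment_partial. Qed.

(** Subtracting the linear map [A] leaves a function whose partial derivatives are small near [x],
    and [increment_partial] applies to the difference. *)
Lemma is_derive_partial n (f : 'rV[R]_n -> R) x v :
  (forall i z, derivable f z (delta_mx ord0 i)) ->
  (forall i, {for x, continuous (partial i f)}) ->
  is_derive x v f (\sum_i v ord0 i * partial i f x).
Proof.
move=> df cf; pose A (w : 'rV[R]_n) := \sum_i w ord0 i * partial i f x.
have lA : linear A.
  move=> a w w'; rewrite /A scaler_sumr -big_split/=; apply: eq_bigr => i _.
  by rewrite !mxE mulrDl -mulrA.
have AE i : A (delta_mx ord0 i) = partial i f x.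
  rewrite /A (bigD1 i)//= mxE !eqxx mul1r big1 ?addr0// => j ji.
  by rewrite mxE eqxx (negbTE ji) mul0r.
have dA z w : is_derive z w A (A w) by exact: is_derive_bounded_linear.
apply/is_deriveP_ball => e e0.
(* [c] dominates both [|v|], which keeps [h *: v + x] within [d] of [x], and [n * |v|], which pays
   for the [n] coordinate steps. *)
pose c := (n%:R + 1) * `|v| + 1 : R.
have c0 : 0 < c by rewrite ltr_wpDl// mulr_ge0// addr_ge0.
have ec : 0 < e / c by rewrite divr_gt0.
have : \forall z \near x, forall i, `|partial i f x - partial i f z| <= e / c.
  apply: (@filter_forall _ _ (fun i (z : 'rV[R]_n) => `|partial i f x - partial i f z| <= e / c)
    (nbhs x) (nbhs_filter x)) => i.
  exact: (@cvgr_dist_le _ _ _ _ (nbhs_filter x) _ _ (cf i) _ ec).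
move=> /nbhs_normP[d /= d0 Hd].
exists (d / c); first exact: divr_gt0.
move=> h hd.
have hv : `|h *: v| < d.
  rewrite normrZ (le_lt_trans (y := d / c * `|v|)) ?ler_wpM2r ?(ltW hd)//.
  rewrite mulrAC ltr_pdivrMr// ltr_pM2l// /c ltr_pwDr//.
  by rewrite mulrDl mul1r lerDr mulr_ge0.
have dg z i : is_derive z (delta_mx ord0 i) (fun y => f y - A y) (partial i f z - partial i f x).
  by rewrite -AE; exact: (is_deriveB (derivableP (df i z)) (dA z _)).
have := @increment_partial n R (fun z => f z - A z) (e / c) x (h *: v + x) _ _.
rewrite addrK lA -!/(A _) => /(_ _ _)/le_trans H.
have -> : f (h *: v + x) - f x - h *: (\sum_(i < n) v ord0 i * partial i f x) =
  f (h *: v + x) - (h *: A v + A x) - (f x - A x).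
  by rewrite /A; ring.
apply: H.
- by move=> i z; have [] := dg z i.
- move=> i z zx; rewrite /partial; have [_ ->] := dg z i.
  by rewrite distrC; apply: (Hd z); rewrite /= distrC (le_lt_trans zx).
have -> : n%:R * (e / c) * `|h *: v| = e * `|h| * (n%:R * `|v| / c) by rewrite normrZ; ring.
rewrite ler_piMr ?mulr_ge0 ?(ltW e0)// ler_pdivrMr// mul1r /c mulrDl mul1r -addrA lerDl.
by rewrite addr_ge0.
Qed.

Lemma lipschitz_continuous (V W : normedModType R) (f : V -> W) (L : R) :
  (forall x y, `|f y - f x| <= L * `|y - x|) -> continuous f.
Proof.
move=> H x; apply/cvgrPdist_le => e e0; near=> y.
rewrite distrC (le_trans (H _ _))//.
apply: (@le_trans _ _ ((`|L| + 1) * `|y - x|)).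
  by rewrite ler_wpM2r// (le_trans (ler_norm L))// lerDl.
rewrite -ler_pdivlMl ?ltr_wpDl// distrC; near: y.
by apply: cvgr_dist_le; [exact: cvg_id|rewrite mulr_gt0 ?invr_gt0 ?ltr_wpDl].
Unshelve. all: by end_near. Qed.

Lemma smooth_partial n (f : 'rV[R]_n -> R) i : smooth (fun _ : R => f) ->
  smooth (fun _ : R => partial i f).
Proof. by move=> Cf; exact: (@smooth_derive _ _ _ _ (fun _ => f) (delta_mx ord0 i)). Qed.

Lemma smooth_derivable0 n (f : 'rV[R]_n -> R) x v : smooth (fun _ : R => f) ->
  derivable f x v.
Proof. exact: (@smooth_derivable _ _ _ _ (fun _ : R => f) 0). Qed.

Fixpoint bounded_derivatives n k (f : 'rV[R]_n -> R) : Prop :=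
  (exists C, forall x, `|f x| <= C) /\
  match k with 0%N => True | k'.+1 => forall i, bounded_derivatives k' (partial i f) end.

(** The working class of the proof: mollified data belong to it, it is stable under products,
    exponentials and reciprocals of functions with a positive lower bound, and its members can be
    integrated against any Gaussian together with all their derivatives. *)
Definition bsmooth n (f : 'rV[R]_n -> R) :=
  smooth (fun _ : R => f) /\ forall k, bounded_derivatives k f.

Lemma bsmooth_smooth n (f : 'rV[R]_n -> R) : bsmooth f -> smooth (fun _ : R => f).
Proof. by case. Qed.

Lemma bsmooth_bounded n (f : 'rV[R]_n -> R) : bsmooth f -> exists C, forall x, `|f x| <= C.
Proof. by move=> [_ /(_ 0%N)[]]. Qed.

Lemma bsmooth_partial n (f : 'rV[R]_n -> R) i : bsmooth f -> bsmooth (partial i f).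
Proof.
move=> [Cf bf]; split=> [|k]; last by case: (bf k.+1) => _; exact.
exact: smooth_partial.
Qed.

Lemma bsmooth_derivable n (f : 'rV[R]_n -> R) x v : bsmooth f -> derivable f x v.
Proof. by move=> [Cf _]; exact: smooth_derivable0. Qed.

Lemma bsmooth_continuous n (f : 'rV[R]_n -> R) : bsmooth f -> continuous f.
Proof. by move=> [Cf _]; exact: (@smooth_continuous _ _ _ _ (fun _ : R => f) 0). Qed.

Lemma smooth_row n (f : 'rV[R]_n -> R) x v : smooth (fun _ : R => f) ->
  'D_v f x = \sum_i v ord0 i * partial i f x.
Proof. by move=> Cf; exact: (@tangent_row _ _ _ _ (fun _ : R => f) 0). Qed.

(** In a family closed under partial derivatives, bounds on the individual members are enough:
    bounded partials give Lipschitz continuity, and the tangent map of a member is a combination of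
    members. A single function is treated by embedding it into such a family. *)
Lemma bsmooth_family n (I : Type) (F : I -> 'rV[R]_n -> R) (d : I -> 'I_n -> I) :
  (forall a, exists C, forall x, `|F a x| <= C) ->
  (forall a x v, is_derive x v (F a) (\sum_i v ord0 i * F (d a i) x)) ->
  forall a, bsmooth (F a).
Proof.
move=> bF dF.
have dFi a i : partial i (F a) = F (d a i).
  apply/funext => x; rewrite /partial; have [_ ->] := dF a x (delta_mx ord0 i).
  rewrite (bigD1 i)//= mxE !eqxx mul1r big1 ?addr0// => j ji.
  by rewrite mxE eqxx (negbTE ji) mul0r.
have cF a : continuous (F a).
  have [C HC] := choice (fun i => bF (d a i)).
  apply: (lipschitz_continuous (L := n%:R * \sum_i `|C i|)).
  apply: lipschitz_partial => [i x|i x]; first by have [] := dF a x (delta_mx ord0 i).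
  by rewrite dFi (le_trans (HC i x))// (bigD1 i)//= (le_trans (ler_norm _))// lerDl sumr_ge0.
have CF k a : Ck k (fun _ : R => F a).
  elim: k a => [|k IH] a.
    by split=> // z; apply: (@continuous_comp _ _ _ snd (F a)); [exact: cvg_snd|exact: cF].
  apply: (@CkSI _ _ _ _ _ _ (fun _ (z : 'rV[R]_n * 'rV[R]_n) => \sum_i z.2 ord0 i * F (d a i) z.1)).
  - by move=> z; apply: (@continuous_comp _ _ _ snd (F a)); [exact: cvg_snd|exact: cF].
  - apply: Ck_sum => i; apply: CkM.
      apply: (@Ck_linear_comp _ _ _ _ _ _ (fun z : 'rV[R]_n => z ord0 i) (fun _ z => z.2)).
        exact: bounded_linear_coord.
      exact/Ck_linear/bounded_linear_snd.
    exact: (Ck_comp_linear (@bounded_linear_fst _ _ _) (IH (d a i))).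
move=> a; split; first by move=> k; exact: CF.
move=> k; elim: k a => [|k IH] a; split=> // i.
by rewrite dFi.
Qed.

Lemma partialD n (f g : 'rV[R]_n -> R) i : smooth (fun _ : R => f) -> smooth (fun _ : R => g) ->
  partial i (fun x => f x + g x) = fun x => partial i f x + partial i g x.
Proof.
move=> Cf Cg; apply/funext => x; apply: deriveD.
  exact: smooth_derivable0.
exact: smooth_derivable0.
Qed.

Lemma partialM n (f g : 'rV[R]_n -> R) i : smooth (fun _ : R => f) -> smooth (fun _ : R => g) ->
  partial i (fun x => f x * g x) = fun x => partial i f x * g x + f x * partial i g x.
Proof.
move=> Cf Cg; apply/funext => x; rewrite /partial deriveM.
- by rewrite addrC [X in X + _]mulrC; congr (_ + _); exact: mulrC.
- exact: smooth_derivable0.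
- exact: smooth_derivable0.
Qed.

Lemma bsmooth_cst n (c : R) : bsmooth (fun _ : 'rV[R]_n => c).
Proof.
split=> [k|k]; first exact: Ck_cst.
elim: k c => [|k IH] c; split=> //; try by exists `|c|.
move=> i; rewrite (_ : partial i _ = fun _ => 0)//.
by apply/funext => x; exact: derive_cst.
Qed.

Lemma bsmoothD n (f g : 'rV[R]_n -> R) : bsmooth f -> bsmooth g -> bsmooth (fun x => f x + g x).
Proof.
move=> bf bg; split=> [k|k]; first by apply: CkD; [exact: bf.1|exact: bg.1].
elim: k f g bf bg => [|k IH] f g bf bg; (split; [|try move=> i; try by []]).
- have [C HC] := bsmooth_bounded bf; have [D HD] := bsmooth_bounded bg.
  by exists (C + D) => x; rewrite (le_trans (ler_normD _ _))// lerD.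
- have [C HC] := bsmooth_bounded bf; have [D HD] := bsmooth_bounded bg.
  by exists (C + D) => x; rewrite (le_trans (ler_normD _ _))// lerD.
- rewrite partialD; [|exact: bf.1|exact: bg.1].
  by apply: IH; exact: bsmooth_partial.
Qed.

Lemma bsmoothM n (f g : 'rV[R]_n -> R) : bsmooth f -> bsmooth g -> bsmooth (fun x => f x * g x).
Proof.
move=> bf bg; have Cfg h1 h2 : bsmooth h1 -> bsmooth h2 -> smooth (fun (_ : R) (x : 'rV[R]_n) => h1 x * h2 x).
  by move=> [C1 _] [C2 _] k; apply: CkM.
split=> [|k]; first exact: Cfg.
have bM h1 h2 : bsmooth h1 -> bsmooth h2 -> exists C, forall x : 'rV[R]_n, `|h1 x * h2 x| <= C.
  move=> /bsmooth_bounded[C HC] /bsmooth_bounded[D HD].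
  by exists (C * D) => x; rewrite normrM ler_pM.
elim: k f g bf bg => [|k IH] f g bf bg; split; [exact: bM|by []|exact: bM|move=> i].
rewrite partialM; [|exact: bf.1|exact: bg.1].
have bDk h1 h2 : smooth (fun _ : R => h1) -> smooth (fun _ : R => h2) ->
    bounded_derivatives k h1 -> bounded_derivatives k h2 ->
    bounded_derivatives k (fun x : 'rV[R]_n => h1 x + h2 x).
  elim: k {IH} h1 h2 => [|k IH] h1 h2 C1 C2 [[B1 HB1] b1] [[B2 HB2] b2].
    split=> //; exists (B1 + B2) => x; rewrite (le_trans (ler_normD _ _))//.
    by rewrite lerD.
  split; first by exists (B1 + B2) => x; rewrite (le_trans (ler_normD _ _))// lerD.
  move=> i'; rewrite partialD//.
  by apply: IH; [exact: smooth_partial|exact: smooth_partial|exact: b1|exact: b2].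
apply: bDk; [apply: Cfg => //|apply: Cfg => //|apply: IH => //|apply: IH => //]; exact: bsmooth_partial.
Qed.

Lemma is_derive_expR_comp n (f : 'rV[R]_n -> R) x v l :
  is_derive x v f l -> is_derive x v (fun y => expR (f y)) (l * expR (f x)).
Proof.
move=> df; have dE (y w : R) : derivable (@expR R) y w.
  exact: (@smooth_derivable R R _ _ (fun _ => @expR R) 0 _ _ (@smooth_expR R R)).
have H := @is_derive_chain R _ _ _ (@expR R) f x v _ dE
  (continuous_Ck_tangent (p := (0 : R)) (@smooth_expR R R 1%N)) df.
apply: (is_derive_eq H).
rewrite -[l in LHS]mulr1 -[l * 1]/(l *: (1 : R)) deriveZv//.
by have [_ ->] := is_derive_expR (f x).
Qed.

Lemma bsmooth_expR n (f : 'rV[R]_n -> R) : bsmooth f -> bsmooth (fun x => expR (f x)).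
Proof.
move=> bf.
have [C HC] := bsmooth_bounded bf.
(* The family consists of the products of [expR f] with a coefficient [g] of the class;
   differentiation replaces [g] by [partial i g + g * partial i f]. *)
pose I := {g : 'rV[R]_n -> R | bsmooth g}.
pose F (a : I) x := sval a x * expR (f x).
pose d (a : I) i : I := exist _ (fun x => partial i (sval a) x + sval a x * partial i f x)
  (bsmoothD (bsmooth_partial i (svalP a)) (bsmoothM (svalP a) (bsmooth_partial i bf))).
have := @bsmooth_family n I F d _ _ (exist _ _ (bsmooth_cst n 1)).
rewrite /F/= (_ : (fun x => 1 * expR (f x)) = fun x => expR (f x)); last first.
  by apply/funext => x; rewrite mul1r.
apply => [[g bg]|[g bg] x v].
  have [D HD] := bsmooth_bounded bg; exists (D * expR C) => x.
  rewrite /F/= normrM ler_pM// ger0_norm ?expR_ge0// ler_expR.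
  exact: le_trans (ler_norm _) _.
have dg := derivableP (@bsmooth_derivable _ _ x v bg).
have df := is_derive_expR_comp (derivableP (@bsmooth_derivable _ _ x v bf)).
apply: (is_derive_eq (is_deriveM dg df)).
rewrite /F/= -![_ *: _]/(_ * _) (@smooth_row _ f x v bf.1) (@smooth_row _ g x v bg.1).
rewrite !mulr_suml !mulr_sumr -big_split/=; apply: eq_bigr => i _.
by rewrite /F/=; ring.
Qed.

End bounded_derivatives.

(** * Compactly supported functions and integration by parts *)

Section compact_support.
Context {R : realType} {n : nat}.
Implicit Types (f psi eta : 'rV[R]_n -> R) (x v z : 'rV[R]_n).

(** Here [r] is the square of a Euclidean radius. *)
Definition supp_in (r : R) f := forall x, r < normsq x -> f x = 0.

Lemma supp_in_partial r f i : supp_in r f -> supp_in r (partial i f).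
Proof.
move=> rf x rx; rewrite -[RHS](derive_cst (0 : R) x (delta_mx ord0 i)).
apply: near_eq_derive.
apply: (@filterS _ (nbhs x) (nbhs_filter x) (fun y => r < normsq y)) => [y|]; first exact: rf.
by apply: (cvgr_gt (normsq x) (@normsq_continuous R n x)).
Qed.

Lemma normsq_le_norm (r : R) x : normsq x <= r -> `|x| <= r + 1.
Proof.
move=> xr; have := normsq_ge x; have := normr_ge0 x; set a := `|x| => a0 ax.
have : 0 <= (a - 1) ^+ 2 by exact: sqr_ge0.
rewrite sqrrB expr1n; nra.
Qed.

Lemma supp_in_bounded r f : continuous f -> supp_in r f -> exists C, forall x, `|f x| <= C.
Proof.
move=> cf rf.
have := continuous_compact (A := [set x : 'rV[R]_n | `|x| <= r + 1])
  (continuous_subspaceT cf) (@closed_ball_compact R n (r + 1)).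
move=> /compact_bounded[M [_ HM]]; exists (`|M| + 1) => x.
have [xr|xr] := leP (normsq x) r; last by rewrite rf// normr0 addr_ge0.
apply: (HM (`|M| + 1)); first by rewrite ltr_pwDr// ler_norm.
by exists x => //=; exact: normsq_le_norm.
Qed.

Definition csmooth r f := bsmooth f /\ supp_in r f.

Lemma csmooth_partial r f i : csmooth r f -> csmooth r (partial i f).
Proof. by move=> [bf rf]; split; [exact: bsmooth_partial|exact: supp_in_partial]. Qed.

(** Compact support makes the iterated partials bounded, and [is_derive_partial] turns their
    continuity into derivatives in all directions; they form a family for [bsmooth_family], indexed
    by lists of axes. *)
Lemma test_function_csmooth eta : test_function eta -> exists r, csmooth r eta.
Proof.
move=> [Seta /compact_bounded[M [_ HM]]].
(* The inequality [normsq x <= n * |x| ^ 2] converts the sup-norm bound on the support. *)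
pose r := n%:R * (`|M| + 1) ^+ 2; exists r.
have reta : supp_in r eta.
  move=> x rx; apply/eqP/negP => /negP ex.
  have : `|x| <= `|M| + 1.
    apply: (HM (`|M| + 1)); first by rewrite ltr_pwDr// ler_norm.
    exact: subset_closure.
  move=> xM; have := le_lt_trans (normsq_le x) _; move: rx => /lt_le_trans /(_ (normsq_le x)).
  rewrite /r => H _; move: H; apply/negP; rewrite -leNgt ler_wpM2l//.
  by rewrite lerXn2r ?nnegrE// addr_ge0.
split=> //.
pose F (js : seq 'I_n) := iter_derive [seq delta_mx ord0 i | i <- js] eta.
have rF js : supp_in r (F js).
  by rewrite /F; elim: js => //= j js IH; exact: supp_in_partial.
have := @bsmooth_family R n (seq 'I_n) F (fun js i => i :: js) _ _ [::]; apply.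
- move=> js; apply: (supp_in_bounded _ (rF js)) => x.
  by have [] := Seta [seq delta_mx ord0 i | i <- js] x I.
- move=> js x v; apply: is_derive_partial.
    by move=> i z; have [+ _] := Seta [seq delta_mx ord0 i | i <- js] z I; exact.
  by move=> i; have [_ +] := Seta [seq delta_mx ord0 i | i <- i :: js] x I.
Qed.

Lemma csmooth_test_function r eta : csmooth r eta -> test_function eta.
Proof.
move=> [beta reta]; split.
  exact: (@smooth_smooth_on _ _ _ _ (fun _ : R => eta) 0 setT (bsmooth_smooth beta)).
apply: (@subclosed_compact _ _ [set x : 'rV[R]_n | `|x| <= r + 1]).
- exact: closed_closure.
- exact: closed_ball_compact.
apply: (@subset_trans _ (closure [set x : 'rV[R]_n | `|x| <= r + 1])).
  apply: closure_subset => x /= ex; apply: normsq_le_norm.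
  by rewrite leNgt; apply/negP => /reta e0; rewrite e0 eqxx in ex.
rewrite -(proj1 (closure_id _))//.
apply: (@closed_comp _ _ (fun x : 'rV[R]_n => `|x|) [set s | s <= r + 1]).
  by move=> x _; exact: norm_continuous.
exact: closed_le.
Qed.

(** Where [psi] can be nonzero the Gaussian is at least [expR (- r)], whence the factor [expR r].
    Integrability of compactly supported functions is thereby reduced to that of one Gaussian. *)
Lemma csmooth_gauss r psi : csmooth r psi ->
  exists C, forall x, `|psi x| <= C * expR (- normsq x).
Proof.
move=> [/bsmooth_bounded[C HC] rpsi]; exists (C * expR r) => x.
have C0 : 0 <= C by exact: le_trans (HC 0).
have [xr|xr] := leP (normsq x) r; last by rewrite rpsi// normr0 !mulr_ge0 ?expR_ge0.
rewrite -mulrA -expRD (le_trans (HC x))// ler_peMr// -expR0 ler_expR; lra.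
Qed.

Lemma csmooth_integ r psi : csmooth r psi -> integ psi.
Proof.
move=> cpsi; have [C HC] := csmooth_gauss cpsi.
apply: (integ_dominated (C := C) _ (integ_gauss1 n)) => //.
exact: (continuous_measurable_rV (bsmooth_continuous cpsi.1)).
Qed.

Lemma normsqD_le x v : normsq (x + v) <= 2 * normsq x + 2 * normsq v.
Proof.
rewrite /normsq !mulr_sumr -big_split/=; apply: ler_sum => i _; rewrite !mxE.
have := sqr_ge0 (x ord0 i - v ord0 i); rewrite sqrrB sqrrD; lra.
Qed.

(** A Taylor remainder with an integrable weight, uniform in [h]: this is what [intg_derive0] and
    differentiation under the integral sign consume. *)
Lemma csmooth_taylor r psi v : csmooth r psi ->
  exists2 C, 0 <= C & forall h z, `|h| <= 1 ->
    `|psi (z + h *: v) - psi z - h * 'D_v psi z| <= h ^+ 2 * (C * expR (- normsq z)).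
Proof.
move=> [bpsi rpsi].
have D1 : 'D_v psi = fun x => \sum_i v ord0 i * partial i psi x.
  by apply/funext => x; exact: smooth_row bpsi.1.
have bsum (I : Type) (s : seq I) (F : I -> 'rV[R]_n -> R) : (forall i, bsmooth (F i)) ->
    bsmooth (fun x => \sum_(i <- s) F i x).
  move=> bF; elim: s => [|i s IH].
    by under eq_fun do rewrite big_nil; exact: bsmooth_cst.
  by under eq_fun do rewrite big_cons; exact: bsmoothD.
have bZ (c : R) f : bsmooth f -> bsmooth (fun x => c * f x).
  by move=> bf; apply: bsmoothM => //; exact: bsmooth_cst.
have bD f : bsmooth f -> bsmooth ('D_v f).
  move=> bf; rewrite (_ : 'D_v f = fun x => \sum_i v ord0 i * partial i f x).
    by apply: bsum => i; apply: bZ; exact: bsmooth_partial.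
  by apply/funext => x; exact: smooth_row bf.1.
have [C HC] := bsmooth_bounded (bD _ (bD _ bpsi)).
have C0 : 0 <= C by exact: le_trans (HC 0).
(* Beyond [r'] both [z] and [z + h *: v] lie outside the support when [|h| <= 1], since [normsq z <=
   2 * normsq (z + h *: v) + 2 * normsq v]. *)
pose r' := 2 * `|r| + 2 * normsq v.
exists (C * expR r'); first by rewrite mulr_ge0 ?expR_ge0.
move=> h z h1.
have [zr|zr] := leP (normsq z) r'.
  rewrite -mulrA -expRD.
  apply: (@le_trans _ _ (C * h ^+ 2)).
    apply: taylor2 => [y|y|s _].
    - exact: bsmooth_derivable.
    - by apply: bsmooth_derivable; exact: bD.
    - exact: HC.
  rewrite mulrC ler_wpM2l ?sqr_ge0// ler_peMr// -expR0 ler_expR; lra.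
have rz : r < normsq z.
  by rewrite (le_lt_trans (ler_norm r))// (le_lt_trans _ zr)// /r'; have := normsq_ge0 v; have := normr_ge0 r; lra.
have rzh : r < normsq (z + h *: v).
  have := normsqD_le (z + h *: v) (- (h *: v)); rewrite addrK normsqN normsqZ => H.
  rewrite (le_lt_trans (ler_norm r))//.
  have : h ^+ 2 * normsq v <= normsq v.
    by rewrite ler_piMl ?normsq_ge0// -real_normK ?num_real// expr_le1.
  rewrite /r' in zr; lra.
have E : 'D_v psi z = 0.
  rewrite (@smooth_row _ _ psi z v bpsi.1) big1// => i _.
  by rewrite (supp_in_partial i rpsi rz) mulr0.
rewrite !rpsi// [X in h * X](_ : _ = 0); last exact: E.
by rewrite mulr0 !subr0 normr0 mulr_ge0 ?sqr_ge0// !mulr_ge0 ?expR_ge0.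
Qed.

Lemma intg_partial0 r psi i : csmooth r psi -> intg (partial i psi) = 0.
Proof.
move=> cpsi; have [C C0 HC] := csmooth_taylor (delta_mx ord0 i) cpsi.
apply: (intg_derive0 (p := psi) (v := delta_mx ord0 i)
  (w := fun z => C * expR (- normsq z))).
- exact: csmooth_integ cpsi.
- exact: (csmooth_integ (csmooth_partial i cpsi)).
- exact/integZ/integ_gauss1.
- by move=> h z /andP[h0 h1]; apply: HC; rewrite gtr0_norm.
Qed.

Lemma csmoothM r f psi : bsmooth f -> csmooth r psi -> csmooth r (fun x => f x * psi x).
Proof.
by move=> bf [bpsi rpsi]; split; [exact: bsmoothM|move=> x /rpsi ->; rewrite mulr0].
Qed.

Lemma intg_by_parts r f psi i : bsmooth f -> csmooth r psi ->
  intg (fun x => partial i f x * psi x) = - intg (fun x => f x * partial i psi x).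
Proof.
move=> bf cpsi; apply/eqP; rewrite -addr_eq0; apply/eqP.
rewrite -(intg_partial0 i (csmoothM bf cpsi)) -intgD.
- by rewrite partialM//; [exact: bf.1|exact: cpsi.1.1].
- exact: (csmooth_integ (csmoothM (bsmooth_partial i bf) cpsi)).
- exact: (csmooth_integ (csmoothM bf (csmooth_partial i cpsi))).
Qed.

End compact_support.

(** * Convolution, Fubini and the Friedrichs mollifier *)

Section mollification.
Context {R : realType} {n : nat}.
Implicit Types (f g psi eta : 'rV[R]_n -> R) (x v z : 'rV[R]_n).

Lemma csmooth_of_smooth r f : smooth (fun _ : R => f) -> supp_in r f -> csmooth r f.
Proof.
move=> Cf rf; split=> //; split=> // k.
elim: k f Cf rf => [|k IH] f Cf rf; (split; first by apply: (supp_in_bounded _ rf);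
  exact: (@smooth_continuous _ _ _ _ (fun _ : R => f) 0 Cf)) => //.
by move=> i; apply: IH; [exact: smooth_partial|exact: supp_in_partial].
Qed.

Lemma csmooth_reflect r psi x : csmooth r psi ->
  csmooth (2 * r + 2 * normsq x) (fun y => psi (x - y)).
Proof.
move=> [bpsi rpsi]; apply: csmooth_of_smooth => [k|y ry].
  apply: (@Ck_comp _ _ _ _ _ _ (fun _ => psi) (fun _ y => x - y)); first exact: bpsi.1.
  by apply: CkB; [exact: Ck_cst|exact: Ck_id].
apply: rpsi; have := normsqD_le (x - y) (- x).
rewrite addrAC subrr add0r !normsqN; lra.
Qed.

Lemma gauss_reflectE x y : expR (- normsq (x - y)) = expR (- normsq (- x + 1 *: y)) :> R.
Proof. by rewrite scale1r -normsqN opprB addrC. Qed.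

Lemma integ_gauss_reflect x : integ (fun y => expR (- normsq (x - y)) : R).
Proof.
have := integ_affine (- x) ltr01 (@integ_gauss1 R n); congr integ; apply/funext => y.
by rewrite gauss_reflectE.
Qed.

Lemma intg_gauss_reflect x :
  intg (fun y => expR (- normsq (x - y)) : R) = intg (fun y : 'rV[R]_n => expR (- normsq y)).
Proof.
rewrite [RHS](intg_affine (- x) ltr01 (@integ_gauss1 R n)) expr1n mul1r.
by congr intg; apply/funext => y; rewrite gauss_reflectE.
Qed.

Lemma measurable_reflect psi x : measurable_fun setT psi ->
  measurable_fun setT (fun y : 'rV[R]_n => psi (x - y)).
Proof.
move=> mpsi; have := measurableT_comp mpsi (measurable_affine_rV x (-1)).
by congr measurable_fun; apply/funext => y /=; rewrite scaleN1r.
Qed.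

Lemma csmooth_measurable r psi : csmooth r psi -> measurable_fun setT psi.
Proof. move=> cpsi; exact: (continuous_measurable_rV (bsmooth_continuous cpsi.1)). Qed.

Definition conv f psi x : R := intg (fun y => f y * psi (x - y)).

Section bounded.
Variables (f : 'rV[R]_n -> R) (B : R).
Hypotheses (mf : measurable_fun setT f) (fB : forall x, `|f x| <= B).

Let B0 : 0 <= B. Proof. exact: le_trans (fB 0). Qed.

Lemma integ_bounded_mul w : integ w -> integ (fun y => f y * w y).
Proof.
move=> wi; apply: (integ_dominated (C := B) _ (integ_norm wi)) => [|y].
  by apply: measurable_funM => //; exact: integ_measurable.
by rewrite normrM ler_wpM2r.
Qed.

Lemma integ_conv r psi x : csmooth r psi -> integ (fun y => f y * psi (x - y)).
Proof. by move=> cpsi; apply: integ_bounded_mul; exact: (csmooth_integ (csmooth_reflect x cpsi)). Qed.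

Lemma conv_bounded r psi : csmooth r psi -> exists C, forall x, `|conv f psi x| <= C.
Proof.
move=> cpsi; have [C HC] := csmooth_gauss cpsi.
exists (B * C * intg (fun y : 'rV[R]_n => expR (- normsq y))) => x.
rewrite -(intg_gauss_reflect x) -intgZ; last exact: integ_gauss_reflect.
apply: norm_intg_le => [||y].
- exact: integ_conv cpsi.
- exact/integZ/integ_gauss_reflect.
- by rewrite normrM -mulrA ler_pM.
Qed.

(** The Taylor remainder of [psi] is bounded by [h ^+ 2] times a Gaussian centred at [x], whose
    integral is independent of [x]; the bound [B] on [f] then makes the remainder of the convolution
    quadratic. *)
Lemma conv_is_derive r psi x v : csmooth r psi ->
  is_derive x v (conv f psi) (\sum_i v ord0 i * conv f (partial i psi) x).
Proof.
move=> cpsi; have [C C0 HC] := csmooth_taylor v cpsi.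
pose I := intg (fun y : 'rV[R]_n => expR (- normsq y)).
apply: (is_derive_quadratic (C := B * C * I)) => h h1.
have -> : \sum_i v ord0 i * conv f (partial i psi) x = intg (fun y => f y * 'D_v psi (x - y)).
  rewrite (_ : (fun y => _) = fun y => \sum_i v ord0 i * (f y * partial i psi (x - y))).
    rewrite intg_sum => [|i]; last exact/integZ/(integ_conv _ (csmooth_partial i cpsi)).
    by apply: eq_bigr => i _; rewrite intgZ//; exact: integ_conv (csmooth_partial i cpsi).
  apply/funext => y; rewrite [X in _ * X](@smooth_row _ _ psi (x - y) v cpsi.1.1) mulr_sumr.
  by apply: eq_bigr => i _; rewrite mulrCA.
have iD : integ (fun y => f y * 'D_v psi (x - y)).
  rewrite (_ : (fun y => _) = fun y => \sum_i v ord0 i * (f y * partial i psi (x - y))).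
    by apply: integ_sum => i; exact/integZ/(integ_conv _ (csmooth_partial i cpsi)).
  apply/funext => y; rewrite [X in _ * X](@smooth_row _ _ psi (x - y) v cpsi.1.1) mulr_sumr.
  by apply: eq_bigr => i _; rewrite mulrCA.
rewrite /conv -[h *: intg _]/(h * intg _) -intgZ// -intgB; [|exact: integ_conv cpsi..].
rewrite -intgB; [|by apply: integB; exact: integ_conv cpsi|exact: integZ].
rewrite mulrC /I -(intg_gauss_reflect x) -(intgZ _ (integ_gauss_reflect x)).
rewrite -(intgZ _ (integZ _ (integ_gauss_reflect x))).
apply: norm_intg_le => [||y].
- by apply: integB; [apply: integB; exact: integ_conv cpsi|exact: integZ].
- exact/integZ/integZ/integ_gauss_reflect.
rewrite (_ : _ - _ = f y * (psi (x - y + h *: v) - psi (x - y) - h * 'D_v psi (x - y))).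
  rewrite normrM (_ : h ^+ 2 * _ = B * (h ^+ 2 * (C * expR (- normsq (x - y))))); last by ring.
  by rewrite ler_pM// HC.
by rewrite [h *: v + x - y]addrAC [h *: v - y]addrC addrAC [-y + _]addrC; ring.
Qed.

Lemma conv_bsmooth r psi : csmooth r psi -> bsmooth (conv f psi).
Proof.
move=> cpsi.
pose I := {psi : 'rV[R]_n -> R | csmooth r psi}.
apply: (@bsmooth_family _ n I (fun a => conv f (sval a))
  (fun a i => exist _ (partial i (sval a)) (csmooth_partial i (svalP a))) _ _ (exist _ psi cpsi)).
  by move=> [a ca]; exact: conv_bounded ca.
by move=> [a ca] x v /=; exact: conv_is_derive ca.
Qed.

Lemma partial_conv r psi i x : csmooth r psi ->
  partial i (conv f psi) x = conv f (partial i psi) x.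
Proof.
move=> cpsi; rewrite /partial; have [_ ->] := conv_is_derive x (delta_mx ord0 i) cpsi.
rewrite (bigD1 i)//= mxE !eqxx mul1r big1 ?addr0// => j ji.
by rewrite mxE eqxx (negbTE ji) mul0r.
Qed.

End bounded.

Lemma partial_reflect r psi i x y : csmooth r psi ->
  partial i (fun y => psi (x - y)) y = - partial i psi (x - y).
Proof.
move=> cpsi; rewrite /partial.
pose e : 'rV[R]_n := delta_mx ord0 i.
have /(is_derive_scale (-1)) : is_derive (x - y) e psi (partial i psi (x - y)).
  by apply: derivableP; apply: bsmooth_derivable; exact: cpsi.1.
rewrite !scaleN1r => /is_deriveP H.
suff [_ ->] : is_derive y e (fun y => psi (x - y)) (- partial i psi (x - y)) by [].
apply/is_deriveP => d /H; apply: filterS => h.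
by rewrite scalerN opprD addrCA.
Qed.

(** The derivative falls on the mollifier and returns to [f] by testing the weak derivative against
    the reflected mollifier [y |-> psi (x - y)]; the reflection supplies the second minus sign. *)
Lemma partial_conv_weak f g B i :
  measurable_fun setT f -> (forall x, `|f x| <= B) ->
  (forall r eta, csmooth r eta ->
    intg (fun x => f x * partial i eta x) = - intg (fun x => g x * eta x)) ->
  forall r psi x, csmooth r psi -> partial i (conv f psi) x = conv g psi x.
Proof.
move=> mf fB fg r psi x cpsi; rewrite (partial_conv mf fB i x cpsi).
apply/eqP; rewrite -eqr_opp -(fg _ _ (csmooth_reflect x cpsi)); apply/eqP.
rewrite /conv -intgN; last exact: (integ_conv mf fB x (csmooth_partial i cpsi)).
by congr intg; apply/funext => y; rewrite (partial_reflect _ _ _ cpsi) mulrN.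
Qed.

(** Integrating the dominating function in [y] first leaves a constant times [expR (- normsq x)], by
    translation invariance, so [F] is integrable on the product space. *)
Lemma intg_Fubini (F : 'rV[R]_n * 'rV[R]_n -> R) (C : R) : measurable_fun setT F ->
  (forall x y, `|F (x, y)| <= C * expR (- normsq x) * expR (- normsq (x - y))) ->
  intg (fun x => intg (fun y => F (x, y))) = intg (fun y => intg (fun x => F (x, y))).
Proof.
move=> mF FC; pose I := intg (fun y : 'rV[R]_n => expR (- normsq y)).
have C0 : 0 <= C.
  have := le_trans (normr_ge0 _) (FC 0 0).
  by rewrite -mulrA pmulr_lge0// mulr_gt0 ?expR_gt0.
have mN : measurable_fun setT (fun p : 'rV[R]_n * 'rV[R]_n => `|F p|).
  exact: (measurableT_comp (@normr_measurable R setT) mF).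
have mFE : measurable_fun setT (EFin \o F) by exact/measurable_EFinP.
have iF : ((lebesgue_rV n) \x (lebesgue_rV n))%E.-integrable setT (EFin \o F).
  apply/integrable12ltyP => //.
  apply: (@le_lt_trans _ _ (\int[lebesgue_rV n]_x (C * I * expR (- normsq x))%:E)%E).
    apply: ge0_le_integral => //=.
    - by move=> x _; exact: integral_ge0.
    - have NF0 (p : 'rV[R]_n * 'rV[R]_n) : (0%:E <= (`|F p|%R)%:E)%E by rewrite lee_fin.
      exact: (measurable_fun_fubini_tonelli_F (m2 := lebesgue_rV n)
        _ (proj2 (measurable_EFinP _ _) mN) NF0).
    - apply/measurable_EFinP; apply: integ_measurable.
      exact/integZ/integ_gauss1.
    move=> x _.
    have ig : integ (fun y => C * expR (- normsq x) * expR (- normsq (x - y))).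
      exact/integZ/integ_gauss_reflect.
    apply: (@le_trans _ _ (intg (fun y => C * expR (- normsq x) * expR (- normsq (x - y))))%:E).
      rewrite /intg /Rintegral fineK; last exact: (integrable_fin_num measurableT ig).
      apply: ge0_le_integral => //=.
      - by apply/measurable_EFinP; exact: (measurableT_comp mN (pair1_measurable x)).
      - by apply/measurable_EFinP; exact: integ_measurable ig.
      - by move=> y _; rewrite lee_fin.
    rewrite lee_fin intgZ; last exact: integ_gauss_reflect.
    by rewrite intg_gauss_reflect mulrAC.
  have /integrableP[_] : integ (fun x : 'rV[R]_n => C * I * expR (- normsq x)).
    exact/integZ/integ_gauss1.
  by under eq_integral do rewrite /= ger0_norm ?mulr_ge0 ?expR_ge0 ?intg_ge0//.
have iy x : integ (fun y => F (x, y)).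
  apply: (integ_dominated _ (integ_gauss_reflect x) (FC x)).
  exact: (measurableT_comp mF (pair1_measurable x)).
have ix y : integ (fun x => F (x, y)).
  apply: (integ_dominated (C := C) _ (@integ_gauss1 R n)) => [|x].
    exact: (measurableT_comp mF (pair2_measurable y)).
  rewrite (le_trans (FC x y))// ler_piMr ?mulr_ge0 ?expR_ge0//.
  by rewrite -[leRHS]expR0 ler_expR oppr_le0 normsq_ge0.
rewrite /intg /Rintegral.
transitivity (fine (\int[lebesgue_rV n]_x \int[lebesgue_rV n]_y (F (x, y))%:E)%E).
  congr fine; apply: eq_integral => x _; rewrite fineK//.
  exact: (integrable_fin_num measurableT (iy x)).
rewrite (Fubini iF)//=.
congr fine; apply: eq_integral => y _; rewrite fineK//.
exact: (integrable_fin_num measurableT (ix y)).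
Qed.

Lemma bump_ge0 x : 0 <= Defs.bump x.
Proof. by rewrite /Defs.bump; case: ifP => // _; exact: expR_ge0. Qed.

Lemma csmooth_bump : csmooth 1 (@Defs.bump R n).
Proof.
apply: csmooth_of_smooth; first exact: smooth_bump.
by move=> x x1; rewrite /Defs.bump ltNge ltW.
Qed.

Lemma intg_bump_gt0 : 0 < intg (@Defs.bump R n).
Proof.
apply: intg_gt0.
- exact: csmooth_integ csmooth_bump.
- exact: (bsmooth_continuous csmooth_bump.1).
- exact: bump_ge0.
- by rewrite /Defs.bump normsq0 ltr01 expR_gt0.
Qed.

Lemma friedrichs_eps_ge0 (e : R) x : 0 < e -> 0 <= friedrichs_eps e x.
Proof.
move=> e0; apply: mulr_ge0; first by rewrite invr_ge0 exprn_ge0// ltW.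
by apply: divr_ge0; [exact: bump_ge0|exact/ltW/intg_bump_gt0].
Qed.

Lemma csmooth_friedrichs_eps (e : R) : 0 < e -> csmooth (e ^+ 2) (@friedrichs_eps R n e).
Proof.
move=> e0; apply: csmooth_of_smooth; first exact: smooth_friedrichs_eps.
move=> x ex; rewrite /friedrichs_eps /friedrichs /Defs.bump normsqZ exprVn.
by rewrite ltNge -ler_pdivrMl ?invr_gt0 ?exprn_gt0// invrK mulr1 ltW// mul0r mulr0.
Qed.

Lemma friedrichs_epsN (e : R) x : friedrichs_eps e (- x) = friedrichs_eps e x.
Proof. by rewrite /friedrichs_eps /friedrichs /Defs.bump scalerN normsqN. Qed.

Lemma intg_friedrichs_eps (e : R) : 0 < e -> intg (@friedrichs_eps R n e) = 1.
Proof.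
move=> e0; have ie := csmooth_integ (csmooth_friedrichs_eps e0).
rewrite (intg_affine 0 e0 ie).
rewrite (_ : (fun x => _) = fun x : 'rV[R]_n => (e ^- n / intg (@Defs.bump R n)) * Defs.bump x).
  rewrite intgZ; last exact: csmooth_integ csmooth_bump.
  by field; rewrite !gt_eqF ?intg_bump_gt0// exprn_gt0.
apply/funext => x; rewrite /friedrichs_eps /friedrichs add0r scalerA mulVf ?gt_eqF// scale1r.
by rewrite -/(intg _) mulrA mulrAC.
Qed.

Lemma intg_friedrichs_shift (e : R) y : 0 < e ->
  intg (fun x => friedrichs_eps e (x - y)) = 1.
Proof.
move=> e0; have ie := csmooth_integ (csmooth_friedrichs_eps e0).
rewrite -[RHS](intg_friedrichs_eps e0) (intg_affine (- y) ltr01 ie) expr1n mul1r.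
by congr intg; apply/funext => x; rewrite scale1r addrC.
Qed.

Lemma integ_friedrichs_shift (e : R) y : 0 < e -> integ (fun x => friedrichs_eps e (x - y)).
Proof.
move=> e0; have := csmooth_integ (csmooth_friedrichs_eps e0).
move=> /(integ_affine (- y) ltr01); congr integ; apply/funext => x.
by rewrite scale1r addrC.
Qed.

(** The mollifier is nonnegative of total mass 1, so averaging does not increase bounds. Applied to
    a weak gradient, this bounds the gradients of all mollifications at once. *)
Lemma conv_friedrichs_le f B (e : R) x : measurable_fun setT f -> (forall x, `|f x| <= B) ->
  0 < e -> `|conv f (friedrichs_eps e) x| <= B.
Proof.
move=> mf fB e0; have B0 : 0 <= B := le_trans (normr_ge0 _) (fB 0).
have E : (fun y => friedrichs_eps e (x - y)) = fun y => friedrichs_eps e (y - x).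
  by apply/funext => y; rewrite -friedrichs_epsN opprB.
rewrite -[leRHS]mulr1 -(intg_friedrichs_shift x e0) -intgZ; last exact: integ_friedrichs_shift.
apply: norm_intg_le => [||y].
- exact: (integ_conv mf fB x (csmooth_friedrichs_eps e0)).
- exact/integZ/integ_friedrichs_shift.
- rewrite normrM ler_pM// -friedrichs_epsN opprB ger0_norm//.
  exact: friedrichs_eps_ge0.
Qed.

Lemma csmooth_lipschitz r eta : csmooth r eta ->
  exists2 L, 0 <= L & forall x y, `|eta y - eta x| <= L * `|y - x|.
Proof.
move=> ceta.
have [C HC] := choice (fun i => bsmooth_bounded (bsmooth_partial i ceta.1)).
exists (n%:R * \sum_i `|C i|); first by rewrite mulr_ge0// sumr_ge0.
apply: lipschitz_partial => [i x|i x]; first exact: bsmooth_derivable ceta.1.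
by rewrite (le_trans (HC i x))// (bigD1 i)//= (le_trans (ler_norm _))// lerDl sumr_ge0.
Qed.

(** Fubini moves the kernel from [f] to the test function. *)
Lemma intg_conv f B r psi r' eta : measurable_fun setT f -> (forall x, `|f x| <= B) ->
  csmooth r psi -> csmooth r' eta ->
  intg (fun x => conv f psi x * eta x) =
  intg (fun y => f y * intg (fun x => psi (x - y) * eta x)).
Proof.
move=> mf fB cpsi ceta; have B0 : 0 <= B := le_trans (normr_ge0 _) (fB 0).
have [D HD] := csmooth_gauss ceta; have [E HE] := csmooth_gauss cpsi.
have E0 : 0 <= E by have := le_trans (normr_ge0 _) (HE 0); rewrite pmulr_lge0// expR_gt0.
have D0 : 0 <= D by have := le_trans (normr_ge0 _) (HD 0); rewrite pmulr_lge0// expR_gt0.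
pose F (p : 'rV[R]_n * 'rV[R]_n) := f p.2 * psi (p.1 - p.2) * eta p.1.
have mF : measurable_fun setT F.
  apply: measurable_funM; last exact: (measurableT_comp (csmooth_measurable ceta)).
  apply: measurable_funM; first exact: (measurableT_comp mf).
  apply: (measurableT_comp (csmooth_measurable cpsi)).
  apply: measurable_fun_rVP => i; under eq_fun do rewrite !mxE.
  apply: measurable_funB.
    exact: (measurableT_comp (measurable_coord i) measurable_fst).
  exact: (measurableT_comp (measurable_coord i) measurable_snd).
have FC x y : `|F (x, y)| <= B * E * D * expR (- normsq x) * expR (- normsq (x - y)).
  rewrite /F/= !normrM.
  rewrite (_ : B * E * D * _ * _ = B * (E * expR (- normsq (x - y))) * (D * expR (- normsq x))); last by ring.
  by rewrite ler_pM// ?ler_pM// mulr_ge0.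
transitivity (intg (fun x => intg (fun y => F (x, y)))).
  congr intg; apply/funext => x; rewrite /conv mulrC -intgZ; last exact: (integ_conv mf fB x cpsi).
  by congr intg; apply/funext => y; rewrite /F/= mulrC.
rewrite (intg_Fubini mF FC); congr intg; apply/funext => y.
rewrite -intgZ; first by congr intg; apply/funext => x; rewrite /F/= mulrA.
have ip : integ (fun x => psi (x - y)).
  have := csmooth_integ cpsi.
  by move=> /(integ_affine (- y) ltr01); congr integ; apply/funext => x; rewrite scale1r addrC.
have [C HC] := bsmooth_bounded ceta.1.
have := integ_bounded_mul (csmooth_measurable ceta) HC ip.
by congr integ; apply/funext => x; rewrite mulrC.
Qed.

(** Once the mollifier sits on [eta], only the regularity of [eta] counts: it varies by at most
    [L * e] over the support of the kernel, while [f] is merely bounded. *)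
Lemma conv_friedrichs_weak f B r eta : measurable_fun setT f -> (forall x, `|f x| <= B) ->
  csmooth r eta -> exists C, forall e : R, 0 < e <= 1 ->
    `|intg (fun x => conv f (friedrichs_eps e) x * eta x) - intg (fun x => f x * eta x)| <= C * e.
Proof.
move=> mf fB ceta; have B0 : 0 <= B := le_trans (normr_ge0 _) (fB 0).
have [L L0 HL] := csmooth_lipschitz ceta.
(* For [e <= 1] and [normsq y] beyond [r'], neither [y] nor a point within [e] of it meets the
   support of [eta]. The factor [expR r'] lets a Gaussian replace the indicator function of the
   ball. *)
pose r' := 2 * `|r| + 2.
pose I := intg (fun y : 'rV[R]_n => expR (- normsq y)).
exists (B * (L * expR r') * I) => e /andP[e0 e1].
have cpsi := csmooth_friedrichs_eps e0.
have psi0 x : 0 <= friedrichs_eps e x by exact: friedrichs_eps_ge0.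
have ipsi (y : 'rV[R]_n) := integ_friedrichs_shift y e0.
have ipsi1 (y : 'rV[R]_n) := intg_friedrichs_shift y e0.
rewrite (intg_conv mf fB cpsi ceta).
move: (friedrichs_eps e) cpsi psi0 ipsi ipsi1 => psi cpsi psi0 ipsi ipsi1.
have [D HD] := bsmooth_bounded ceta.1.
have ipe y : integ (fun x => psi (x - y) * eta x).
  have := integ_bounded_mul (csmooth_measurable ceta) HD (ipsi y).
  by congr integ; apply/funext => x; rewrite mulrC.
have dE y : intg (fun x => psi (x - y) * eta x) - eta y =
    intg (fun x => psi (x - y) * (eta x - eta y)).
  rewrite -[eta y in LHS]mulr1 -(ipsi1 y) -intgZ// -intgB//; last exact: integZ.
  by congr intg; apply/funext => x; ring.
have ipd y : integ (fun x => psi (x - y) * (eta x - eta y)).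
  rewrite (_ : (fun x => _) = fun x => psi (x - y) * eta x - eta y * psi (x - y)).
    by apply: integB => //; exact: integZ.
  by apply/funext => x; ring.
have key y : `|intg (fun x => psi (x - y) * eta x) - eta y| <= L * expR r' * e * expR (- normsq y).
  rewrite dE -[leRHS]mulr1 -(ipsi1 y) -intgZ//.
  apply: norm_intg_le => // [|x]; first exact: integZ.
  rewrite normrM ger0_norm// mulrC.
  have [ex|xe] := ltP (e ^+ 2) (normsq (x - y)).
    by rewrite (cpsi.2 _ ex) !mulr0.
  rewrite ler_wpM2r//.
  have xye : `|x - y| <= e.
    have := le_trans (normsq_ge (x - y)) xe.
    by rewrite ler_pXn2r ?nnegrE// ltW.
  have [yr|yr] := leP (normsq y) r'.
    apply: (le_trans (HL y x)).
    rewrite (_ : L * _ * _ * _ = L * e * (expR r' * expR (- normsq y))); last by ring.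
    rewrite -[leLHS]mulr1 ler_pM//; first by rewrite mulr_ge0.
      by rewrite ler_wpM2l.
    by rewrite -expRD -[leLHS]expR0 ler_expR; lra.
  have xr : r < normsq x.
    have H := normsqD_le x (y - x); rewrite [x + _]addrC subrK in H.
    have E : normsq (y - x) = normsq (x - y) by rewrite -normsqN opprB.
    rewrite E in H.
    have e21 : e ^+ 2 <= 1 by rewrite expr_le1// ltW.
    have := ler_norm r; rewrite /r' in yr; lra.
  have yr' : r < normsq y by have := ler_norm r; have := normr_ge0 r; rewrite /r' in yr; lra.
  by rewrite !ceta.2// subrr normr0 !mulr_ge0 ?expR_ge0// ltW.
(* Measurability in [y] is read off from continuity: the integral is the convolution of [eta] with
   the reflected kernel. *)
have mg : measurable_fun setT (fun y : 'rV[R]_n => intg (fun x => psi (x - y) * eta x)).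
  have ceq : (fun y : 'rV[R]_n => intg (fun x => psi (x - y) * eta x)) = conv eta (fun x => psi (- x)).
    apply/funext => y; rewrite /conv; congr intg; apply/funext => x.
    by rewrite mulrC opprB.
  rewrite ceq.
  have cr : csmooth (2 * e ^+ 2 + 2 * normsq (0 : 'rV[R]_n)) (fun x => psi (- x)).
    by have := csmooth_reflect 0 cpsi; congr csmooth; apply/funext => x; rewrite sub0r.
  exact: (continuous_measurable_rV (bsmooth_continuous (conv_bsmooth (csmooth_measurable ceta) HD cr))).
have ig : integ (fun y : 'rV[R]_n => L * expR r' * e * expR (- normsq y)) by exact/integZ/integ_gauss1.
have id : integ (fun y => intg (fun x => psi (x - y) * eta x) - eta y).
  apply: (integ_dominated (C := 1) _ ig) => [|y]; last by rewrite mul1r.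
  by apply: measurable_funB => //; exact: csmooth_measurable ceta.
have ie := csmooth_integ ceta.
have ige : integ (fun y => intg (fun x => psi (x - y) * eta x)).
  by have := integD id ie; congr integ; apply/funext => y; rewrite subrK.
rewrite -intgB; [|exact: (integ_bounded_mul mf fB)..].
rewrite (_ : (fun y => _) = fun y => f y * (intg (fun x => psi (x - y) * eta x) - eta y)); last first.
  by apply/funext => y; rewrite mulrBr.
rewrite (_ : _ * e = B * (L * expR r' * e) * I); last by ring.
rewrite -intgZ; last exact: integ_gauss1.
apply: norm_intg_le => [||y].
- exact: (integ_bounded_mul mf fB).
- exact/integZ/integ_gauss1.
- by rewrite normrM -[leRHS]mulrA ler_pM.
Qed.

End mollification.

Section partial_sums.
Context {R : realType} {n : nat}.

Lemma lipschitz_derive (V W : normedModType R) (f : V -> W) (L : R) :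
  (forall x v, derivable f x v) -> (forall x v, `|'D_v f x| <= L * `|v|) ->
  forall x y, `|f y - f x| <= L * `|y - x|.
Proof.
move=> df HL x y; have := @vector_MVT R W (fun s => f (x + s *: (y - x)))
  (fun s => 'D_(y - x) f (x + s *: (y - x))) (fun s => L * `|y - x| * s) (fun _ => L * `|y - x|) 0 1 ler01.
rewrite scale1r scale0r addr0 [x + _]addrC subrK mulr1 mulr0 subr0; apply => s _.
- by apply: is_derive_line.
- exact: is_derive_mull.
- exact: HL.
Qed.

Lemma partialZ (c : R) (f : 'rV[R]_n -> R) i : smooth (fun _ : R => f) ->
  partial i (fun x => c * f x) = fun x => c * partial i f x.
Proof.
move=> Cf; rewrite partialM//; last by move=> k; exact: Ck_cst.
apply/funext => x; rewrite [X in X * _](_ : _ = 0) ?mul0r ?add0r//.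
exact: derive_cst.
Qed.

Lemma smooth_sum (I : Type) (s : seq I) (F : I -> 'rV[R]_n -> R) :
  (forall i, smooth (fun _ : R => F i)) -> smooth (fun _ : R => fun x => \sum_(i <- s) F i x).
Proof. by move=> CF k; apply: Ck_sum => i; exact: CF. Qed.

Lemma partial_sum (I : Type) (s : seq I) (F : I -> 'rV[R]_n -> R) j :
  (forall i, smooth (fun _ : R => F i)) ->
  partial j (fun x => \sum_(i <- s) F i x) = fun x => \sum_(i <- s) partial j (F i) x.
Proof.
move=> CF; elim: s => [|i s IH].
  by apply/funext => x; rewrite big_nil; under eq_fun do rewrite big_nil; exact: derive_cst.
apply/funext => x; rewrite big_cons; under eq_fun do rewrite big_cons.
rewrite partialD//; last exact: smooth_sum.
by rewrite IH.
Qed.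

End partial_sums.

(** * Gaussian averages in the variables [(x, sqrt t)] *)

Section heat_kernel.
Context {R : realType} {n : nat}.
Variables (r : R) (r_gt0 : 0 < r).
Implicit Types (G H : 'rV[R]_n -> R).

Definition gauss (z : 'rV[R]_n) : R := expR (- (r * normsq z)).

Local Notation gam := gauss.

Lemma gauss_ge0 z : 0 <= gam z. Proof. exact: expR_ge0. Qed.

(* In the variables (x, sqrt t) the solution of the heat equation stays smooth up to t = 0. *)
Definition heat G (q : 'rV[R]_n * R) : R := intg (fun z => G (q.1 + q.2 *: z) * gam z).

Let ig : integ gam := integ_gauss n r_gt0.

Lemma intg_gauss_gt0 : 0 < intg gam.
Proof.
apply: intg_gt0 => //; first exact: continuous_gauss.
- exact: gauss_ge0.
- exact: expR_gt0.
Qed.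

Lemma measurable_affine_bsmooth G q : bsmooth G ->
  measurable_fun setT (fun z : 'rV[R]_n => G (q.1 + q.2 *: z)).
Proof.
move=> bG; exact: (measurableT_comp (continuous_measurable_rV (bsmooth_continuous bG))
  (measurable_affine_rV q.1 q.2)).
Qed.

Lemma integ_heat_weight G w q : bsmooth G -> integ w -> integ (fun z => G (q.1 + q.2 *: z) * w z).
Proof.
move=> bG iw; have [C HC] := bsmooth_bounded bG.
by apply: (integ_bounded_mul (B := C)) => //; exact: measurable_affine_bsmooth.
Qed.

Lemma integ_heat G q : bsmooth G -> integ (fun z => G (q.1 + q.2 *: z) * gam z).
Proof. by move=> bG; exact: integ_heat_weight ig. Qed.

Lemma heat_ge G m q : bsmooth G -> (forall y, m <= G y) -> m * intg gam <= heat G q.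
Proof.
move=> bG mG; rewrite -intgZ//; apply: le_intg; [exact: integZ|exact: integ_heat|].
by move=> z; rewrite ler_wpM2r ?gauss_ge0.
Qed.

Lemma heat_le G H q : bsmooth G -> bsmooth H -> (forall y, `|G y| <= H y) ->
  `|heat G q| <= heat H q.
Proof.
move=> bG bH GH; apply: norm_intg_le; [exact: integ_heat|exact: integ_heat|move=> z].
by rewrite normrM (ger0_norm (gauss_ge0 _)) ler_wpM2r ?gauss_ge0.
Qed.

Lemma heatZ (c : R) G q : bsmooth G -> heat (fun y => c * G y) q = c * heat G q.
Proof.
move=> bG; rewrite /heat -intgZ; last exact: integ_heat.
by congr intg; apply/funext => z; rewrite mulrA.
Qed.

Lemma heat0 G x : heat G (x, 0) = G x * intg gam.
Proof. by rewrite /heat -intgZ//; congr intg; apply/funext => z; rewrite /= scale0r addr0. Qed.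

Lemma integ_gauss_poly_dominated C (f : 'rV[R]_n -> R) : measurable_fun setT f ->
  (forall z, `|f z| <= C * ((1 + normsq z) * gam z)) -> integ f.
Proof. by move=> mf; apply: integ_dominated => //; exact: integ_gauss_poly. Qed.

Lemma coord_le_poly (z : 'rV[R]_n) j : `|z ord0 j| <= 1 + normsq z.
Proof.
have := le_trans (rV_norm_ge z j) (lexx `|z|); have := normsq_ge z; have := normr_ge0 z.
set a := `|z|; set b := `|_|; nra.
Qed.

Lemma integ_heat_coord G q j : bsmooth G ->
  integ (fun z => z ord0 j * (G (q.1 + q.2 *: z) * gam z)).
Proof.
move=> bG; have [C HC] := bsmooth_bounded bG.
apply: (@integ_gauss_poly_dominated C) => [|z].
  apply: measurable_funM; first exact: measurable_coord.
  exact: (integ_measurable (integ_heat q bG)).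
rewrite !normrM (ger0_norm (gauss_ge0 _)).
rewrite (_ : C * _ = (1 + normsq z) * (C * gam z)); last by ring.
by rewrite ler_pM ?mulr_ge0 ?gauss_ge0 ?coord_le_poly// ler_wpM2r ?gauss_ge0.
Qed.

(** The direction [u] will be [v + p *: z] with [z] the integration variable, so the dependence on
    [u] has to be explicit; quadratic growth is integrable against the Gaussian. *)
Lemma second_derive_bound G : bsmooth G -> exists2 C, 0 <= C &
  forall u y, `|'D_u ('D_u G) y| <= C * `|u| ^+ 2.
Proof.
move=> bG.
have [C HC] := choice (fun i => bsmooth_bounded (bsmooth_partial i.1 (bsmooth_partial i.2 bG)) : exists C, _).
exists (\sum_i \sum_j `|C (i, j)|); first by apply: sumr_ge0 => i _; exact: sumr_ge0.
move=> u y.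
have CG : smooth (fun _ : R => G) := bG.1.
have CD : smooth (fun _ : R => 'D_u G) by exact: (@smooth_derive _ _ _ _ (fun _ => G) u CG).
rewrite (@smooth_row _ _ ('D_u G) y u CD).
have -> : 'D_u G = fun z => \sum_j u ord0 j * partial j G z.
  by apply/funext => z; exact: smooth_row.
rewrite (le_trans (ler_norm_sum _ _ _))// mulr_suml; apply: ler_sum => i _.
have -> : partial i (fun z => \sum_j u ord0 j * partial j G z) y =
    \sum_j u ord0 j * partial i (partial j G) y.
  rewrite (@partial_sum _ _ _ _ (fun j z => u ord0 j * partial j G z) i) => [|j].
    by apply: eq_bigr => j _; rewrite partialZ//; exact: smooth_partial.
  by move=> k; apply: CkM; [exact: Ck_cst|exact: (@smooth_partial _ _ G j CG)].
rewrite mulr_sumr (le_trans (ler_norm_sum _ _ _))// mulr_suml; apply: ler_sum => j _.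
rewrite (_ : u ord0 i * _ = partial i (partial j G) y * (u ord0 i * u ord0 j)); last by ring.
rewrite normrM expr2 ler_pM//; last by rewrite normrM ler_pM ?rV_norm_ge.
by rewrite (le_trans (HC (i, j) y))// ler_norm.
Qed.

(** Along [(v, p)] the argument of [G] moves in the direction [v + p *: z]. The Taylor remainder is
    at most [C * D * (1 + normsq z) * h ^+ 2] times the Gaussian, an integrable bound. *)
Lemma is_derive_heat G (x v : 'rV[R]_n) (s p : R) : bsmooth G ->
  is_derive (x, s) (v, p) (heat G)
    (\sum_j (v ord0 j * heat (partial j G) (x, s) +
      p * intg (fun z => z ord0 j * (partial j G (x + s *: z) * gam z)))).
Proof.
move=> bG; have [C C0 HC] := second_derive_bound bG.
set l := \sum_j _.
pose D := 2 * `|v| ^+ 2 + 2 * p ^+ 2.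
have D0 : 0 <= D by rewrite addr_ge0// mulr_ge0// sqr_ge0.
pose P (z : 'rV[R]_n) := (1 + normsq z) * gam z.
have iP : integ P := integ_gauss_poly n r_gt0.
have bp j := bsmooth_partial j bG.
pose d z := 'D_(v + p *: z) G (x + s *: z) * gam z.
have dE : d = fun z => \sum_j (v ord0 j * (partial j G (x + s *: z) * gam z) +
    p * (z ord0 j * (partial j G (x + s *: z) * gam z))).
  apply/funext => z; rewrite /d (@smooth_row _ _ G _ _ bG.1) mulr_suml.
  by apply: eq_bigr => j _; rewrite !mxE; ring.
have ij j : integ (fun z => v ord0 j * (partial j G (x + s *: z) * gam z) +
    p * (z ord0 j * (partial j G (x + s *: z) * gam z))).
  apply: integD; apply: integZ; first exact: (integ_heat (x, s) (bp j)).
  exact: (integ_heat_coord (x, s) j (bp j)).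
have idd : integ d by rewrite dE; exact: integ_sum.
have lE : l = intg d.
  rewrite dE intg_sum//; apply: eq_bigr => j _.
  rewrite intgD; [|apply: integZ; exact: (integ_heat (x, s) (bp j))
    |apply: integZ; exact: (integ_heat_coord (x, s) j (bp j))].
  by rewrite (intgZ _ (integ_heat (x, s) (bp j))) (intgZ _ (integ_heat_coord (x, s) j (bp j))).
apply: (is_derive_quadratic (C := C * D * intg P)) => h h1.
rewrite lE /heat /= -[h *: intg d]/(h * intg d) -[h *: p]/(h * p).
have i1 := integ_heat (h *: v + x, h * p + s) bG; have i2 := integ_heat (x, s) bG.
rewrite -(intgZ h idd) -(intgB i1 i2) -(intgB (integB i1 i2) (integZ h idd)).
rewrite [leRHS]mulrC -(intgZ (C * D) iP) -(intgZ (h ^+ 2) (integZ (C * D) iP)).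
apply: norm_intg_le => [||z].
- exact: (integB (integB i1 i2) (integZ h idd)).
- exact: (integZ (h ^+ 2) (integZ (C * D) iP)).
rewrite [X in `|X|](_ : _ = (G (h *: v + x + (h * p + s) *: z) - G (x + s *: z) -
  h * 'D_(v + p *: z) G (x + s *: z)) * gam z); last by rewrite /d/=; ring.
rewrite normrM (ger0_norm (gauss_ge0 _)) /P.
rewrite (_ : h ^+ 2 * _ = C * (D * (1 + normsq z)) * h ^+ 2 * gam z); last by ring.
rewrite ler_wpM2r ?gauss_ge0//.
rewrite (_ : h *: v + x + (h * p + s) *: z = x + s *: z + h *: (v + p *: z)); last first.
  by rewrite scalerDl scalerDr scalerA addrACA [RHS]addrC.
apply: (@le_trans _ _ (C * `|v + p *: z| ^+ 2 * h ^+ 2)).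
  apply: taylor2 => [y|y|t _].
  - exact: bsmooth_derivable.
  - by apply: smooth_derivable0; exact: (@smooth_derive _ _ _ _ (fun _ => G) _ bG.1).
  - exact: HC.
rewrite ler_wpM2r ?sqr_ge0// ler_wpM2l//.
apply: (@le_trans _ _ (2 * `|v| ^+ 2 + 2 * (p ^+ 2 * normsq z))).
  have H1 : `|v + p *: z| <= `|v| + `|p| * `|z| by rewrite -normrZ; exact: ler_normD.
  have H2 := normsq_ge z; rewrite -[p ^+ 2]real_normK ?num_real//.
  have := normr_ge0 (v + p *: z); move: H1 H2; set a := `|v|; set b := `|p|; set c := `|z|.
  set e := `|_| => H1 H2 e0.
  apply: (@le_trans _ _ ((a + b * c) ^+ 2)).
    by rewrite lerXn2r ?nnegrE ?(le_trans e0).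
  have : 0 <= (a - b * c) ^+ 2 by exact: sqr_ge0.
  have : b ^+ 2 * c ^+ 2 <= b ^+ 2 * normsq z by rewrite ler_wpM2l// sqr_ge0.
  rewrite sqrrB sqrrD exprMn; lra.
have N0 := normsq_ge0 z; have v0 := mulr_ge0 (sqr_ge0 `|v|) N0; have p0 := sqr_ge0 p.
by rewrite /D; lra.
Qed.

Lemma is_derive_gauss z j : is_derive z (delta_mx ord0 j) gam (- (2 * r * z ord0 j * gam z)).
Proof.
have dn : is_derive z (delta_mx ord0 j) (@normsq R n) (2 * z ord0 j).
  apply: (is_derive_quadratic (C := 1)) => h _.
  rewrite [X in `|X|](_ : _ = h ^+ 2); first by rewrite ger0_norm ?sqr_ge0// mul1r.
  rewrite -[h *: (2 * _)]/(h * (2 * _)) /normsq (bigD1 j)//= [in X in _ - X - _](bigD1 j)//=.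
  rewrite !mxE !eqxx (eq_bigr (fun i => z ord0 i ^+ 2)) => [|i ij]; last first.
    by rewrite !mxE eqxx (negbTE ij) mulr0 add0r.
  by rewrite /= mulr1; ring.
have := is_derive_expR_comp (is_deriveN (is_deriveZ r dn)).
move=> H; apply: (is_derive_eq H).
by rewrite /gauss -![_ *: _]/(_ * _) mulNr mulrA [r * 2]mulrC.
Qed.

(** A shift [e] of length at most 1 costs half of the Gaussian rate, because [normsq z <= 2 * normsq
    (z + e) + 2 * normsq e]; the 3 comes from [1 + normsq (z + e) <= 3 * (1 + normsq z)]. A bound
    along a whole Taylor segment thus stays integrable. *)
Lemma gauss_shift z j s : `|s| <= 1 ->
  (1 + normsq (z + s *: delta_mx ord0 j)) * gam (z + s *: delta_mx ord0 j) <=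
  3 * expR r * ((1 + normsq z) * expR (- (r / 2 * normsq z))).
Proof.
move=> s1; set e : 'rV[R]_n := s *: delta_mx ord0 j.
have ne : normsq e <= 1.
  rewrite /normsq (bigD1 j)//= big1 => [|k kj]; last by rewrite !mxE eqxx (negbTE kj) mulr0 expr0n.
  by rewrite !mxE !eqxx mulr1 addr0 -real_normK ?num_real// expr_le1.
have ne0 := normsq_ge0 e.
have H1 := normsqD_le z e.
have := normsqD_le (z + e) (- e); rewrite addrK normsqN => H2.
rewrite (_ : 3 * expR r * _ = 3 * (1 + normsq z) * (expR r * expR (- (r / 2 * normsq z)))); last by ring.
rewrite -expRD ler_pM ?gauss_ge0 ?addr_ge0 ?normsq_ge0//.
  by have := normsq_ge0 z; lra.
rewrite ler_expR; have : r * normsq z <= r * (2 * normsq (z + e) + 2 * normsq e) by rewrite ler_pM2l.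
have : r * normsq e <= r by rewrite ler_piMr// ltW.
lra.
Qed.

Lemma is_derive_affine_arg (A : 'rV[R]_n -> R) (x z v : 'rV[R]_n) (s : R) :
  derivable A (x + s *: z) v ->
  is_derive z v (fun z => A (x + s *: z)) (s * 'D_v A (x + s *: z)).
Proof.
move=> /derivableP /(is_derive_scale s) /is_deriveP H; apply/is_deriveP => e /H.
by apply: filterS => h; rewrite scalerDr !scalerA [h * s]mulrC addrCA.
Qed.

(** The left side is the second derivative along the [j]-th axis of [H (x + t *: z) * gauss z],
    divided by [gauss z]: [w] is the [j]-th coordinate of [z], the [a]'s are [H] and its derivatives
    along that axis, and [N] will be [1 + normsq z]. *)
Lemma quadratic_weight_bound (t a2 a1 a0 w N C2 C1 C0 : R) :
  `|a2| <= C2 -> `|a1| <= C1 -> `|a0| <= C0 -> 1 <= N -> `|w| <= N -> w ^+ 2 <= N ->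
  `|t ^+ 2 * a2 - 4 * r * t * (w * a1) + (4 * r ^+ 2 * w ^+ 2 - 2 * r) * a0| <=
  (t ^+ 2 * C2 + 4 * r * `|t| * C1 + (4 * r ^+ 2 + 2 * r) * C0) * N.
Proof.
move=> a2C a1C a0C N1 wN wwN; have N0 : 0 <= N := le_trans ler01 N1; have r0 := ltW r_gt0.
have h2 : `|t ^+ 2 * a2| <= t ^+ 2 * (C2 * N).
  rewrite normrM ger0_norm ?sqr_ge0// ler_wpM2l ?sqr_ge0//.
  by rewrite -[leLHS]mulr1 ler_pM.
have h1 : `|4 * r * t * (w * a1)| <= 4 * (r * `|t| * (N * C1)).
  rewrite !normrM (ger0_norm (ler0n _ 4)) (ger0_norm r0) -!mulrA ler_wpM2l// ler_wpM2l//.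
  by rewrite ler_wpM2l// ler_pM.
have h0 : `|(4 * r ^+ 2 * w ^+ 2 - 2 * r) * a0| <= (4 * r ^+ 2 + 2 * r) * N * C0.
  rewrite normrM ler_pM//.
  have r20 := sqr_ge0 r; have w20 := sqr_ge0 w.
  have A1 : r ^+ 2 * w ^+ 2 <= r ^+ 2 * N by rewrite ler_wpM2l.
  have A2 : r * 1 <= r * N by rewrite ler_wpM2l.
  have A3 := mulr_ge0 r20 w20; have A4 := mulr_ge0 r20 N0; have A5 := mulr_ge0 r0 N0.
  rewrite ler_norml; apply/andP; split; lra.
have := ler_normD (t ^+ 2 * a2 - 4 * r * t * (w * a1)) ((4 * r ^+ 2 * w ^+ 2 - 2 * r) * a0).
have := ler_normB (t ^+ 2 * a2) (4 * r * t * (w * a1)).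
lra.
Qed.

(* [z_j gauss(z)] is [- (2 r)^-1] times the [j]-th partial derivative of [gauss]. *)
Lemma intg_coord_gauss H x s j : bsmooth H ->
  intg (fun z => z ord0 j * (H (x + s *: z) * gam z)) =
  s / (2 * r) * heat (partial j H) (x, s).
Proof.
move=> bH; pose e : 'rV[R]_n := delta_mx ord0 j.
pose a0 z := H (x + s *: z); pose a1 z := partial j H (x + s *: z).
pose a2 z := partial j (partial j H) (x + s *: z).
have b1 := bsmooth_partial j bH; have b2 := bsmooth_partial j b1.
have d0 z : is_derive z e a0 (s * a1 z).
  by apply: is_derive_affine_arg; exact: bsmooth_derivable.
have d1 z : is_derive z e a1 (s * a2 z).
  by apply: is_derive_affine_arg; exact: bsmooth_derivable.
have dg z := is_derive_gauss z j : is_derive z e gam _.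
have dz z : is_derive z e (fun z => z ord0 j) 1.
  have -> : 1 = e ord0 j by rewrite mxE !eqxx.
  by apply: is_derive_bounded_linear => c u w; rewrite !mxE.
(* [q] and [q2] are the first two derivatives of [p] along the axis. By translation invariance [q]
   integrates to 0, and this identity solved for the first moment is the claim; [q2] controls the
   Taylor remainder. *)
pose p z := a0 z * gam z.
pose q z := s * (a1 z * gam z) - 2 * r * (z ord0 j * p z).
pose q2 z := s * (s * a2 z * gam z - 2 * r * (z ord0 j * (a1 z * gam z))) -
  2 * r * (p z + z ord0 j * q z).
have dp z : is_derive z e p (q z).
  by apply: (is_derive_eq (is_deriveM (d0 z) (dg z))); rewrite /q /p -![_ *: _]/(_ * _); ring.
have dq z : is_derive z e q (q2 z).
  have D1 := is_deriveM (d1 z) (dg z).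
  have D2 := is_deriveM (dz z) (dp z).
  apply: (is_derive_eq (is_deriveB (is_deriveZ s D1) (is_deriveZ (2 * r) D2))).
  by rewrite /q2 /q /p -![_ *: _]/(_ * _); ring.
have ip : integ p := integ_heat (x, s) bH.
have izp : integ (fun z => z ord0 j * p z) := integ_heat_coord (x, s) j bH.
have i1 : integ (fun z => a1 z * gam z) := integ_heat (x, s) b1.
have iq : integ q by apply: integB; exact: integZ.
suff H0 : intg q = 0.
  move: H0; rewrite /q intgB; [|exact: integZ..].
  rewrite !intgZ// => /eqP; rewrite subr_eq0 => /eqP E.
  have -> : heat (partial j H) (x, s) = intg (fun z => a1 z * gam z) by [].
  rewrite -[LHS]/(intg (fun z => z ord0 j * p z)) mulrAC E mulrAC divff ?mul1r//.
  by rewrite mulf_neq0// gt_eqF.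
have [C0 HC0] := bsmooth_bounded bH; have [C1 HC1] := bsmooth_bounded b1.
have [C2 HC2] := bsmooth_bounded b2.
pose C := s ^+ 2 * C2 + 4 * r * `|s| * C1 + (4 * r ^+ 2 + 2 * r) * C0.
have q2C z : `|q2 z| <= C * ((1 + normsq z) * gam z).
  have -> : q2 z = (s ^+ 2 * a2 z - 4 * r * s * (z ord0 j * a1 z) +
      (4 * r ^+ 2 * z ord0 j ^+ 2 - 2 * r) * a0 z) * gam z.
    by rewrite /q2 /q /p; ring.
  rewrite normrM (ger0_norm (gauss_ge0 _)) [leRHS]mulrA ler_wpM2r ?gauss_ge0//.
  have N1 : 1 <= 1 + normsq z by rewrite lerDl normsq_ge0.
  have zN := coord_le_poly z j.
  have zN2 : z ord0 j ^+ 2 <= 1 + normsq z.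
    rewrite -real_normK ?num_real//; apply: (@le_trans _ _ (normsq z)); last by rewrite lerDr.
    by apply: le_trans (normsq_ge z); rewrite lerXn2r ?nnegrE// rV_norm_ge.
  exact: (quadratic_weight_bound s (HC2 (x + s *: z)) (HC1 (x + s *: z)) (HC0 (x + s *: z)) N1 zN zN2).
have C_ge0 : 0 <= C.
  have C00 := le_trans (normr_ge0 _) (HC0 0); have C10 := le_trans (normr_ge0 _) (HC1 0).
  have C20 := le_trans (normr_ge0 _) (HC2 0).
  have r0 := ltW r_gt0; have s20 := sqr_ge0 s; have r20 := sqr_ge0 r.
  apply: addr_ge0; [apply: addr_ge0|]; apply: mulr_ge0 => //.
    by rewrite !mulr_ge0.
  by rewrite addr_ge0 ?mulr_ge0.
apply: (intg_derive0 (p := p) (v := e)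
  (w := fun z => C * (3 * expR r * ((1 + normsq z) * expR (- (r / 2 * normsq z)))))) => //.
  by apply/integZ/integZ/integ_gauss_poly; rewrite divr_gt0.
move=> h z /andP[h0 h1].
have -> : q z = 'D_e p z by have [_ ->] := dp z.
rewrite [leRHS]mulrC; apply: taylor2 => [y|y|t th].
- by have [] := dp y.
- rewrite (_ : 'D_e p = q); first by have [] := dq y.
  by apply/funext => y'; have [_ ->] := dp y'.
- rewrite (_ : 'D_e p = q); last by apply/funext => y'; have [_ ->] := dp y'.
  have [_ ->] := dq (z + t *: e).
  apply: le_trans (q2C _) _; rewrite ler_wpM2l//.
  by apply: gauss_shift; rewrite (le_trans th)// gtr0_norm.
Qed.

(** A heat equation: the derivative in [s] is [s / (2 * r)] times the average of the Laplacian. Only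
    averages and a polynomial factor occur, so the formula can be iterated across [s = 0]. *)
Lemma is_derive_heat_bsmooth G (x v : 'rV[R]_n) (s p : R) : bsmooth G ->
  is_derive (x, s) (v, p) (heat G)
    (\sum_j (v ord0 j * heat (partial j G) (x, s) +
      p * (s / (2 * r) * heat (partial j (partial j G)) (x, s)))).
Proof.
move=> bG; apply: (is_derive_eq (is_derive_heat x v s p bG)); apply: eq_bigr => j _.
by rewrite (intg_coord_gauss _ _ _ (bsmooth_partial j bG)).
Qed.

Lemma heat_bounded G : bsmooth G -> exists C, forall q, `|heat G q| <= C.
Proof.
move=> bG; have [C HC] := bsmooth_bounded bG; exists (C * intg gam) => q.
rewrite -intgZ//; apply: norm_intg_le; [exact: integ_heat|exact: integZ|move=> z].
by rewrite normrM (ger0_norm (gauss_ge0 _)) ler_wpM2r ?gauss_ge0.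
Qed.

Lemma intg_coord_bounded G j : bsmooth G ->
  exists C, forall x s, `|intg (fun z => z ord0 j * (G (x + s *: z) * gam z))| <= C.
Proof.
move=> bG; have [C HC] := bsmooth_bounded bG.
pose P (z : 'rV[R]_n) := (1 + normsq z) * gam z.
have iP : integ P := integ_gauss_poly n r_gt0.
exists (C * intg P) => x s; rewrite -intgZ//.
apply: norm_intg_le; [exact: (integ_heat_coord (x, s) j bG)|exact: integZ|move=> z].
rewrite !normrM (ger0_norm (gauss_ge0 _)).
rewrite (_ : C * _ = (1 + normsq z) * (C * gam z)); last by rewrite /P; ring.
by rewrite ler_pM ?mulr_ge0 ?gauss_ge0 ?coord_le_poly// ler_wpM2r ?gauss_ge0.
Qed.

(** The first moments are kept here: in the form with [s / (2 * r)] the coefficient is unbounded in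
    [s], whereas the characteristics call for a global Lipschitz constant. *)
Lemma lipschitz_heat G : bsmooth G ->
  exists2 L, 0 <= L & forall p q, `|heat G q - heat G p| <= L * `|q - p|.
Proof.
move=> bG; have bp j := bsmooth_partial j bG.
have [C HC] := choice (fun j => heat_bounded (bp j)).
have [D HD] := choice (fun j => intg_coord_bounded j (bp j)).
exists (\sum_j (`|C j| + `|D j|)); first by apply: sumr_ge0 => j _; rewrite addr_ge0.
apply: lipschitz_derive => [[x s] [v p]|[x s] [v p]].
  by have [] := is_derive_heat x v s p bG.
have [_ ->] := is_derive_heat x v s p bG.
rewrite (le_trans (ler_norm_sum _ _ _))// mulr_suml; apply: ler_sum => j _.
have nv : `|v| <= `|(v, p)| by rewrite prod_normE/= le_max lexx.
have np : `|p| <= `|(v, p)| by rewrite prod_normE/= le_max lexx orbT.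
rewrite (le_trans (ler_normD _ _))// mulrDl !normrM ![_ * `|(v, p)|]mulrC lerD//.
  rewrite ler_pM//; first by rewrite (le_trans (rV_norm_ge v j)).
  by rewrite (le_trans (HC j _))// ler_norm.
by rewrite ler_pM// (le_trans (HD j _ _))// ler_norm.
Qed.

Lemma continuous_heat G : bsmooth G -> continuous (heat G).
Proof. by move=> /lipschitz_heat[L _ HL]; exact: (lipschitz_continuous HL). Qed.

Lemma smooth_heat G : bsmooth G -> smooth (fun _ : R => heat G).
Proof.
move=> bG k; elim: k G bG => [|k IH] G bG.
  by split=> // z; apply: (@continuous_comp _ _ _ snd (heat G)); [exact: cvg_snd|exact: continuous_heat].
apply: (@CkSI _ _ _ _ _ _ (fun _ (w : ('rV[R]_n * R) * ('rV[R]_n * R)) =>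
   \sum_j (w.2.1 ord0 j * heat (partial j G) w.1 +
      w.2.2 * (w.1.2 / (2 * r) * heat (partial j (partial j G)) w.1)))).
- by move=> z; apply: (@continuous_comp _ _ _ snd (heat G)); [exact: cvg_snd|exact: continuous_heat].
- by move=> _ [x s] [v p]; exact: is_derive_heat_bsmooth.
- have bp j := bsmooth_partial j bG; have bpp j := bsmooth_partial j (bp j).
  have C1 H : bsmooth H -> Ck k (fun (_ : R) (w : ('rV[R]_n * R) * ('rV[R]_n * R)) => heat H w.1).
    by move=> bH; exact: (Ck_comp_linear (@bounded_linear_fst _ _ _) (IH H bH)).
  have L1 j : Ck k (fun (_ : R) (w : ('rV[R]_n * R) * ('rV[R]_n * R)) => w.2.1 ord0 j).
    exact: (Ck_linear _ _ (bounded_linear_comp (@bounded_linear_snd _ _ _)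
      (bounded_linear_comp (@bounded_linear_fst _ _ _) (bounded_linear_coord j)))).
  have L2 : Ck k (fun (_ : R) (w : ('rV[R]_n * R) * ('rV[R]_n * R)) => w.2.2).
    exact: (Ck_linear _ _ (bounded_linear_comp (@bounded_linear_snd _ _ _) (@bounded_linear_snd _ _ _))).
  have L3 : Ck k (fun (_ : R) (w : ('rV[R]_n * R) * ('rV[R]_n * R)) => w.1.2).
    exact: (Ck_linear _ _ (bounded_linear_comp (@bounded_linear_fst _ _ _) (@bounded_linear_snd _ _ _))).
  apply: Ck_sum => j; apply: CkD; first by apply: CkM; [exact: L1|exact: C1].
  apply: CkM => //; apply: CkM; last exact: C1.
  by apply: CkM => //; exact: Ck_cst.
Qed.

End heat_kernel.

(** * Quotients with denominators bounded below *)

Section bounded_quotients.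
Context {R : realType} {n : nat}.

Lemma is_derive_inv (V : normedModType R) (f : V -> R) x v l : is_derive x v f l -> f x != 0 ->
  is_derive x v (fun y => (f y)^-1) (- (f x) ^- 2 * l).
Proof.
move=> [df <-] fx; split; first exact: derivableV.
by rewrite deriveV.
Qed.

Lemma bsmoothV (f : 'rV[R]_n -> R) (c : R) : 0 < c -> (forall x, c <= f x) -> bsmooth f ->
  bsmooth (fun x => (f x)^-1).
Proof.
move=> c0 fc bf; have f0 x : 0 < f x := lt_le_trans c0 (fc x).
(* The family consists of the quotients [g / f ^ k]; the quotient rule sends [(g, k)] to [(partial i
   g * f - k * g * partial i f, k + 1)]. *)
pose I := ({g : 'rV[R]_n -> R | bsmooth g} * nat)%type.
pose F (a : I) x := sval a.1 x * (f x)^-1 ^+ a.2.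
pose d (a : I) i : I := (exist _ (fun x => partial i (sval a.1) x * f x +
    sval a.1 x * ((- a.2%:R) * partial i f x))
  (bsmoothD (bsmoothM (bsmooth_partial i (svalP a.1)) bf)
    (bsmoothM (svalP a.1) (bsmoothM (bsmooth_cst n (- a.2%:R)) (bsmooth_partial i bf)))), a.2.+1).
have := @bsmooth_family R n I F d _ _ (exist _ _ (bsmooth_cst n 1), 1%N).
rewrite /F/= (_ : (fun x => 1 * (f x)^-1 ^+ 1) = fun x => (f x)^-1); last first.
  by apply/funext => x; rewrite mul1r expr1.
apply => [[[g bg] k]|[[g bg] k] x v].
  have [D HD] := bsmooth_bounded bg; exists (D * c^-1 ^+ k) => x.
  rewrite /F/= normrM ler_pM// ger0_norm ?exprn_ge0 ?invr_ge0 ?(ltW (f0 x))//.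
  by rewrite lerXn2r ?nnegrE ?invr_ge0 ?(ltW (f0 x)) ?(ltW c0)// lef_pV2 ?posrE.
have dg := derivableP (@bsmooth_derivable _ _ g x v bg).
have df := derivableP (@bsmooth_derivable _ _ f x v bf).
have dV := is_derive_inv df (negbT (gt_eqF (f0 x))).
have dk := is_deriveX k dV.
have dV' : is_derive x v (fun y => (f y)^-1 ^+ k)
    (k%:R * (f x)^-1 ^+ k.-1 * (- (f x) ^- 2 * 'D_v f x)).
  by move: dk; rewrite exprfctE.
apply: (is_derive_eq (is_deriveM dg dV')).
rewrite /F/= -![_ *: _]/(_ * _) (@smooth_row _ _ f x v bf.1) (@smooth_row _ _ g x v bg.1).
rewrite !mulr_sumr -big_split/=; apply: eq_bigr => i _.
have fx := negbT (gt_eqF (f0 x)).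
case: k {dk dV'} => [|k]; rewrite /= ?expr0 ?expr1 ?mul0r ?mulr0n ?oppr0.
  by rewrite !mul0r ?mulr0 ?mul0r ?mulr0; field.
by rewrite !exprVn !exprS; field; rewrite fx expf_neq0.
Qed.

Lemma norm_quotient_le (a a' b b' c d LA LB CA : R) : 0 < c -> c <= b -> c <= b' -> 0 <= d ->
  0 <= LA -> 0 <= LB ->
  `|a' - a| <= LA * d -> `|b' - b| <= LB * d -> `|a| <= CA ->
  `|a' / b' - a / b| <= (LA / c + CA * LB / c ^+ 2) * d.
Proof.
move=> c0 cb cb' d0 LA0 LB0 Ha Hb HC.
have b0 := lt_le_trans c0 cb; have b'0 := lt_le_trans c0 cb'.
have Vle y : c <= y -> y^-1 <= c^-1.
  by move=> cy; rewrite lef_pV2 ?posrE// (lt_le_trans c0).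
have -> : a' / b' - a / b = (a' - a) / b' - a * (b' - b) * (b^-1 * b'^-1).
  by field; rewrite !gt_eqF.
rewrite (le_trans (ler_normB _ _))// [leRHS]mulrDl lerD//.
  rewrite normrM normfV (gtr0_norm b'0) [leRHS]mulrAC ler_pM ?invr_ge0 ?(ltW b'0)//.
  exact: Vle.
rewrite !normrM !normfV (gtr0_norm b0) (gtr0_norm b'0).
rewrite (_ : CA * LB / c ^+ 2 * d = CA * (LB * d) * (c^-1 * c^-1)); last by field; rewrite gt_eqF.
by rewrite !ler_pM ?mulr_ge0 ?invr_ge0 ?(ltW b0) ?(ltW b'0)//; exact: Vle.
Qed.

End bounded_quotients.

Section heat_flow.
Context {R : realType} {n : nat}.
Variables (r : R) (r_gt0 : 0 < r).
Implicit Types (G : 'rV[R]_n -> R).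

Lemma is_derive_heat_x G x v s : bsmooth G ->
  is_derive x v (fun y => heat r G (y, s)) (\sum_j v ord0 j * heat r (partial j G) (x, s)).
Proof.
move=> bG; have := is_derive_fst (is_derive_heat_bsmooth r_gt0 x v s 0 bG).
by move=> H; apply: (is_derive_eq H); apply: eq_bigr => j _; rewrite mul0r addr0.
Qed.

Lemma partial_heat G s j : bsmooth G ->
  partial j (fun y => heat r G (y, s)) = fun y => heat r (partial j G) (y, s).
Proof.
move=> bG; apply/funext => x; rewrite /partial; have [_ ->] := is_derive_heat_x x (delta_mx ord0 j) s bG.
rewrite (bigD1 j)//= mxE !eqxx mul1r big1 ?addr0// => i ij.
by rewrite mxE eqxx (negbTE ij) mul0r.
Qed.

Lemma heat_bsmooth G s : bsmooth G -> bsmooth (fun y => heat r G (y, s)).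
Proof.
move=> bG.
apply: (@bsmooth_family R n {G : 'rV[R]_n -> R | bsmooth G} (fun a y => heat r (sval a) (y, s))
  (fun a i => exist _ (partial i (sval a)) (bsmooth_partial i (svalP a))) _ _ (exist _ G bG)).
  by move=> [a ba]; have [C HC] := heat_bounded r_gt0 ba; exists C => x.
by move=> [a ba] x v /=; exact: is_derive_heat_x.
Qed.

(** The factors [sqrt t / (2 * r)] and [1 / (2 * sqrt t)] combine to the constant diffusivity
    [1 / (4 * r)], which is [eps / 2] for the [r] of the velocity. *)
Lemma is_derive_heat_t G x (t : R) : 0 < t -> bsmooth G ->
  is_derive t (1 : R) (fun t => heat r G (x, Num.sqrt t))
    ((4 * r)^-1 * \sum_j heat r (partial j (partial j G)) (x, Num.sqrt t)).
Proof.
move=> t0 bG.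
have t1 : 0 < Num.sqrt t by rewrite sqrtr_gt0.
have dq := is_derive_pair (is_derive_cst x t (1 : R)) (is_derive1_sqrt t0).
have Cq := smooth_heat r_gt0 bG.
have dh y v : derivable (heat r G) y v.
  exact: (@smooth_derivable _ _ _ _ (fun _ : R => heat r G) 0 y v Cq).
have := is_derive_chain dh (continuous_Ck_tangent (p := (0 : R)) (Cq 1%N)) dq.
move=> H; apply: (is_derive_eq H).
have [_ ->] := is_derive_heat_bsmooth r_gt0 x 0 (Num.sqrt t) (2 * Num.sqrt t)^-1 bG.
rewrite mulr_sumr; apply: eq_bigr => j _; rewrite mxE mul0r add0r.
by field; rewrite !gt_eqF.
Qed.

End heat_flow.

(** * The Cole-Hopf velocity and the viscous Burgers equation *)

Section velocity.
Context {R : realType} {n : nat}.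
Variables (phi : 'rV[R]_n -> R) (eps : R).
Hypotheses (bphi : bsmooth phi) (eps_gt0 : 0 < eps).

(** Under [y = x + tau *: z] with [tau ^ 2 = t], the exponent [normsq (x - y) / (2 * t * eps)]
    becomes [r * normsq z]. *)
Let r := (2 * eps)^-1.
Let r_gt0 : 0 < r. Proof. by rewrite invr_gt0 mulr_gt0. Qed.

Definition boltzmann (y : 'rV[R]_n) : R := expR (- eps^-1 * phi y).
Local Notation G := boltzmann.
Definition flux i (y : 'rV[R]_n) : R := partial i phi y * G y.
Local Notation P := flux.

Definition velocity (q : 'rV[R]_n * R) : 'rV[R]_n :=
  \row_i (heat r (P i) q / heat r G q).
Local Notation u := velocity.

Lemma bsmooth_boltzmann : bsmooth G.
Proof. by apply: bsmooth_expR; apply: bsmoothM => //; exact: bsmooth_cst. Qed.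

Lemma bsmooth_flux i : bsmooth (P i).
Proof. by apply: bsmoothM; [exact: bsmooth_partial|exact: bsmooth_boltzmann]. Qed.

Lemma partial_boltzmann i : partial i G = fun y => - eps^-1 * P i y.
Proof.
apply/funext => y; rewrite /partial /G.
have H := is_deriveZ (- eps^-1) (derivableP (@bsmooth_derivable _ _ phi y (delta_mx ord0 i) bphi)).
have [_ ->] := is_derive_expR_comp H.
by rewrite /P/partial -[_ *: _]/(_ * _) mulrA.
Qed.

(** An upper bound on the potential bounds the Boltzmann factor from below, so the denominator stays
    away from 0 uniformly in [x] and [tau]; the Lipschitz bound on the velocity rests on this. *)
Lemma boltzmann_lower : exists2 c, 0 < c & forall q, c <= heat r G q.
Proof.
have [C HC] := bsmooth_bounded bphi.
exists (expR (- eps^-1 * C) * intg (gauss r : 'rV[R]_n -> R)).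
  by rewrite mulr_gt0 ?expR_gt0// intg_gauss_gt0.
move=> q; apply: heat_ge => //; first exact: bsmooth_boltzmann.
move=> y; rewrite ler_expR !mulNr lerN2 ler_wpM2l ?invr_ge0 ?(ltW eps_gt0)//.
exact: le_trans (ler_norm _) (HC y).
Qed.

Lemma heat_boltzmann_gt0 q : 0 < heat r G q.
Proof. by have [c c0 H] := boltzmann_lower; exact: lt_le_trans (H q). Qed.

Lemma velocity_coord q i : u q ord0 i = heat r (P i) q / heat r G q.
Proof. by rewrite mxE. Qed.

(** The velocity averages [gradient phi] with positive weights; in particular the bound does not
    involve [eps]. *)
Lemma velocity_bound B : 0 <= B -> (forall i y, `|partial i phi y| <= B) ->
  forall q, `|u q| <= B.
Proof.
move=> B0 HB q; rewrite [leLHS]/Num.Def.normr/= mx_normrE.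
apply/bigmax_leP; split => // -[i0 j] _ /=; rewrite (ord1 i0) velocity_coord normrM.
have h0 := heat_boltzmann_gt0 q.
rewrite normfV (gtr0_norm h0) ler_pdivrMr// -heatZ//; last exact: bsmooth_boltzmann.
apply: heat_le => // [||y]; first exact: bsmooth_flux.
  by apply: bsmoothM; [exact: bsmooth_cst|exact: bsmooth_boltzmann].
by rewrite normrM (gtr0_norm (expR_gt0 _)) ler_wpM2r ?expR_ge0.
Qed.

Lemma smooth_velocity : smooth (fun _ : R => u).
Proof.
move=> k; apply: (@Ck_ext _ _ _ _ _ (fun (_ : R) q => \sum_i (heat r (P i) q * (heat r G q)^-1) *: delta_mx ord0 i)).
  by move=> _ q; rewrite [RHS]row_sum_delta; apply: eq_bigr => i _; rewrite mxE.
apply: Ck_sum => i; apply: CkZ; last exact: Ck_cst.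
apply: CkM; first exact: (smooth_heat r_gt0 (bsmooth_flux i)).
apply: CkV; first by move=> _ q; rewrite gt_eqF// heat_boltzmann_gt0.
exact: (smooth_heat r_gt0 bsmooth_boltzmann).
Qed.

Lemma lipschitz_velocity : exists2 L, 0 <= L & forall p q, `|u q - u p| <= L * `|q - p|.
Proof.
have [c c0 Hc] := boltzmann_lower.
have [L0 L00 HL0] := lipschitz_heat r_gt0 bsmooth_boltzmann.
have HL i := lipschitz_heat r_gt0 (bsmooth_flux i).
have /choice[L1 HL1] : forall i, exists L, 0 <= L /\ forall p q,
    `|heat r (P i) q - heat r (P i) p| <= L * `|q - p|.
  by move=> i; have [L ? ?] := HL i; exists L.
have [C HC] := choice (fun i => heat_bounded r_gt0 (bsmooth_flux i)).
exists (\sum_i (L1 i / c + `|C i| * L0 / c ^+ 2)).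
  by apply: sumr_ge0 => i _; rewrite addr_ge0 ?divr_ge0 ?mulr_ge0 ?sqr_ge0 ?(ltW c0)// (HL1 i).1.
move=> p q; rewrite [leLHS]/Num.Def.normr/= mx_normrE.
apply/bigmax_leP; split => [|[i0 i] _ /=].
  rewrite mulr_ge0// sumr_ge0// => i _.
  by rewrite addr_ge0 ?divr_ge0 ?mulr_ge0 ?sqr_ge0 ?(ltW c0)// (HL1 i).1.
rewrite (ord1 i0) !mxE.
apply: (@le_trans _ _ ((L1 i / c + `|C i| * L0 / c ^+ 2) * `|q - p|)).
  apply: norm_quotient_le => //; [exact: (HL1 i).1|exact: (HL1 i).2|].
  exact: le_trans (HC i p) (ler_norm _).
rewrite ler_wpM2r// (bigD1 i)//= lerDl sumr_ge0// => k _.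
by rewrite addr_ge0 ?divr_ge0 ?mulr_ge0 ?sqr_ge0 ?(ltW c0)// (HL1 k).1.
Qed.

Lemma velocity0 x : u (x, 0) = gradient phi x.
Proof.
apply/rowP => i; rewrite !mxE !heat0// /flux.
by field; rewrite !gt_eqF ?expR_gt0// intg_gauss_gt0.
Qed.

Lemma velocity_bsmooth s i : bsmooth (fun y => u (y, s) ord0 i).
Proof.
have [c c0 Hc] := boltzmann_lower.
rewrite (_ : (fun y => _) = fun y => heat r (P i) (y, s) * (heat r G (y, s))^-1); last first.
  by apply/funext => y; rewrite mxE.
apply: bsmoothM; first exact: heat_bsmooth (bsmooth_flux i).
apply: (bsmoothV c0); first by move=> y; exact: Hc.
exact: heat_bsmooth bsmooth_boltzmann.
Qed.

(** The quadratic term comes from the denominator, whose [j]-th derivative is [- eps^-1] times the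
    average of the flux. It is the origin of the nonlinearity of the Burgers equation. *)
Lemma partial_velocity s i j :
  partial j (fun y => u (y, s) ord0 i) = fun y =>
    heat r (partial j (P i)) (y, s) / heat r G (y, s) +
    eps^-1 * (u (y, s) ord0 i * u (y, s) ord0 j).
Proof.
apply/funext => y; set e : 'rV[R]_n := delta_mx ord0 j.
have Z0 := heat_boltzmann_gt0 (y, s).
have da := derivableP (@bsmooth_derivable _ _ _ y e (heat_bsmooth r_gt0 s (bsmooth_flux i))).
have dZ := derivableP (@bsmooth_derivable _ _ _ y e (heat_bsmooth r_gt0 s bsmooth_boltzmann)).
have dV := is_derive_inv dZ (negbT (gt_eqF Z0)).
transitivity ('D_e (fun y => heat r (P i) (y, s) * (heat r G (y, s))^-1) y).
  by congr ('D_e _ y); apply/funext => z; rewrite mxE.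
have [_ ->] := is_deriveM da dV.
have Ea := congr1 (@^~ y) (partial_heat r_gt0 s j (bsmooth_flux i)).
have EZ := congr1 (@^~ y) (partial_heat r_gt0 s j bsmooth_boltzmann).
rewrite /= in Ea EZ; rewrite -/(partial j _ _) [X in _ + _ *: X]Ea -/(partial j _ _) EZ.
rewrite partial_boltzmann (heatZ r_gt0 _ _ (bsmooth_flux j)).
have alg (a Z e' p aj : R) : Z != 0 -> a *: (- Z ^- 2 * (- e' * p)) + Z^-1 *: aj =
    aj / Z + e' * (a / Z * (p / Z)).
  by move=> Z1; rewrite -![_ *: _]/(_ * _); field.
by rewrite !velocity_coord; apply: alg; rewrite gt_eqF.
Qed.

Lemma partial2_velocity s i j y :
  partial j (partial j (fun y => u (y, s) ord0 i)) y =
    heat r (partial j (partial j (P i))) (y, s) / heat r G (y, s) +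
    eps^-1 * (heat r (partial j (P i)) (y, s) / heat r G (y, s) * u (y, s) ord0 j) +
    eps^-1 * (partial j (fun y => u (y, s) ord0 i) y * u (y, s) ord0 j +
      u (y, s) ord0 i * partial j (fun y => u (y, s) ord0 j) y).
Proof.
have Z0 := heat_boltzmann_gt0 (y, s); set e : 'rV[R]_n := delta_mx ord0 j.
have bPj := bsmooth_partial j (bsmooth_flux i).
have da := derivableP (@bsmooth_derivable _ _ _ y e (heat_bsmooth r_gt0 s bPj)).
have dZ := derivableP (@bsmooth_derivable _ _ _ y e (heat_bsmooth r_gt0 s bsmooth_boltzmann)).
have dV := is_derive_inv dZ (negbT (gt_eqF Z0)).
have dui := derivableP (@bsmooth_derivable _ _ _ y e (velocity_bsmooth s i)).
have duj := derivableP (@bsmooth_derivable _ _ _ y e (velocity_bsmooth s j)).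
rewrite [in LHS]partial_velocity -[LHS]/('D_e _ y).
have [_ ->] := is_deriveD (is_deriveM da dV) (is_deriveZ eps^-1 (is_deriveM dui duj)).
have Ea := congr1 (@^~ y) (partial_heat r_gt0 s j bPj).
have EZ := congr1 (@^~ y) (partial_heat r_gt0 s j bsmooth_boltzmann).
rewrite /= in Ea EZ; rewrite -!/(partial j _ _) [X in _ + _ *: X + _]Ea EZ.
rewrite partial_boltzmann (heatZ r_gt0 _ _ (bsmooth_flux j)).
have alg (aj ajj Z e' p ui uj dui' duj' : R) : Z != 0 -> uj = p / Z ->
    aj *: (- Z ^- 2 * (- e' * p)) + Z^-1 *: ajj + e' *: (ui *: duj' + uj *: dui') =
    ajj / Z + e' * (aj / Z * uj) + e' * (dui' * uj + ui * duj').
  by move=> Z1 ->; rewrite -![_ *: _]/(_ * _); field.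
by apply: alg; [rewrite gt_eqF|rewrite velocity_coord].
Qed.

Lemma is_derive_velocity_t x (t : R) i : 0 < t ->
  is_derive t (1 : R) (fun t => u (x, Num.sqrt t) ord0 i)
   (eps / 2 * \sum_j (heat r (partial j (partial j (P i))) (x, Num.sqrt t) / heat r G (x, Num.sqrt t)
     + eps^-1 * (u (x, Num.sqrt t) ord0 i * heat r (partial j (P j)) (x, Num.sqrt t) / heat r G (x, Num.sqrt t)))).
Proof.
move=> t0.
rewrite (_ : (fun t => _) = fun t => heat r (P i) (x, Num.sqrt t) * (heat r G (x, Num.sqrt t))^-1); last first.
  by apply/funext => z; rewrite mxE.
have Z0 := heat_boltzmann_gt0 (x, Num.sqrt t).
have da := is_derive_heat_t r_gt0 x t0 (bsmooth_flux i).
have dZ := is_derive_heat_t r_gt0 x t0 bsmooth_boltzmann.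
have dV := is_derive_inv dZ (negbT (gt_eqF Z0)).
apply: (is_derive_eq (is_deriveM da dV)).
have rE : (4 * r)^-1 = eps / 2 by rewrite /r; field; rewrite gt_eqF.
set s := Num.sqrt t.
have sE : \sum_j heat r (partial j (partial j G)) (x, s) =
    - eps^-1 * \sum_j heat r (partial j (P j)) (x, s).
  rewrite mulr_sumr; apply: eq_bigr => j _; have CP := (bsmooth_flux j).1.
  rewrite partial_boltzmann (partialZ (- eps^-1) j CP).
  exact: (heatZ r_gt0 (- eps^-1) _ (bsmooth_partial j (bsmooth_flux j))).
have RE : \sum_j (heat r (partial j (partial j (P i))) (x, s) / heat r G (x, s) +
    eps^-1 * (u (x, s) ord0 i * heat r (partial j (P j)) (x, s) / heat r G (x, s))) =
    (\sum_j heat r (partial j (partial j (P i))) (x, s)) / heat r G (x, s) +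
    eps^-1 * u (x, s) ord0 i * (\sum_j heat r (partial j (P j)) (x, s)) / heat r G (x, s).
  rewrite big_split/= -mulr_suml; congr (_ + _).
  by rewrite mulr_sumr mulr_suml; apply: eq_bigr => j _; rewrite !mulrA.
have alg (E a Z e' p k S T U w : R) : Z != 0 -> k = E -> S = - e' * p ->
    U = T / Z + e' * w * p / Z -> w = a / Z ->
    a *: (- Z ^- 2 * (k * S)) + Z^-1 *: (k * T) = E * U.
  by move=> Z1 -> -> -> ->; rewrite -![_ *: _]/(_ * _); field.
exact: (alg _ _ _ _ _ _ _ _ _ _ (negbT (gt_eqF Z0)) rE sE RE (velocity_coord _ _)).
Qed.

(* Cole-Hopf: u solves the viscous Burgers equation with viscosity eps / 2. *)
Lemma burgers_velocity x (t : R) i : 0 < t ->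
  burgers_lhs (fun x t => u (x, Num.sqrt t)) x t ord0 i =
  eps / 2 * \sum_j partial j (partial j (fun y => u (y, Num.sqrt t) ord0 i)) x.
Proof.
move=> t0; set s := Num.sqrt t; rewrite /burgers_lhs mxE summxE derive1E.
have dut : derivable (fun t => u (x, Num.sqrt t)) t 1.
  have dq := is_derive_pair (is_derive_cst x t (1 : R)) (is_derive1_sqrt t0).
  have du y v : derivable u y v := @smooth_derivable _ _ _ _ (fun _ : R => u) 0 y v smooth_velocity.
  by have [] := is_derive_chain du (continuous_Ck_tangent (p := (0 : R)) (smooth_velocity 1%N)) dq.
have [_ <-] := is_derive_coord i (derivableP dut).
have [_ ->] := is_derive_velocity_t x i t0.
have Z0 := heat_boltzmann_gt0 (x, s).
rewrite !mulr_sumr -big_split/=; apply: eq_bigr => j _.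
rewrite [X in _ + X]mxE.
have -> : partial j (fun y => u (y, s)) x ord0 i = partial j (fun y => u (y, s) ord0 i) x.
  have du : derivable (fun y => u (y, s)) x (delta_mx ord0 j).
    have du := @smooth_derivable _ _ _ _ (fun _ : R => u) 0 (x, s) (delta_mx ord0 j, 0) smooth_velocity.
    by have [] := is_derive_fst (derivableP du).
  by rewrite /partial; have [_ <-] := is_derive_linear_comp (bounded_linear_coord i) (derivableP du).
(* After substitution the equation holds separately for each [j], as a rational identity in the
   averages. *)
rewrite partial2_velocity !partial_velocity.
have alg (e' Z ajj ui uj pjj aj : R) : e' != 0 -> Z != 0 ->
    e' / 2 * (ajj / Z + e'^-1 * (ui * pjj / Z)) + uj * (aj / Z + e'^-1 * (ui * uj)) =
    e' / 2 * (ajj / Z + e'^-1 * (aj / Z * uj) +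
      e'^-1 * ((aj / Z + e'^-1 * (ui * uj)) * uj + ui * (pjj / Z + e'^-1 * (uj * uj)))).
  by move=> e1 Z1; field; rewrite e1 Z1.
by apply: alg; rewrite gt_eqF.
Qed.

Lemma intg_burgers_velocity r' eta (t : R) i : 0 < t -> csmooth r' eta ->
  intg (fun x => burgers_lhs (fun x t => u (x, Num.sqrt t)) x t ord0 i * eta x) =
  eps / 2 * \sum_j intg (fun x => u (x, Num.sqrt t) ord0 i * partial j (partial j eta) x).
Proof.
move=> t0 ceta; set s := Num.sqrt t.
have bu := velocity_bsmooth s i.
have buj j := bsmooth_partial j bu; have bujj j := bsmooth_partial j (buj j).
rewrite (_ : (fun x => _) = fun x => eps / 2 * \sum_j partial j (partial j (fun y => u (y, s) ord0 i)) x * eta x); last first.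
  by apply/funext => x; rewrite burgers_velocity// -mulrA mulr_suml.
have ij j := csmooth_integ (csmoothM (bujj j) ceta).
rewrite intgZ; last exact: integ_sum.
rewrite intg_sum//; congr (_ * _); apply: eq_bigr => j _.
rewrite (intg_by_parts j (buj j) ceta) (intg_by_parts j bu (csmooth_partial j ceta)).
by rewrite opprK.
Qed.

Lemma integ_burgers_velocity r' eta (t : R) i : 0 < t -> csmooth r' eta ->
  integ (fun x => burgers_lhs (fun x t => u (x, Num.sqrt t)) x t ord0 i * eta x).
Proof.
move=> t0 ceta; set s := Num.sqrt t.
have bujj j := bsmooth_partial j (bsmooth_partial j (velocity_bsmooth s i)).
rewrite (_ : (fun x => _) = fun x => eps / 2 * \sum_j partial j (partial j (fun y => u (y, s) ord0 i)) x * eta x); last first.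
  by apply/funext => x; rewrite burgers_velocity// -mulrA mulr_suml.
by apply/integZ/integ_sum => j; exact: csmooth_integ (csmoothM (bujj j) ceta).
Qed.

Lemma burgers_velocity_bound r' eta (t : R) i B : 0 < t -> csmooth r' eta ->
  0 <= B -> (forall i y, `|partial i phi y| <= B) ->
  `|intg (fun x => burgers_lhs (fun x t => u (x, Num.sqrt t)) x t ord0 i * eta x)| <=
  eps / 2 * \sum_j B * intg (fun x => `|partial j (partial j eta) x|).
Proof.
move=> t0 ceta B0 HB; rewrite (intg_burgers_velocity _ t0 ceta) normrM.
have e20 : 0 <= eps / 2 by rewrite divr_ge0// ltW.
rewrite (ger0_norm e20) ler_wpM2l// (le_trans (ler_norm_sum _ _ _))//.
apply: ler_sum => j _.
have cjj := csmooth_partial j (csmooth_partial j ceta).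
have ijj := csmooth_integ cjj.
rewrite -intgZ; last exact: integ_norm.
apply: norm_intg_le => [||x].
- exact: csmooth_integ (csmoothM (velocity_bsmooth (Num.sqrt t) i) cjj).
- exact/integZ/integ_norm.
- rewrite normrM ler_wpM2r// (le_trans (rV_norm_ge _ i))//.
  exact: velocity_bound.
Qed.

End velocity.

(** * Characteristics and the smoothness of their feet *)

Section foot_map.
Context {R : realType} {n : nat}.
Variables (u : 'rV[R]_n * R -> 'rV[R]_n) (L B : R).
Hypotheses (Cu : smooth (fun _ : R => u)).
Hypotheses (L_ge0 : 0 <= L) (uL : forall p q, `|u q - u p| <= L * `|q - p|).
Hypotheses (B_ge0 : 0 <= B) (uB : forall q, `|u q| <= B).

Let w (x : 'rV[R]_n) (t : R) := u (x, Num.sqrt t).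

Let cu : continuous u. Proof. exact: (@smooth_continuous _ _ _ _ (fun _ : R => u) 0 Cu). Qed.

Let L1_gt0 : 0 < L + 1. Proof. by rewrite ltr_wpDl. Qed.

Let lip x y s : `|u (x, s) - u (y, s)| <= L * `|x - y|.
Proof.
apply: (le_trans (uL (y, s) (x, s))); rewrite ler_wpM2l//.
by rewrite prod_normE/= subrr normr0 ge_max lexx normr_ge0.
Qed.

Lemma derivable_within_continuous (X dX : R -> 'rV[R]_n) :
  (forall s : R, -1 < s -> is_derive s (1 : R) X (dX s)) -> {within `[0, +oo[, continuous X}.
Proof.
move=> DX; apply: continuous_in_subspaceT => s; rewrite inE/= in_itv/= andbT => s0.
have [dX' _] := DX s (lt_le_trans (ltrN10 R) s0).
exact/differentiable_continuous/derivable1_diffP.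
Qed.

(** [flow] is a chosen solution, so a constructed one is identified with it by uniqueness on [[0,
    +oo[]. As [Num.sqrt] is 0 on negative numbers, the field is continuous at all times and the
    curve extends to [s > -1]. *)
Lemma flow_curve x (t : R) : 0 <= t -> exists X : R -> 'rV[R]_n,
  [/\ X t = x, forall s : R, -1 < s -> is_derive s (1 : R) X (w (X s) s) &
      forall s, 0 <= s -> flow w x t s = X s].
Proof.
move=> t0.
have cw : continuous (fun z : 'rV[R]_n * R => w z.1 z.2).
  move=> z; apply: (@continuous_comp _ _ _ (fun z : 'rV[R]_n * R => (z.1, Num.sqrt z.2)) u); last exact: cu.
  apply: continuous_at_pair; first exact: cvg_fst.
  by apply: (@continuous_comp _ _ _ snd (@Num.sqrt R)); [exact: cvg_snd|exact: sqrt_continuous].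
have wL x' y s : `|w x' s - w y s| <= (L + 1) * `|x' - y|.
  by apply: le_trans (lip _ _ _) _; rewrite ler_wpM2r// lerDl.
have [X Xt DX] := ode_exists (x0 := x) L1_gt0 B_ge0 t0 cw wL (fun s => uB (x, Num.sqrt s)).
exists X; split=> // s s0.
have cX := derivable_within_continuous DX.
have DX0 (r : R) : 0 < r -> is_derive r (1 : R) X (w (X r) r).
  by move=> r0; apply: DX; rewrite (lt_trans (ltrN10 R)).
have [Yt cY DY] : integral_curve w x t (flow w x t).
  by apply: getPex; exists X; split.
have wL' x' y s' : `|w x' s' - w y s'| <= L * `|x' - y| by exact: lip.
by apply: (ode_unique L_ge0 t0 wL' cY cX DY DX0) => //; rewrite Yt Xt.
Qed.

(** A trajectory [X] is itself the characteristic through [(X t, t)], by uniqueness, so all its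
    points share the foot [X 0]. *)
Lemma flow_const (X : R -> 'rV[R]_n) (t : R) : 0 <= t ->
  (forall s : R, -1 < s -> is_derive s (1 : R) X (w (X s) s)) ->
  flow w (X t) t 0 = X 0.
Proof.
move=> t0 DX; have [Y [Yt DY ->//]] := flow_curve (X t) t0.
have pos (Z : R -> 'rV[R]_n) : (forall s : R, -1 < s -> is_derive s (1 : R) Z (w (Z s) s)) ->
    forall s : R, 0 < s -> is_derive s (1 : R) Z (w (Z s) s).
  by move=> DZ s s0; apply: DZ; rewrite (lt_trans (ltrN10 R)).
have wL' x' y s' : `|w x' s' - w y s'| <= L * `|x' - y| by exact: lip.
exact: (ode_unique L_ge0 t0 wL' (derivable_within_continuous DY) (derivable_within_continuous DX)
  (pos _ DY) (pos _ DX) Yt (lexx 0)).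
Qed.

Lemma flow0 x : flow w x 0 0 = x.
Proof. by have [X [X0 _ ->]] := flow_curve x (lexx 0). Qed.

(* With t = tau^2 and s = tau^2 (1 - theta) the backward trajectories live on the fixed
   interval [0, 1] and their equation depends smoothly on tau down to 0. *)
Let c (theta : R) : R := Num.sqrt (1 - clamp theta).

Let field (tau theta : R) (y : 'rV[R]_n) := - (tau ^+ 2) *: u (y, tau * c theta).

Let cc : continuous c.
Proof.
move=> s; apply: (@continuous_comp _ _ _ (fun s => 1 - clamp s) (@Num.sqrt R)); last exact: sqrt_continuous.
by apply: cvgB; [exact: cvg_cst|exact: continuous_clamp].
Qed.

Let field_lip tau x y theta : `|field tau theta x - field tau theta y| <= tau ^+ 2 * L * `|x - y|.
Proof. by rewrite -scalerBr normrZ normrN ger0_norm ?sqr_ge0// -mulrA ler_wpM2l ?sqr_ge0. Qed.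

Let field_bound tau x theta : `|field tau theta x| <= tau ^+ 2 * B.
Proof. by rewrite normrZ normrN ger0_norm ?sqr_ge0// ler_wpM2l ?sqr_ge0. Qed.

Lemma backward_exists x tau : exists Y : R -> 'rV[R]_n, Y 0 = x /\
  forall s : R, -1 < s -> is_derive s (1 : R) Y (field tau s (Y s)).
Proof.
have cf : continuous (fun z : 'rV[R]_n * R => field tau z.2 z.1).
  move=> z; apply: cvgZr; apply: (@continuous_comp _ _ _ (fun z : 'rV[R]_n * R => (z.1, tau * c z.2)) u); last exact: cu.
  apply: continuous_at_pair; first exact: cvg_fst.
  apply: cvgM; first exact: cvg_cst.
  by apply: (@continuous_comp _ _ _ snd c); [exact: cvg_snd|exact: cc].
have [||x' y s|s|Y Y0 DY] := @ode_exists R n (fun x s => field tau s x) (tau ^+ 2 * L + 1) (tau ^+ 2 * B) 0 x _ _ (lexx 0) cf.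
- by rewrite ltr_wpDl// mulr_ge0// sqr_ge0.
- by rewrite mulr_ge0// sqr_ge0.
- apply: le_trans (field_lip _ _ _ _) _.
  by rewrite ler_wpM2r// lerDl.
- exact: field_bound.
by exists Y.
Qed.

(** Smooth dependence on [tau] is obtained as dependence on initial data: [tau] is appended to the
    state as a coordinate with zero velocity, and the foot is read off the time-1 map of the
    enlarged flow. *)
Lemma foot_smooth : exists Fh : 'rV[R]_n * R -> 'rV[R]_n, smooth (fun _ : R => Fh) /\
  forall x t, 0 <= t -> flow w x t 0 = Fh (x, Num.sqrt t).
Proof.
have [Y HY] := choice (fun p : 'rV[R]_n * R => backward_exists p.1 p.2).
pose tm (z : 'rV[R]_(n + 1)) : R := rsubmx z ord0 ord0.
pose Psi (z : 'rV[R]_(n + 1)) (s : R) : 'rV[R]_(n + 1) :=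
  row_mx (Y (lsubmx z, tm z) s) (rsubmx z).
pose f (s : R) (z : 'rV[R]_(n + 1)) : 'rV[R]_(n + 1) := row_mx (field (tm z) s (lsubmx z)) 0.
have Cf : smooth f.
  move=> k.
  have C1 : Ck k (fun (s : R) (z : 'rV[R]_(n + 1)) => lsubmx z) by exact/Ck_linear/bounded_linear_lsubmx.
  have C2 : Ck k (fun (s : R) (z : 'rV[R]_(n + 1)) => tm z).
    exact: (Ck_linear _ _ (bounded_linear_comp (bounded_linear_rsubmx n 1) (bounded_linear_coord ord0))).
  have C3 : Ck k (fun (s : R) (_ : 'rV[R]_(n + 1)) => c s) by exact: Ck_param.
  apply: (@Ck_linear_comp _ _ _ _ _ _ (fun z : 'rV[R]_n * 'rV[R]_1 => row_mx z.1 z.2)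
    (fun s z => (field (tm z) s (lsubmx z), 0))); first exact: bounded_linear_row_mx.
  apply: Ck_pair; last exact: Ck_cst.
  apply: CkZ; first by apply/CkN/CkX.
  have Cu' : Ck k (fun _ : R => u) := Cu k.
  apply: (@Ck_comp _ _ _ _ _ _ (fun _ => u) (fun s z => (lsubmx z, tm z * c s))) => //.
  by apply: Ck_pair => //; exact: CkM.
have fP : flow_of f Psi.
  move=> z; have [Y0 DY] := HY (lsubmx z, tm z); split.
  - by rewrite /Psi Y0 hsubmxK.
  - apply: continuous_in_subspaceT => s; rewrite inE/= in_itv/= => /andP[s0 _].
    apply: (@continuous_comp _ _ _ (fun s => (Y (lsubmx z, tm z) s, rsubmx z)) (fun p : 'rV[R]_n * 'rV[R]_1 => row_mx p.1 p.2)).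
      apply: continuous_at_pair; last exact: cvg_cst.
      have [dY _] := DY s (lt_le_trans (ltrN10 R) s0).
      exact/differentiable_continuous/derivable1_diffP.
    exact: (bounded_linear_row_mx n 1).2.
  - move=> s /andP[s0 _]; have DYs := DY s (lt_trans (ltrN10 R) s0).
    have := is_derive_linear_comp (bounded_linear_row_mx n 1) (is_derive_pair DYs (is_derive_cst (rsubmx z) s 1)).
    move=> H; apply: (is_derive_eq H).
    by rewrite /f /Psi /tm /= row_mxKl row_mxKr.
have lb : locally_bounded Psi.
  move=> r; exists (`|r| + `|r| ^+ 2 * B) => z s zr /andP[s0 s1].
  have r0 : 0 <= `|r| ^+ 2 * B by rewrite mulr_ge0// sqr_ge0.
  have zr' : `|z| <= `|r| by apply: le_trans zr (ler_norm r).
  apply: row_mx_norm; last by rewrite (le_trans (rsubmx_norm z))// (le_trans zr')// lerDl.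
  have [Y0 DY] := HY (lsubmx z, tm z).
  have := @vector_MVT R _ (Y (lsubmx z, tm z)) (fun s => field (tm z) s (Y (lsubmx z, tm z) s))
    (fun s => tm z ^+ 2 * B * s) (fun _ => tm z ^+ 2 * B) 0 s s0.
  rewrite Y0 mulr0 subr0 => H.
  have {}H : `|Y (lsubmx z, tm z) s - lsubmx z| <= tm z ^+ 2 * B * s.
    apply: H => s' /andP[s'0 _].
    - by apply: DY; rewrite (lt_le_trans (ltrN10 R)).
    - exact: is_derive_mull.
    - exact: field_bound.
  rewrite -[Y _ s](subrK (lsubmx z)) addrC (le_trans (ler_normD _ _))// lerD//.
    exact: le_trans (lsubmx_norm z) zr'.
  apply: (le_trans H).
  apply: (@le_trans _ _ (tm z ^+ 2 * B)); first by rewrite ler_piMr// mulr_ge0// sqr_ge0.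
  rewrite ler_wpM2r// -real_normK ?num_real// lerXn2r ?nnegrE// (le_trans (rV_norm_ge _ _))//.
  exact: le_trans (rsubmx_norm z) zr'.
have SP := flow_smooth Cf fP lb (s := 1) (introT andP (conj ler01 (lexx 1))).
pose emb (q : 'rV[R]_n * R) : 'rV[R]_(n + 1) := row_mx q.1 (const_mx q.2).
have bemb : bounded_linear emb.
  have bc : bounded_linear (fun s : R => const_mx s : 'rV[R]_1).
    split; first by move=> a x y; apply/rowP => i; rewrite !mxE.
    move=> s; apply/cvgrPdist_le => e e0; near=> t.
    rewrite [leLHS]/Num.Def.normr/= mx_normrE; apply: bigmax_le => /=; first exact: ltW.
    move=> [i j] _ /=; rewrite !mxE; near: t.
    by apply: cvgr_dist_le => //; exact: cvg_id.
  have := bounded_linear_comp (bounded_linear_pair (@bounded_linear_fst _ _ _)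
    (bounded_linear_comp (@bounded_linear_snd _ _ _) bc)) (bounded_linear_row_mx n 1).
  by apply.
exists (fun q => lsubmx (Psi (emb q) 1)); split.
  move=> k.
  apply: (@Ck_linear_comp _ _ _ _ _ _ (fun z : 'rV[R]_(n + 1) => lsubmx z)
    (fun _ q => Psi (emb q) 1)); first exact: bounded_linear_lsubmx.
  exact: (Ck_comp_linear bemb (SP k)).
move=> x t t0; set tau := Num.sqrt t.
have tau0 : 0 <= tau by exact: sqrtr_ge0.
have tE : tau ^+ 2 = t by rewrite sqr_sqrtr.
rewrite /Psi /emb /tm /= !row_mxKl row_mxKr mxE.
have [X [Xt DX ->//]] := flow_curve x t0.
have [Y0 DY] := HY (x, tau); rewrite /= in Y0 DY.
(* The curve [s |-> X (t - t * s)] runs the characteristic backwards and obeys the same equation as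
   [Y] on [[0, 1]], because [sqrt t * sqrt (1 - s) = sqrt (t - t * s)]; Gronwall then gives
   [e 1 = 0]. *)
pose e (s : R) : 'rV[R]_n := Y (x, tau) s - X (t + - t * s).
have := @gronwall R n e (fun s => field tau s (Y (x, tau) s) - (- t) *: w (X (t + - t * s)) (t + - t * s))
  (tau ^+ 2 * L) 0 1 ler01 (mulr_ge0 (sqr_ge0 _) L_ge0) (lexx 0).
have tpos s : 0 <= s <= 1 -> 0 <= t + - t * s.
  by move=> /andP[s0 s1]; rewrite mulNr subr_ge0 ler_piMr.
have De (s : R) : 0 <= s <= 1 -> is_derive s (1 : R) e
    (field tau s (Y (x, tau) s) - (- t) *: w (X (t + - t * s)) (t + - t * s)).
  move=> /[dup] s01 /andP[s0 s1]; apply: is_deriveB; first by apply: DY; rewrite (lt_le_trans (ltrN10 R)).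
  by apply: is_derive_affine; apply: DX; rewrite (lt_le_trans (ltrN10 R))// tpos.
move=> /(_ _ _ _ 1); rewrite lexx ler01 => H.
have : `|e 1| <= 0.
  apply: le_trans (H _ _ _ _) _ => //.
  - apply: continuous_in_subspaceT => s; rewrite inE/= in_itv/= => s01.
    have [de _] := De s s01.
    exact/differentiable_continuous/derivable1_diffP.
  - by move=> s /andP[s0 s1]; apply: De; rewrite !ltW.
  - move=> s /andP[s0 s1]; rewrite addr0.
    have s01 : 0 <= s <= 1 by rewrite !ltW.
    have -> : - t *: w (X (t + - t * s)) (t + - t * s) = field tau s (X (t + - t * s)).
      rewrite /field tE /w; congr (_ *: u (_, _)).
      rewrite /c clampE// -sqrtrM//; congr Num.sqrt; ring.
    exact: field_lip.
  have -> : e 0 = 0 by rewrite /e mulr0 addr0 Y0 Xt subrr.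
  by rewrite normr0 mulr0 add0r mul0r.
by rewrite normr_le0 /e mulr1 subrr subr_eq0 => /eqP ->.
Unshelve. all: by end_near. Qed.

End foot_map.

(** * Derivative of a determinant *)

Section jacobi.
Context {R : realType}.

Lemma is_derive_prod (V : normedModType R) (I : eqType) (r : seq I) (f : I -> V -> R) (df : I -> R) x v :
  uniq r -> (forall i, is_derive x v (f i) (df i)) ->
  is_derive x v (fun y => \prod_(i <- r) f i y)
    (\sum_(i <- r) df i * \prod_(k <- r | k != i) f k x).
Proof.
move=> + Df; elim: r => [_|i r IH /= /andP[ir ur]].
  rewrite big_nil; under eq_fun do rewrite big_nil; exact: is_derive_cst.
under eq_fun do rewrite big_cons.
apply: (is_derive_eq (is_deriveM (Df i) (IH ur))).
rewrite -![_ *: _]/(_ * _) big_cons big_cons eqxx/= addrC; congr (_ + _).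
  rewrite mulrC; congr (_ * _); rewrite big_seq_cond [RHS]big_seq_cond; apply: eq_bigl => k.
  by rewrite andbT andbC; case: eqVneq => //= ->; rewrite (negbTE ir).
rewrite mulr_sumr [LHS]big_seq [RHS]big_seq; apply: eq_bigr => m mr.
have im : i != m by apply: contra ir => /eqP ->.
by rewrite big_cons im mulrCA.
Qed.

Lemma is_derive_summation (V W : normedModType R) (I : Type) (r : seq I) (f : I -> V -> W) (df : I -> W) x v :
  (forall i, is_derive x v (f i) (df i)) ->
  is_derive x v (fun y => \sum_(i <- r) f i y) (\sum_(i <- r) df i).
Proof.
move=> Df; elim: r => [|i r IH].
  by rewrite big_nil; under eq_fun do rewrite big_nil; exact: is_derive_cst.
by rewrite big_cons; under eq_fun do rewrite big_cons; exact: is_deriveD.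
Qed.

(* Jacobi's formula; no invertibility is needed since A' = M A. *)
Lemma is_derive_det n (A : R -> 'M[R]_n) (M : 'M[R]_n) t :
  (forall i j, is_derive t (1 : R) (fun s => A s i j) ((M *m A t) i j)) ->
  is_derive t (1 : R) (fun s => \det (A s)) (\tr M * \det (A t)).
Proof.
move=> DA.
have D1 (s : 'S_n) := is_derive_prod (index_enum_uniq 'I_n) (fun i => DA i (s i)).
have D2 := is_derive_summation (index_enum 'S_n) (fun s : 'S_n => is_deriveZ ((-1) ^+ s) (D1 s)).
apply: (is_derive_eq D2); rewrite /mxtrace mulr_suml.
under eq_bigr do rewrite -[_ *: _]/(_ * _) mulr_sumr.
rewrite exchange_big/=; apply: eq_bigr => i _.
(* [B] is [A t] with row [i] replaced by that of [M *m A t]. Its cofactors along that row are those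
   of [A t], so its determinant is the diagonal entry of [M *m A t *m \adj (A t)], that is,
   [M i i * \det (A t)]. *)
pose B := \matrix_(k, j) if k == i then (M *m A t) i j else A t k j.
have Bi j : B i j = (M *m A t) i j by rewrite [LHS]mxE eqxx.
have Bk k j : k != i -> B k j = A t k j by move=> ki; rewrite [LHS]mxE (negbTE ki).
transitivity (\det B).
  rewrite /determinant; apply: eq_bigr => s _; congr (_ * _).
  rewrite [RHS](bigD1 i)//= Bi; congr (_ * _).
  by apply: eq_bigr => k ki; rewrite Bk.
have cofB j : cofactor B i j = cofactor (A t) i j.
  rewrite /cofactor; congr (_ * \det _); apply/matrixP => k l; rewrite !mxE.
  by rewrite eq_sym (negbTE (neq_lift _ _)).
rewrite (expand_det_row B i).
transitivity ((M *m A t *m \adj (A t)) i i).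
  by rewrite [RHS]mxE; apply: eq_bigr => j _; rewrite cofB Bi; congr (_ * _); rewrite [RHS]mxE.
by rewrite -mulmxA mul_mx_adj mul_mx_scalar mxE mulrC.
Qed.

End jacobi.

(** * The continuity equation along characteristics *)

Section continuity_equation.
Context {R : realType} {n : nat}.
Variables (u : 'rV[R]_n * R -> 'rV[R]_n) (L B : R).
Hypotheses (Cu : smooth (fun _ : R => u)).
Hypotheses (L_ge0 : 0 <= L) (uL : forall p q, `|u q - u p| <= L * `|q - p|).
Hypotheses (B_ge0 : 0 <= B) (uB : forall q, `|u q| <= B).

Let w (x : 'rV[R]_n) (t : R) := u (x, Num.sqrt t).

Variable Fh : 'rV[R]_n * R -> 'rV[R]_n.
Hypotheses (CF : smooth (fun _ : R => Fh))
  (flowF : forall x t, 0 <= t -> flow w x t 0 = Fh (x, Num.sqrt t)).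

(* The direction of the trajectories in the variables (x, tau = sqrt t). *)
Definition characteristic (q : 'rV[R]_n * R) : 'rV[R]_n * R := (u q, (2 * q.2)^-1).
Let kap := characteristic.

Lemma is_derive_along (W : normedModType R) (f : 'rV[R]_n * R -> W) (X : R -> 'rV[R]_n) (t : R) :
  smooth (fun _ : R => f) -> 0 < t -> is_derive t (1 : R) X (w (X t) t) ->
  is_derive t (1 : R) (fun s => f (X s, Num.sqrt s)) ('D_(kap (X t, Num.sqrt t)) f (X t, Num.sqrt t)).
Proof.
move=> Cf t0 DX.
have dq := is_derive_pair DX (is_derive1_sqrt t0).
have df y v : derivable f y v := @smooth_derivable _ _ _ _ (fun _ : R => f) 0 y v Cf.
exact: (is_derive_chain df (continuous_Ck_tangent (p := (0 : R)) (Cf 1%N)) dq).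
Qed.

Lemma curve_through x (tau : R) : 0 < tau -> exists X : R -> 'rV[R]_n,
  [/\ X (tau ^+ 2) = x, forall s : R, 0 < s -> is_derive s (1 : R) X (w (X s) s) &
      forall s, 0 < s -> Fh (X s, Num.sqrt s) = X 0].
Proof.
move=> tau0; have t0 : 0 <= tau ^+ 2 by exact: sqr_ge0.
have [X [Xt DX _]] := flow_curve Cu L_ge0 uL B_ge0 uB x t0.
exists X; split=> // [s s0|s s0]; first by apply: DX; rewrite (lt_trans (ltrN10 R)).
rewrite -flowF ?ltW//; apply: (flow_const Cu L_ge0 uL B_ge0 uB _ DX); exact: ltW.
Qed.

Lemma derive_near_cst (W : normedModType R) (g : R -> W) (c : W) (t : R) : 0 < t ->
  (forall s, 0 < s -> g s = c) -> is_derive t (1 : R) g 0.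
Proof.
move=> t0 gc.
have near : \forall s \near t, cst c s = g s.
  by near=> s; rewrite gc//; near: s; exact: lt_nbhsr.
by have := is_derive_cst c t (1 : R); apply: near_eq_is_derive.
Unshelve. all: by end_near. Qed.

Lemma transport q : 0 < q.2 -> 'D_(kap q) Fh q = 0.
Proof.
case: q => x tau /= tau0; have t0 : 0 < tau ^+ 2 by rewrite exprn_gt0.
have [X [Xt DX XF]] := curve_through x tau0.
have := is_derive_along CF t0 (DX _ t0).
rewrite sqrtr_sqr (gtr0_norm tau0) Xt => -[_ <-].
by have [_ ->] := derive_near_cst t0 XF.
Qed.

Let e i : 'rV[R]_n * R := (delta_mx ord0 i, 0).

Lemma derive_space (W : normedModType R) (f : 'rV[R]_n * R -> W) q (v : 'rV[R]_n) :
  smooth (fun _ : R => f) -> 'D_(v, 0) f q = \sum_k v ord0 k *: 'D_(e k) f q.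
Proof.
move=> Cf; have C1 : Ck 1 (fun _ : R => f) := Cf 1%N.
have vE : (v, 0) = \sum_k v ord0 k *: e k.
  rewrite [RHS]surjective_pairing; congr (_, _).
    rewrite (big_morph fst (id1 := 0) (op1 := +%R))//= [LHS]row_sum_delta.
    by apply: eq_bigr => k _.
  rewrite (big_morph snd (id1 := 0) (op1 := +%R))//= big1// => k _.
  by rewrite /= scaler0.
rewrite vE (@tangent_sum _ _ _ _ (fun _ : R => f) 0 q _ _ _ C1).
by apply: eq_bigr => k _; rewrite (@tangentZ _ _ _ _ (fun _ : R => f) 0 q _ _ C1).
Qed.

(** The transport equation differentiated along the [i]-th axis. With the direction frozen at [q],
    transport at [(y, tau)] allows [kap (y, tau)] to be subtracted; the time components agree, and
    the remaining spatial coefficient [u q - u (y, tau)] vanishes at [y = x], so only its derivative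
    survives. *)
Lemma derive_transport q i : 0 < q.2 ->
  'D_(kap q) ('D_(e i) Fh) q = \sum_k (- 'D_(e i) u q ord0 k) *: 'D_(e k) Fh q.
Proof.
case: q => x tau /= tau0; set q := (x, tau).
rewrite (@derive_symmetric _ _ _ _ (fun _ : R => Fh) 0 q _ _ (CF 2%N)).
pose c k (y : 'rV[R]_n) := u q ord0 k - u (y, tau) ord0 k.
have E : (fun y => 'D_(kap q) Fh (y, tau)) = fun y => \sum_k c k y *: 'D_(e k) Fh (y, tau).
  apply/funext => y; rewrite -[LHS]subr0 -[X in _ - X](@transport (y, tau) tau0).
  have C1 : Ck 1 (fun _ : R => Fh) := CF 1%N.
  rewrite -scaleN1r -(@tangentZ _ _ _ _ (fun _ : R => Fh) 0 _ (-1) _ C1).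
  rewrite -(@tangentD _ _ _ _ (fun _ : R => Fh) 0 _ _ _ C1).
  have -> : kap q + -1 *: kap (y, tau) = (u q - u (y, tau), 0).
    rewrite scaleN1r /kap /characteristic/=; congr pair.
    by rewrite /= subrr.
  rewrite (derive_space _ _ CF); apply: eq_bigr => k _.
  by rewrite /c !mxE.
have Dk : derivable ('D_(kap q) Fh) q (e i).
  by apply: (@smooth_derivable _ _ _ _ (fun _ : R => 'D_(kap q) Fh) 0); exact: (@smooth_derive _ _ _ _ (fun _ => Fh)).
have [_ <-] := is_derive_fst (derivableP Dk).
rewrite E.
have Dc k : is_derive x (delta_mx ord0 i) (c k) (0 - 'D_(e i) u q ord0 k).
  apply: is_deriveB.
  have := is_derive_fst (derivableP (@smooth_derivable _ _ _ _ (fun _ : R => u) 0 q (e i) Cu)).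
  exact: is_derive_linear_comp (bounded_linear_coord k).
have DFk k : is_derive x (delta_mx ord0 i) (fun y => 'D_(e k) Fh (y, tau)) ('D_(e i) ('D_(e k) Fh) q).
  have CeF : smooth (fun _ : R => 'D_(e k) Fh) by exact: (@smooth_derive _ _ _ _ (fun _ => Fh)).
  exact: (is_derive_fst (derivableP (@smooth_derivable _ _ _ _ (fun _ : R => 'D_(e k) Fh) 0 q (e i) CeF))).
have [_ ->] := is_derive_summation (index_enum 'I_n) (fun k => is_derive_scaler (Dc k) (DFk k)).
by apply: eq_bigr => k _; rewrite /c subrr scale0r add0r sub0r.
Qed.

Definition jacobian_mx q : 'M[R]_n := \matrix_(i, j) 'D_(e i) Fh q ord0 j.

Lemma smooth_jacobian_det : smooth (fun _ : R => fun q => \det (jacobian_mx q)).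
Proof.
move=> k; apply: Ck_sum => s; apply: CkM; first exact: Ck_cst.
apply: Ck_prod => i.
apply: (@Ck_ext _ _ _ _ _ (fun (_ : R) (q : 'rV[R]_n * R) => 'D_(e i) Fh q ord0 (s i))); first by move=> _ q; rewrite mxE.
apply: (@Ck_linear_comp _ _ _ _ _ _ (fun z : 'rV[R]_n => z ord0 (s i)) (fun _ => 'D_(e i) Fh)).
  exact: bounded_linear_coord.
exact: (@smooth_derive _ _ _ _ (fun _ => Fh)).
Qed.

(** By [derive_transport] the Jacobian matrix solves a linear equation along trajectories, with
    matrix [M] minus the spatial derivative of [u]; the trace of [M] is minus the divergence. *)
Lemma derive_jacobian_det (X : R -> 'rV[R]_n) (t : R) : 0 < t -> is_derive t (1 : R) X (w (X t) t) ->
  is_derive t (1 : R) (fun s => \det (jacobian_mx (X s, Num.sqrt s)))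
    (- (\sum_i 'D_(e i) u (X t, Num.sqrt t) ord0 i) * \det (jacobian_mx (X t, Num.sqrt t))).
Proof.
move=> t0 DX; set q := (X t, Num.sqrt t).
pose M : 'M[R]_n := \matrix_(i, k) - 'D_(e i) u q ord0 k.
have -> : - (\sum_i 'D_(e i) u q ord0 i) = \tr M.
  by rewrite /mxtrace -sumrN; apply: eq_bigr => i _; rewrite mxE.
apply: is_derive_det => i j.
have CeF : smooth (fun _ : R => 'D_(e i) Fh) by exact: (@smooth_derive _ _ _ _ (fun _ => Fh)).
have := is_derive_linear_comp (bounded_linear_coord j) (is_derive_along CeF t0 DX).
rewrite -/q derive_transport; last by rewrite /= sqrtr_gt0.
move=> H; rewrite (_ : (fun s => _) = fun s => 'D_(e i) Fh (X s, Num.sqrt s) ord0 j); last first.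
  by apply/funext => s; rewrite mxE.
apply: (is_derive_eq H); rewrite summxE mxE; apply: eq_bigr => k _.
by rewrite !mxE.
Qed.

Variable rho0 : 'rV[R]_n -> R.
Hypothesis Crho : smooth (fun _ : R => rho0).

Definition density q : R := rho0 (Fh q) * \det (jacobian_mx q).

Lemma smooth_density : smooth (fun _ : R => density).
Proof.
move=> k; apply: CkM; last exact: smooth_jacobian_det.
have C0 : Ck k (fun _ : R => rho0) := Crho k.
exact: (Ck_comp C0 (CF k)).
Qed.

Lemma derive_density q : 0 < q.2 ->
  'D_(kap q) density q = - (\sum_i 'D_(e i) u q ord0 i) * density q.
Proof.
case: q => x tau /= tau0; have t0 : 0 < tau ^+ 2 by rewrite exprn_gt0.
have [X [Xt DX XF]] := curve_through x tau0.
have := is_derive_along smooth_density t0 (DX _ t0).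
rewrite sqrtr_sqr (gtr0_norm tau0) Xt => -[_ <-].
have := is_deriveZ (rho0 (X 0)) (derive_jacobian_det t0 (DX _ t0)).
rewrite sqrtr_sqr (gtr0_norm tau0) Xt => H.
have near : \forall s \near tau ^+ 2, (rho0 (X 0) \*: (fun s => \det (jacobian_mx (X s, Num.sqrt s)))) s =
    density (X s, Num.sqrt s).
  near=> s; rewrite /density XF//.
  by near: s; exact: lt_nbhsr.
have [_ ->] := near_eq_is_derive near H.
rewrite /density -[_ *: _]/(_ * _) (_ : Fh (x, tau) = X 0); first by ring.
by have := XF _ t0; rewrite sqrtr_sqr (gtr0_norm tau0) Xt.
Unshelve. all: by end_near. Qed.

(** The direction [kap] splits into the spatial part [u] and the time part [1 / (2 * tau)], which is
    differentiation in [t]; [derive_density] then is the continuity equation with the divergence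
    expanded by the product rule. *)
Lemma continuity_density x (t : R) (rho : 'rV[R]_n -> R -> R) : 0 < t ->
  (forall y s, 0 < s -> rho y s = density (y, Num.sqrt s)) -> continuity_lhs w rho x t = 0.
Proof.
move=> t0 rhoE; set tau := Num.sqrt t; have tau0 : 0 < tau by rewrite sqrtr_gt0.
set q := (x, tau).
have Cd := smooth_density; have C1 : Ck 1 (fun _ : R => density) := Cd 1%N.
have dd y v : derivable density y v := @smooth_derivable _ _ _ _ (fun _ : R => density) 0 y v Cd.
have Et : derive1 (rho x) t = 'D_(0, (2 * tau)^-1) density q.
  have near : \forall s \near t, density (x, Num.sqrt s) = rho x s.
    near=> s; rewrite rhoE//; near: s; exact: lt_nbhsr.
  have dq := is_derive_pair (is_derive_cst x t (1 : R)) (is_derive1_sqrt t0).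
  have H := is_derive_chain dd (continuous_Ck_tangent (p := (0 : R)) (Cd 1%N)) dq.
  by rewrite derive1E; have [_ ->] := near_eq_is_derive near H.
have Ex j : partial j (fun y => rho y t * w y t ord0 j) x =
    u q ord0 j * 'D_(e j) density q + density q * 'D_(e j) u q ord0 j.
  rewrite (_ : (fun y => _) = fun y => density (y, tau) * u (y, tau) ord0 j); last first.
    by apply/funext => y; rewrite rhoE.
  have D1 := is_derive_fst (derivableP (dd q (e j))).
  have D2 := is_derive_linear_comp (bounded_linear_coord j)
    (is_derive_fst (derivableP (@smooth_derivable _ _ _ _ (fun _ : R => u) 0 q (e j) Cu))).
  rewrite /partial; have [_ ->] := is_deriveM D1 D2.
  by rewrite addrC.
rewrite /continuity_lhs Et (eq_bigr _ (fun j _ => Ex j)) big_split/= -mulr_sumr.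
have := derive_density (q := q) tau0.
have -> : kap q = (u q, 0) + (0, (2 * tau)^-1).
  by rewrite /kap /characteristic; congr pair; rewrite /= ?addr0 ?add0r.
rewrite (@tangentD _ _ _ _ (fun _ : R => density) 0 _ _ _ C1) (derive_space _ _ Cd) => H.
have {}H : 'D_(0, (2 * tau)^-1) density q =
   - (\sum_i 'D_(e i) u q ord0 i) * density q - \sum_k u q ord0 k *: 'D_(e k) density q.
  by rewrite -H addrAC subrr add0r.
rewrite H.
have alg (a b c : R) : - a * b - c + (c + b * a) = 0 by ring.
exact: alg.
Unshelve. all: by end_near. Qed.

End continuity_equation.

Lemma smooth_cvg_sqrt {R : realType} {n : nat} {W : normedModType R} (f : 'rV[R]_n * R -> W) x :
  smooth (fun _ : R => f) -> f (x, Num.sqrt t) @[t --> 0^'+] --> f (x, 0).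
Proof.
move=> sf; rewrite -[in X in _ --> X](sqrtr0 R); apply: cvg_at_right_filter.
apply: (@continuous_comp _ _ _ (fun t => (x, Num.sqrt t)) f).
  by apply: continuous_at_pair; [exact: cvg_cst|exact: sqrt_continuous].
exact: (@smooth_continuous _ _ _ _ (fun _ : R => f) 0 sf).
Qed.

(** * Identification of the integral formula with the velocity *)

Section u_eps_formula.
Context {R : realType} {n : nat}.
Variables (phi : 'rV[R]_n -> R) (eps : R).
Hypotheses (bphi : bsmooth phi) (eps_gt0 : 0 < eps).

Let r := (2 * eps)^-1.
Let r_gt0 : 0 < r. Proof. by rewrite invr_gt0 mulr_gt0. Qed.

(** Substitution [y = x + sqrt t *: z]. The factor [sqrt t ^+ n] is common to numerator and
    denominator of the Gibbs average and cancels there. *)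
Lemma intg_gibbs (A : 'rV[R]_n -> R) x (t : R) : 0 < t -> bsmooth A ->
  intg (fun y => A y * gibbs phi eps x t y) =
  Num.sqrt t ^+ n * heat r (fun y => A y * boltzmann phi eps y) (x, Num.sqrt t).
Proof.
move=> t0 bA; set c := Num.sqrt t; have c0 : 0 < c by rewrite sqrtr_gt0.
pose f y := A y * gibbs phi eps x t y.
pose h z := A (x + c *: z) * boltzmann phi eps (x + c *: z) * gauss r z.
have fh z : f (x + c *: z) = h z.
  rewrite /f /h /gibbs /boltzmann /gauss -mulrA -expRD; congr (_ * expR _).
  rewrite opprD addrA subrr add0r normsqN normsqZ /r sqr_sqrtr ?(ltW t0)//.
  by field; rewrite !gt_eqF.
have ih : integ h.
  have bb : bsmooth (boltzmann phi eps) by exact: bsmooth_boltzmann.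
  exact: (integ_heat r_gt0 (x, c) (bsmoothM bA bb)).
have fi : integ f.
  have := integ_affine (- c^-1 *: x) (c := c^-1) _ ih; rewrite invr_gt0 => /(_ c0).
  congr integ; apply/funext => y; rewrite -fh; congr f.
  by rewrite scalerDr !scalerA mulrN mulfV ?gt_eqF// scaleN1r scale1r addrA subrr add0r.
by rewrite (intg_affine x c0 fi); congr (_ * intg _); apply/funext => z; exact: fh.
Qed.

Lemma gibbs_average_velocity x (t : R) : 0 < t ->
  gibbs_average phi eps x t = velocity phi eps (x, Num.sqrt t).
Proof.
move=> t0; apply/rowP => i; rewrite !mxE.
have c0 : 0 < Num.sqrt t by rewrite sqrtr_gt0.
have Z0 := heat_boltzmann_gt0 bphi eps_gt0 (x, Num.sqrt t).
have E1 := intg_gibbs x t0 (bsmooth_partial i bphi).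
have E2 := intg_gibbs x t0 (bsmooth_cst n 1).
have -> : \int[lebesgue_rV n]_y (gradient phi y ord0 i * gibbs phi eps x t y) =
    intg (fun y => partial i phi y * gibbs phi eps x t y).
  by apply: eq_Rintegral => y _; rewrite mxE.
have -> : \int[lebesgue_rV n]_y gibbs phi eps x t y = intg (fun y => 1 * gibbs phi eps x t y).
  by apply: eq_Rintegral => y _; rewrite mul1r.
have E3 : heat r (fun y => 1 * boltzmann phi eps y) (x, Num.sqrt t) = heat r (boltzmann phi eps) (x, Num.sqrt t).
  by congr heat; apply/funext => y; rewrite mul1r.
rewrite E1 E2 E3.
have alg (k a Z : R) : k != 0 -> Z != 0 -> k * a / (k * Z) = a / Z by move=> k0 Z1; field; rewrite k0 Z1.
by apply: alg; rewrite gt_eqF// exprn_gt0.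
Qed.

End u_eps_formula.

(** At [t = 0] the defining limit is found from continuity of the velocity in [tau]; for [t < 0]
    both sides repeat that value, [Num.sqrt] being 0 there. *)
Lemma u_epsE {R : realType} {n : nat} (phi0 : 'rV[R]_n -> R) (eps : R) : 0 < eps -> bsmooth (mollify phi0 eps) ->
  u_eps phi0 eps = fun x t => velocity (mollify phi0 eps) eps (x, Num.sqrt t).
Proof.
move=> e0 bphi; apply/funext => x; apply/funext => t; rewrite /u_eps.
case: ltP => t0; first exact: gibbs_average_velocity.
rewrite ler0_sqrtr//; apply: cvg_lim; first exact: norm_hausdorff.
apply: cvg_trans; last exact: (smooth_cvg_sqrt (x := x) (smooth_velocity bphi e0)).
by apply: near_eq_cvg; near=> s; rewrite gibbs_average_velocity.
Unshelve. all: by end_near. Qed.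

(** * Truncation of essentially bounded functions *)

Section truncation.
Context {R : realType} {n : nat}.
Implicit Types f g : 'rV[R]_n -> R.
Local Notation mu := (lebesgue_rV n).

(** The norm with exponent [+oo] is an essential supremum only when the whole space has positive
    measure. *)
Lemma lebesgue_rV_gt0 : (0 < mu [set: 'rV[R]_n])%E.
Proof.
apply: (@lt_le_trans _ _ (mu [set x : 'rV[R]_n | forall i : 'I_n, `[0, 1]%classic (x ord0 i)])).
  rewrite (@lebesgue_rV_box R n (fun _ => `[0, 1]%classic))// big1 ?lte01// => i _.
  by rewrite lebesgue_measure_itv/= lte01 sube0.
apply: le_measure; rewrite ?inE//.
by apply: (@measurable_box R n (fun _ => `[0, 1]%classic)).
Qed.

(** An essential bound holds off a null set, whereas the convolution estimates ask for a pointwise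
    one; clipping to [[- B, B]] changes the function on a null set only. *)
Lemma Linfty_truncation f : Linfty f -> measurable_fun setT f /\
  exists g, exists B, [/\ 0 <= B, measurable_fun setT g, forall x, `|g x| <= B & {ae mu, forall x, f x = g x}].
Proof.
rewrite /Linfty inE/= => /andP[]; rewrite !inE/= => mf.
rewrite /finite_norm unlock lebesgue_rV_gt0 => fB.
split=> //.
have [B [B0 HB]] : exists B : R, 0 <= B /\ (ess_sup mu (abse \o (EFin \o f)) <= B%:E)%E.
  move: fB; case: (ess_sup mu _) => [s _||_]; [|by rewrite ltxx|by exists 0; rewrite leNye].
  by exists (Num.max s 0); rewrite le_max lexx orbT lee_fin le_max lexx.
exists (fun x => Num.max (- B) (Num.min (f x) B)), B; split=> //.
- by apply: measurable_maxr => //; exact: measurable_minr.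
- move=> x; rewrite ler_norml le_max lexx/= ge_max ge_min lexx orbT andbT.
  by rewrite (le_trans _ B0)// oppr_le0.
- move/ess_supP : HB; apply: filterS => x /=; rewrite lee_fin ler_norml => /andP[f1 f2].
  by rewrite min_l// max_r.
Qed.

Lemma ae_eq_integral_mul f g h : measurable_fun setT f -> measurable_fun setT g ->
  measurable_fun setT h -> {ae mu, forall x, f x = g x} ->
  (\int[mu]_x (f x * h x)%:E = \int[mu]_x (g x * h x)%:E)%E.
Proof.
move=> mf mg mh fg; apply: ae_eq_integral => //.
- by apply/measurable_EFinP; exact: measurable_funM.
- by apply/measurable_EFinP; exact: measurable_funM.
- by apply: filterS fg => x -> _.
Qed.

Lemma ae_eq_integ f g : measurable_fun setT f ->
  {ae mu, forall x, f x = g x} -> integ g -> integ f.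
Proof.
move=> mf fg ig; have mg := integ_measurable ig; move/integrableP: ig => [_ ig].
apply/integrableP; split; first exact/measurable_EFinP.
rewrite (ae_eq_integral (fun x => `|(EFin \o g) x|%E))//.
- by apply: measurableT_comp => //; exact/measurable_EFinP.
- by apply: measurableT_comp => //; exact/measurable_EFinP.
- by apply: filterS fg => x /= -> _.
Qed.

Lemma integral_intg f : integ f -> (\int[mu]_x (f x)%:E = (intg f)%:E)%E.
Proof. by move=> fi; rewrite /intg/Rintegral fineK//; exact: (integrable_fin_num measurableT fi). Qed.

Lemma mollify_conv f g (e : R) : measurable_fun setT f -> measurable_fun setT g -> 0 < e ->
  {ae mu, forall x, f x = g x} -> mollify f e = conv g (friedrichs_eps e).
Proof.
move=> mf mg e0 fg; apply/funext => x; rewrite /mollify /conv /intg /Rintegral; congr fine.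
apply: ae_eq_integral_mul => //; apply: measurable_reflect.
exact: csmooth_measurable (csmooth_friedrichs_eps e0).
Qed.

(** The test function is bounded and vanishes off a compact ball, on which local integrability
    applies. *)
Lemma loc_integrable_integ f r eta : loc_integrable f -> csmooth r eta -> integ (fun x => f x * eta x).
Proof.
move=> [mf lf] ceta; have [D HD] := bsmooth_bounded ceta.1.
have D0 : 0 <= D := le_trans (normr_ge0 _) (HD 0).
have mE := csmooth_measurable ceta.
pose K := [set x : 'rV[R]_n | `|x| <= r + 1].
have cK : compact K by exact: closed_ball_compact.
have mK : measurable K.
  have -> : K = ~` [set x : 'rV[R]_n | r + 1 < `|x|].
    by apply/seteqP; split => x /=; rewrite /K/= leNgt => /negP.
  apply: measurableC; apply: open_measurable_rV.
  apply: (@open_comp _ _ (fun x : 'rV[R]_n => `|x|) [set s | r + 1 < s]); last exact: open_gt.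
  by move=> x _; exact: norm_continuous.
have KE x : ~ K x -> eta x = 0.
  move=> Kx; apply: ceta.2; rewrite ltNge; apply/negP => xr; apply: Kx.
  exact: normsq_le_norm.
apply/integrableP; split; first by apply/measurable_EFinP; exact: measurable_funM.
rewrite (_ : (fun x => _) = (fun x => `|f x * eta x|%:E) \_ K); last first.
  apply/funext => x; rewrite patchE; case: ifPn => // /negP; rewrite inE => /KE /= ->.
  by rewrite mulr0 normr0.
rewrite -integral_mkcond.
apply: (@le_lt_trans _ _ (\int[mu]_(x in K) (D%:E * `|f x|%:E))%E).
  apply: ge0_le_integral => //.
  - apply/measurable_EFinP; apply: measurable_funTS.
    exact: (measurableT_comp (@normr_measurable R setT) (measurable_funM mf mE)).
  - apply/measurable_funeM/measurable_EFinP; apply: measurable_funTS.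
    exact: (measurableT_comp (@normr_measurable R setT) mf).
  - by move=> x _; rewrite -EFinM lee_fin normrM mulrC ler_wpM2r.
rewrite ge0_integralZl//.
- by rewrite lte_mul_pinfty// lf.
- apply/measurable_EFinP; apply: measurable_funTS.
  exact: (measurableT_comp (@normr_measurable R setT) mf).
Qed.

End truncation.

Section smooth_on_eq.
Context {R : realType} {V W : normedModType R}.

Lemma smooth_on_eq (U : set V) (f g : V -> W) : open U ->
  (forall x, U x -> f x = g x) -> smooth_on U g -> smooth_on U f.
Proof.
move=> oU fg sg vs x Ux.
have nearU y (Q : V -> Prop) : U y -> (forall z, U z -> Q z) -> \forall z \near y, Q z.
  by move=> Uy UQ; apply: (@filterS _ _ (nbhs_filter y) U) => //; exact: open_nbhs_nbhs.
have E ws : forall y, U y -> iter_derive ws f y = iter_derive ws g y.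
  elim: ws => [|v ws IH] y Uy /=; first exact: fg.
  by apply: near_eq_derive; exact: nearU.
have [dg cg] := sg vs x Ux; split.
  move=> v; apply: near_eq_derivable (dg v).
  by apply: nearU => // z Uz; rewrite E.
rewrite /prop_for /continuous_at (E vs x Ux).
apply: cvg_trans cg; apply: near_eq_cvg.
by apply: nearU => // z Uz; rewrite E.
Qed.

End smooth_on_eq.

(** * Pairings with test functions and convergence of the initial data *)

Section pairings.
Context {R : realType} {n : nat}.
Local Notation mu := (lebesgue_rV n).

Lemma cvg0_linear_bound (h : R -> R) (C : R) :
  (forall e, 0 < e <= 1 -> `|h e| <= C * e) -> h e @[e --> 0^'+] --> 0.
Proof.
move=> hC; apply/cvgrPdist_lt => d d0; near=> e.
have e01 : 0 < e <= 1.
  by apply/andP; split; near: e; [exact: nbhs_right_gt|exact: nbhs_right_le].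
rewrite sub0r normrN; apply: le_lt_trans (hC e e01) _.
have C1 : 0 < `|C| + 1 by rewrite ltr_wpDl.
have e0 : 0 < e by case/andP: e01.
apply: (@le_lt_trans _ _ ((`|C| + 1) * e)).
  by rewrite ler_wpM2r ?(ltW e0)// (le_trans (ler_norm C))// lerDl.
rewrite mulrC -ltr_pdivlMr//; near: e.
by apply: nbhs_right_lt; rewrite divr_gt0.
Unshelve. all: by end_near. Qed.

(** Integrability is part of the relation because the pairings of [o_distr] are extended-valued
    integrals: that of [f] must be known to be finite before it can be subtracted. *)
Definition dual_eq (f g : 'rV[R]_n -> R) := forall r eta, csmooth r eta ->
  integ (fun x => f x * eta x) /\ intg (fun x => f x * eta x) = intg (fun x => g x * eta x).

(** The bounded [g] is mollified while the claim concerns [f]; equality of pairings bridges the two,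
    and the error is [O(e)] for each fixed test function. *)
Lemma o_distr_conv (f g : 'rV[R]_n -> R) (B : R) (F : R -> 'rV[R]_n -> R) : measurable_fun setT g ->
  (forall x, `|g x| <= B) -> dual_eq f g ->
  (forall e, 0 < e -> F e = conv g (friedrichs_eps e)) ->
  o_distr (fun e x => F e x - f x).
Proof.
move=> mg gB fg FE eta /test_function_csmooth [r ceta].
have [fi fgE] := fg _ _ ceta; have [C HC] := conv_friedrichs_weak mg gB ceta.
pose h e := intg (fun x => conv g (friedrichs_eps e) x * eta x) - intg (fun x => g x * eta x).
have E (e : R) : 0 < e -> (\int[mu]_x ((F e x - f x) * eta x)%:E)%E = (h e)%:E.
  move=> e0; rewrite FE//.
  have bc := conv_bsmooth mg gB (csmooth_friedrichs_eps e0).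
  have ci : integ (fun x => conv g (friedrichs_eps e) x * eta x).
    exact: csmooth_integ (csmoothM bc ceta).
  rewrite /h -fgE -intgB// -integral_intg; last exact: integB.
  by apply: eq_integral => x _; rewrite mulrBl.
apply: (@cvg_trans _ ((h e)%:E @[e --> 0^'+])).
  by apply: near_eq_cvg; near=> e; rewrite E.
apply: cvg_EFin; first by near=> e.
exact: cvg0_linear_bound HC.
Unshelve. all: by end_near. Qed.

Lemma dual_eq_ae (f g : 'rV[R]_n -> R) (B : R) : measurable_fun setT f -> measurable_fun setT g ->
  (forall x, `|g x| <= B) -> {ae mu, forall x, f x = g x} -> dual_eq f g.
Proof.
move=> mf mg gB fg r eta ceta.
have gi : integ (fun x => g x * eta x) by exact: integ_bounded_mul mg gB _ (csmooth_integ ceta).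
have me := csmooth_measurable ceta.
split.
  apply: ae_eq_integ gi; first exact: measurable_funM.
  by apply: filterS fg => x ->.
by rewrite /intg /Rintegral (@ae_eq_integral_mul _ _ f g).
Qed.

(** The Sobolev hypothesis gives one weak gradient with essentially bounded components, while [u0]
    is an arbitrary one. They are compared by duality: both pair with [eta] to minus the integral of
    [phi] times the derivative of [eta]. Summing the [n] bounds gives a common [B]. *)
Lemma W1infty_truncation (phi0 : 'rV[R]_n -> R) : W1infty phi0 ->
  exists (phi : 'rV[R]_n -> R) (g : 'I_n -> 'rV[R]_n -> R) (B0 B : R),
  [/\ measurable_fun setT phi0,
      [/\ measurable_fun setT phi, forall x, `|phi x| <= B0 & {ae mu, forall x, phi0 x = phi x}],
      0 <= B /\ (forall i, measurable_fun setT (g i) /\ forall x, `|g i x| <= B),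
      forall i r eta, csmooth r eta ->
        intg (fun x => phi x * partial i eta x) = - intg (fun x => g i x * eta x) &
      forall u0, weak_gradient phi0 u0 -> forall i, dual_eq (fun x => u0 x ord0 i) (g i)].
Proof.
move=> [/Linfty_truncation[mphi0 [phi [B0 [B0_ge0 mphi phiB phi0E]]]] [g0 wg0 Lg0]].
have /choice[g Hg] : forall i : 'I_n, exists g : 'rV[R]_n -> R, exists B : R, [/\ 0 <= B, measurable_fun setT g,
    forall x, `|g x| <= B & {ae mu, forall x, g0 x ord0 i = g x}].
  by move=> i; have [_] := Linfty_truncation (Lg0 i).
have /choice[b Hb] := Hg.
have mg i : measurable_fun setT (g i) by case: (Hb i).
have mg0 i : measurable_fun setT (fun x => g0 x ord0 i) by have [[]] := wg0 i.
have gb i x : `|g i x| <= b i by case: (Hb i).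
have b0 i : 0 <= b i by case: (Hb i).
have gE i : {ae mu, forall x, g0 x ord0 i = g i x} by case: (Hb i).
have gi i r eta : csmooth r eta -> integ (fun x => g i x * eta x).
  by move=> ceta; exact: integ_bounded_mul (mg i) (gb i) _ (csmooth_integ ceta).
have key (v : 'rV[R]_n -> 'rV[R]_n) i r eta : weak_gradient phi0 v -> csmooth r eta ->
    (\int[mu]_x (v x ord0 i * eta x)%:E)%E = (- intg (fun x => phi x * partial i eta x))%:E.
  move=> wv ceta; have cd := csmooth_partial i ceta.
  have [_ /(_ eta (csmooth_test_function ceta))] := wv i.
  rewrite (ae_eq_integral_mul mphi0 mphi (csmooth_measurable cd) phi0E) integral_intg; last first.
    exact: integ_bounded_mul mphi phiB _ (csmooth_integ cd).
  by move=> H; rewrite EFinN H oppeK.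
exists phi, g, B0, (\sum_i b i); split=> //.
- split; first by rewrite sumr_ge0.
  move=> i; split=> // x; apply: le_trans (gb i x) _.
  by rewrite (bigD1 i)//= lerDl sumr_ge0.
- move=> i r eta ceta; have := key g0 i r eta wg0 ceta.
  rewrite (ae_eq_integral_mul (mg0 i) (mg i) (csmooth_measurable ceta) (gE i)).
  by rewrite (integral_intg (gi _ _ _ ceta)) => -[->]; rewrite opprK.
- move=> u0 wu0 i r eta ceta.
  have iu : integ (fun x => u0 x ord0 i * eta x).
    by apply: loc_integrable_integ ceta; have [] := wu0 i.
  split=> //; apply: EFin_inj; rewrite -integral_intg// (key _ _ _ _ wu0 ceta).
  rewrite -(key g0 i r eta wg0 ceta).
  rewrite (ae_eq_integral_mul (mg0 i) (mg i) (csmooth_measurable ceta) (gE i)).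
  by rewrite (integral_intg (gi _ _ _ ceta)).
Qed.

End pairings.

(** * The density formula in terms of the foot map *)

Section density_formula.
Context {R : realType} {n : nat}.

Lemma rho_eps_foot (phi0 rho0 : 'rV[R]_n -> R) eps x t (F : 'rV[R]_n -> 'rV[R]_n) :
  (fun y => flow (u_eps phi0 eps) y t 0) = F ->
  rho_eps phi0 rho0 eps x t = mollify rho0 eps (F x) * \det ('J F x).
Proof. by move=> <-. Qed.

Lemma jacobian_mx_foot (Fh : 'rV[R]_n * R -> 'rV[R]_n) x (s : R) :
  smooth (fun _ : R => Fh) -> 'J (fun y => Fh (y, s)) x = jacobian_mx Fh (x, s).
Proof.
move=> sF; apply/matrixP => i j; rewrite [RHS]mxE.
have sFs : smooth (fun (_ : R) (y : 'rV[R]_n) => Fh (y, s)).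
  move=> k; apply: (@Ck_comp _ _ _ _ _ _ (fun _ => Fh) (fun _ y => (y, s))); first exact: sF.
  by apply: Ck_pair; [exact: Ck_id|exact: Ck_cst].
apply: (etrans (@jacobianE R R n n (fun (_ : R) y => Fh (y, s)) 0 x i j (sFs 1%N))).
have DF : is_derive (x, s) (delta_mx ord0 i, 0) Fh ('D_(delta_mx ord0 i, 0) Fh (x, s)).
  apply: DeriveDef => //.
  exact: (@smooth_derivable _ _ _ _ (fun _ : R => Fh) 0 (x, s) (delta_mx ord0 i, 0) sF).
by rewrite /partial; have [_ ->] := is_derive_fst DF.
Qed.

Lemma det_jacobian_id (x : 'rV[R]_n) : \det ('J (fun y : 'rV[R]_n => y) x) = 1.
Proof.
rewrite -(det1 R n); congr (\det _); apply/matrixP => i j; rewrite [RHS]mxE.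
rewrite (@jacobianE _ _ _ _ (fun (_ : R) (y : 'rV[R]_n) => y) 0); last exact: Ck_id.
by rewrite /partial derive_id mxE eqxx/= eq_sym.
Qed.

Variables (phi0 rho0 : 'rV[R]_n -> R) (eps B : R).
Hypotheses (eps_gt0 : 0 < eps) (bphi : bsmooth (mollify phi0 eps)) (B_ge0 : 0 <= B).
Hypothesis (phiB : forall i y, `|partial i (mollify phi0 eps) y| <= B).
Hypothesis (srho : smooth (fun _ : R => mollify rho0 eps)).

(** For fixed [eps] the results on characteristics apply to the velocity of the mollified potential.
    At [t = 0] the foot map is the identity, with Jacobian 1, so the initial density is the
    mollified [rho0]. *)
Lemma rho_eps_density : exists Fh, [/\ smooth (fun _ : R => Fh),
  forall x t, 0 <= t -> rho_eps phi0 rho0 eps x t = density Fh (mollify rho0 eps) (x, Num.sqrt t),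
  forall x, rho_eps phi0 rho0 eps x 0 = mollify rho0 eps x &
  forall x t, 0 < t -> continuity_lhs (u_eps phi0 eps) (rho_eps phi0 rho0 eps) x t = 0].
Proof.
pose u := velocity (mollify phi0 eps) eps.
have su : smooth (fun _ : R => u) by exact: smooth_velocity.
have [L L0 uL] := lipschitz_velocity bphi eps_gt0.
have uB q : `|u q| <= B by exact: velocity_bound.
have uE : u_eps phi0 eps = fun x t => u (x, Num.sqrt t) by exact: u_epsE.
have [Fh [sF FhE]] := foot_smooth su L0 uL B_ge0 uB.
have footE t : 0 <= t -> (fun y => flow (u_eps phi0 eps) y t 0) = fun y => Fh (y, Num.sqrt t).
  by move=> t0; apply/funext => y; rewrite uE FhE.
have rE x t : 0 <= t -> rho_eps phi0 rho0 eps x t = density Fh (mollify rho0 eps) (x, Num.sqrt t).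
  by move=> t0; rewrite (rho_eps_foot _ _ (footE t t0)) (jacobian_mx_foot _ _ sF).
exists Fh; split=> //.
- move=> x; have F0 : (fun y => flow (u_eps phi0 eps) y 0 0) = id.
    by apply/funext => y; rewrite uE; exact: (flow0 su L0 uL B_ge0 uB).
  by rewrite (rho_eps_foot _ _ F0) det_jacobian_id mulr1.
- move=> x t t0; rewrite uE.
  exact: (@continuity_density _ _ u L B su L0 uL B_ge0 uB Fh sF FhE _ srho x t (rho_eps phi0 rho0 eps)
    t0 (fun y s s0 => rE y s (ltW s0))).
Qed.

End density_formula.

Theorem theorem4p1 (R : realType) (n : nat) (n_gt0 : (0 < n)%N)
  (phi0 : 'rV[R]_n -> R) (u0 : 'rV[R]_n -> 'rV[R]_n) (rho0 : 'rV[R]_n -> R)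
  (phi0_W1infty : W1infty phi0) (u0_grad : weak_gradient phi0 u0)
  (rho0_Linfty : Linfty rho0) :
  weak_asymptotic_solution u0 rho0 (u_eps phi0) (rho_eps phi0 rho0).
Proof.
have [phi [g [B0 [B [mphi0 [mphi phiB phi0E] [B_ge0 gB] phig u0g]]]]] := W1infty_truncation phi0_W1infty.
have [mrho0 [rho [Br [_ mrho rhoB rho0E]]]] := Linfty_truncation rho0_Linfty.
have pE e : 0 < e -> mollify phi0 e = conv phi (friedrichs_eps e).
  by move=> e0; exact: mollify_conv.
have rE e : 0 < e -> mollify rho0 e = conv rho (friedrichs_eps e).
  by move=> e0; exact: mollify_conv.
have bp e : 0 < e -> bsmooth (mollify phi0 e).
  by move=> e0; rewrite pE//; exact: conv_bsmooth mphi phiB _ _ (csmooth_friedrichs_eps e0).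
have sr e : 0 < e -> smooth (fun _ : R => mollify rho0 e).
  by move=> e0; rewrite rE//; exact: (conv_bsmooth mrho rhoB (csmooth_friedrichs_eps e0)).1.
(* Mollification commutes with the weak gradient; the bound [B] in [dB] is therefore the same for
   all [e]. *)
have dp e i : 0 < e -> partial i (mollify phi0 e) = conv (g i) (friedrichs_eps e).
  move=> e0; apply/funext => x; rewrite pE//.
  exact: (partial_conv_weak mphi phiB (phig i) _ (csmooth_friedrichs_eps e0)).
have dB e (i : 'I_n) y : 0 < e -> `|partial i (mollify phi0 e) y| <= B.
  by move=> e0; rewrite dp//; have [mgi gBi] := gB i; exact: conv_friedrichs_le.
have den e (e0 : 0 < e) := rho_eps_density e0 (bp e e0) B_ge0 (fun i y => dB e i y e0) (sr e e0).
have uE e (e0 : 0 < e) := u_epsE e0 (bp e e0).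
have openU : open [set p : 'rV[R]_n * R | 0 < p.2].
  apply: (@open_comp _ _ (fun p : 'rV[R]_n * R => p.2) [set s | 0 < s]).
    by move=> p _; exact: cvg_snd.
  exact: open_gt.
split.
- split=> e e0.
    rewrite uE//; split.
      exact: (@smooth_on_sqrt _ _ _ _ (fun _ : R => velocity (mollify phi0 e) e) 0 (smooth_velocity (bp e e0) e0)).
    by move=> x; rewrite sqrtr0; exact: smooth_cvg_sqrt (smooth_velocity (bp e e0) e0).
  have [Fh [sF rF r0 _]] := den e e0.
  have sd := smooth_density sF (sr e e0).
  split.
    apply: (smooth_on_eq openU) (@smooth_on_sqrt _ _ _ _ (fun _ : R => density Fh (mollify rho0 e)) 0 sd).
    by move=> p p0; rewrite rF// ltW.
  move=> x; rewrite rF// sqrtr0.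
  apply: cvg_trans (@smooth_cvg_sqrt _ _ _ _ x sd).
  by apply: near_eq_cvg; near=> t; rewrite rF.
- move=> i eta /test_function_csmooth[r ceta] d d0.
  (* [C] depends on [eta] and [B] only, which makes the bound [e / 2 * C] uniform in [t]. *)
  pose C := \sum_j B * intg (fun x : 'rV_n => `|partial j (partial j eta) x|).
  near=> e => t t0.
  have e0 : 0 < e by [].
  rewrite uE// (integral_intg (integ_burgers_velocity (bp e e0) e0 i t0 ceta)).
  rewrite [X in (X < _)%E](_ : _ = (`|intg (fun x => burgers_lhs
    (fun y s => velocity (mollify phi0 e) e (y, Num.sqrt s)) x t ord0 i * eta x)|)%:E)//.
  rewrite lte_fin.
  apply: le_lt_trans (burgers_velocity_bound (bp e e0) e0 i t0 ceta B_ge0 (fun i y => dB e i y e0)) _.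
  rewrite -/C.
  have C1 : 0 < `|C| + 1 by rewrite ltr_wpDl.
  apply: (@le_lt_trans _ _ (e * (`|C| + 1))).
    rewrite -mulrA ler_pM2l//.
    by have := ler_norm C; have := normr_ge0 C; lra.
  rewrite -ltr_pdivlMr//; near: e.
  by apply: nbhs_right_lt; rewrite divr_gt0.
- move=> eta _ d d0; near=> e => t t0.
  have e0 : 0 < e by [].
  have [Fh [_ _ _ c0]] := den e e0.
  rewrite integral0_eq ?abse0 ?lte_fin// => x _.
  by rewrite c0// mul0r.
- move=> i; have [mgi gBi] := gB i.
  have H := o_distr_conv mgi gBi (u0g _ u0_grad i) (F := fun e x => u_eps phi0 e x 0 ord0 i).
  rewrite (_ : (fun e x => _) = fun e x => u_eps phi0 e x 0 ord0 i - u0 x ord0 i); last first.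
    by apply/funext => e; apply/funext => x; rewrite !mxE.
  (* At [t = 0] the velocity is the gradient of the mollified potential, that is, the mollification
     of [g i] in each component. *)
  apply: H => e e0; rewrite uE// -dp//; apply/funext => x.
  by rewrite sqrtr0 velocity0// mxE.
- apply: (o_distr_conv mrho rhoB (dual_eq_ae mrho0 mrho rhoB rho0E)) => e e0.
  by have [Fh [_ _ r0 _]] := den e e0; rewrite -rE//; apply/funext.
Unshelve. all: by end_near. Qed.
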